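(* Let $M$ be any model of $\mathrm{ZF}$. The following are equivalent. (1) $M$ is a model of $\mathrm{ZFC}+V=\mathrm{HOD}$. (2) $M$ thinks there is a definable well-ordering of the universe. (3) Every definable nonempty set in $M$ has a definable element. (4) Every definable nonempty set in $M$ has an ordinal-definable element. (5) Every ordinal-definable nonempty set in $M$ has an ordinal-definable element. (6) Every $\Pi_2$-definable nonempty set in $M$ has an ordinal-definable element.
   Context: Models are models of the language of set theory $\{\in\}$ and need not be well-founded or $\omega$-standard. An object $a$ of $M$ is definable in $M$ if there is a formula $\varphi$ (without parameters) in the language of set theory such that $a$ is the unique satisfying instance of $\varphi$ in $M$, i.e. $M\models\varphi[x]$ if and only if $x=a$. This is an external, model-theoretic notion. The object $a$ is $\Pi_2$-definable if there is such a defining formula $\varphi$ of complexity $\Pi_2$ in the Lévy hierarchy. An object is ordinal-definable if it is the unique satisfying instance in $M$ of a formula $\varphi(\cdot,\vec\alpha)$ with ordinal parameters $\vec\alpha$ of $M$. Equivalently, $M$ satisfies the first-order assertion $a\in\mathrm{OD}$, that there is an ordinal $\theta$ such that $a$ is definable with ordinal parameters inside the structure $\langle V_\theta,\in\rangle$. $\mathrm{HOD}$ is the class of hereditarily ordinal-definable sets, and $V=\mathrm{HOD}$ is the sentence asserting that every set is hereditarily ordinal-definable. A definable well-ordering of the universe in (2) is a well-ordering relation on all of $M$ (as $M$ sees it) that is defined in $M$ by a formula without parameters. *)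

(* Defs.v *)
From Stdlib Require Import Arith List.
Import ListNotations.

(* Formulas of the language of set theory.  Variables are de Bruijn indices:
   the variable bound by the innermost enclosing quantifier is 0. *)
Inductive fml : Type :=
| Mem (x y : nat)
| Eq (x y : nat)
| Not (p : fml)
| And (p q : fml)
| Or (p q : fml)
| Imp (p q : fml)
| All (p : fml)
| Ex (p : fml).

Definition Iff (p q : fml) : fml := And (Imp p q) (Imp q p).

Declare Scope fml_scope.
Delimit Scope fml_scope with fml.
Bind Scope fml_scope with fml.
Notation "x ∈ y" := (Mem x y) (at level 70) : fml_scope.
Notation "x ≡ y" := (Eq x y) (at level 70) : fml_scope.
Notation "¬ p" := (Not p) (at level 75, right associativity) : fml_scope.
Notation "p ∧ q" := (And p q) (at level 80, right associativity) : fml_scope.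
Notation "p ∨ q" := (Or p q) (at level 85, right associativity) : fml_scope.
Notation "p ↔ q" := (Iff p q) (at level 95, no associativity) : fml_scope.
Notation "p → q" := (Imp p q) (at level 99, q at level 200, right associativity) : fml_scope.

(* The bound [y] is read outside the new quantifier, so it cannot be the
   quantified variable. *)
Definition BAll (y : nat) (p : fml) : fml := All (0 ∈ S y → p).
Definition BEx (y : nat) (p : fml) : fml := Ex (0 ∈ S y ∧ p).

Fixpoint free_below (n : nat) (p : fml) : Prop :=
  match p with
  | Mem x y | Eq x y => x < n /\ y < n
  | Not p => free_below n p
  | And p q | Or p q | Imp p q => free_below n p /\ free_below n q
  | All p | Ex p => free_below (S n) p
  end.

Definition up (f : nat -> nat) (i : nat) : nat :=
  match i with 0 => 0 | S j => S (f j) end.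

Fixpoint rename (f : nat -> nat) (p : fml) : fml :=
  match p with
  | Mem x y => Mem (f x) (f y)
  | Eq x y => Eq (f x) (f y)
  | Not p => Not (rename f p)
  | And p q => And (rename f p) (rename f q)
  | Or p q => Or (rename f p) (rename f q)
  | Imp p q => Imp (rename f p) (rename f q)
  | All p => All (rename (up f) p)
  | Ex p => Ex (rename (up f) p)
  end.

(* [at1 p x k] is p(x, params) and [at2 p x y k] is p(x, y, params): the
   remaining free variables of [p] are parameters, to be read under [k]
   binders. *)
Definition at1 (p : fml) (x k : nat) : fml :=
  rename (fun i => match i with 0 => x | S j => k + j end) p.
Definition at2 (p : fml) (x y k : nat) : fml :=
  rename (fun i => match i with 0 => x | 1 => y | S (S j) => k + j end) p.

(* Lévy hierarchy; blocks of like quantifiers are allowed. *)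
Inductive Delta0 : fml -> Prop :=
| Delta0_Mem x y : Delta0 (x ∈ y)
| Delta0_Eq x y : Delta0 (x ≡ y)
| Delta0_Not p : Delta0 p -> Delta0 (¬ p)
| Delta0_And p q : Delta0 p -> Delta0 q -> Delta0 (p ∧ q)
| Delta0_Or p q : Delta0 p -> Delta0 q -> Delta0 (p ∨ q)
| Delta0_Imp p q : Delta0 p -> Delta0 q -> Delta0 (p → q)
| Delta0_BAll y p : Delta0 p -> Delta0 (BAll y p)
| Delta0_BEx y p : Delta0 p -> Delta0 (BEx y p).

Inductive Sigma : nat -> fml -> Prop :=
| Sigma_0 p : Delta0 p -> Sigma 0 p
| Sigma_Pi n p : Pi n p -> Sigma (S n) p
| Sigma_Ex n p : Sigma (S n) p -> Sigma (S n) (Ex p)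
with Pi : nat -> fml -> Prop :=
| Pi_0 p : Delta0 p -> Pi 0 p
| Pi_Sigma n p : Sigma n p -> Pi (S n) p
| Pi_All n p : Pi (S n) p -> Pi (S n) (All p).

(* No well-foundedness or omega-standardness is required of [mem]. *)
Record structure : Type := {
  carrier :> Type;
  mem : carrier -> carrier -> Prop;
  carrier_inhabited : inhabited carrier
}.
Arguments mem {_} _ _.

Definition scons {M : Type} (x : M) (rho : nat -> M) (i : nat) : M :=
  match i with 0 => x | S j => rho j end.

Fixpoint sat {M : structure} (rho : nat -> M) (p : fml) : Prop :=
  match p with
  | Mem x y => mem (rho x) (rho y)
  | Eq x y => rho x = rho y
  | Not p => ~ sat rho p
  | And p q => sat rho p /\ sat rho q
  | Or p q => sat rho p \/ sat rho q
  | Imp p q => sat rho p -> sat rho q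
  | All p => forall a : M, sat (scons a rho) p
  | Ex p => exists a : M, sat (scons a rho) p
  end.

(* Truth of the universal closure. *)
Definition models (M : structure) (p : fml) : Prop :=
  forall rho : nat -> M, sat rho p.

Definition models_theory (M : structure) (T : fml -> Prop) : Prop :=
  forall p, T p -> models M p.

(* Below, the arguments of a defined formula are variables, and an argument
   [x] is written [k + x] under [k] further quantifiers. *)

Definition is_subset (x y : nat) : fml := BAll x (0 ∈ 1 + y).
Definition is_empty (x : nat) : fml := All (¬ 0 ∈ 1 + x).
(* y = x ∪ {x} *)
Definition is_succ (y x : nat) : fml := All (0 ∈ 1 + y ↔ 0 ∈ 1 + x ∨ 0 ≡ 1 + x).
(* z = {x, y} *)
Definition is_pair (z x y : nat) : fml := All (0 ∈ 1 + z ↔ 0 ≡ 1 + x ∨ 0 ≡ 1 + y).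
(* z = (x, y) = {{x}, {x, y}} *)
Definition is_opair (z x y : nat) : fml :=
  Ex (Ex (is_pair 1 (2 + x) (2 + x) ∧ is_pair 0 (2 + x) (2 + y)
          ∧ is_pair (2 + z) 1 0)).
(* (x, y) ∈ f *)
Definition maps (f x y : nat) : fml := BEx f (is_opair 0 (1 + x) (1 + y)).
(* f is a function with domain d *)
Definition is_fun (f d : nat) : fml :=
  BAll f (BEx (1 + d) (Ex (is_opair 2 1 0)))
  ∧ BAll d (Ex (maps (2 + f) 1 0 ∧ All (maps (3 + f) 2 0 → 0 ≡ 1))).
(* f is a function from d to A *)
Definition is_fun_into (f d A : nat) : fml :=
  is_fun f d ∧ All (All (maps (2 + f) 1 0 → 0 ∈ 2 + A)).

Definition is_transitive (x : nat) : fml := BAll x (is_subset 0 (1 + x)).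
(* Von Neumann ordinals, in the presence of Foundation. *)
Definition is_ord (x : nat) : fml :=
  is_transitive x ∧ BAll x (BAll (1 + x) (0 ∈ 1 ∨ 0 ≡ 1 ∨ 1 ∈ 0)).
Definition is_zero_or_succ (x : nat) : fml := is_empty x ∨ Ex (is_succ (1 + x) 0).
(* x ∈ ω, which may be nonstandard *)
Definition is_nat (x : nat) : fml :=
  is_ord x ∧ is_zero_or_succ x ∧ BAll x (is_zero_or_succ 0).

Definition ax_extensionality : fml :=
  All (All (All (0 ∈ 1 ↔ 0 ∈ 2) → 0 ≡ 1)).
Definition ax_foundation : fml :=
  All (Ex (0 ∈ 1) → BEx 0 (¬ BEx 0 (0 ∈ 2))).
Definition ax_pairing : fml := All (All (Ex (is_pair 0 1 2))).
Definition ax_union : fml := All (Ex (All (0 ∈ 1 ↔ BEx 2 (1 ∈ 0)))).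
Definition ax_power : fml := All (Ex (All (0 ∈ 1 ↔ is_subset 0 2))).
Definition ax_infinity : fml :=
  Ex (BEx 0 (is_empty 0) ∧ BAll 0 (BEx 1 (is_succ 0 1))).
Definition ax_separation (p : fml) : fml :=
  All (Ex (All (0 ∈ 1 ↔ 0 ∈ 2 ∧ at1 p 0 3))).
Definition ax_replacement (p : fml) : fml :=
  All (All (All (at2 p 2 1 3 ∧ at2 p 2 0 3 → 1 ≡ 0)))
  → All (Ex (All (0 ∈ 1 ↔ BEx 2 (at2 p 0 1 4)))).
(* Every family of nonempty sets has a choice function. *)
Definition ax_choice : fml :=
  All (BAll 0 (Ex (0 ∈ 1)) → Ex (is_fun 0 1 ∧ BAll 1 (BEx 0 (maps 2 1 0)))).

Inductive ZF : fml -> Prop :=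
| ZF_extensionality : ZF ax_extensionality
| ZF_foundation : ZF ax_foundation
| ZF_pairing : ZF ax_pairing
| ZF_union : ZF ax_union
| ZF_power : ZF ax_power
| ZF_infinity : ZF ax_infinity
| ZF_separation p : ZF (ax_separation p)
| ZF_replacement p : ZF (ax_replacement p).

Definition ZFC (p : fml) : Prop := ZF p \/ p = ax_choice.

(* w = ⋃_{β ∈ b} P(f(β)) *)
Definition is_rank_step (f b w : nat) : fml :=
  All (0 ∈ 1 + w ↔ BEx (1 + b) (Ex (maps (3 + f) 1 0 ∧ is_subset 2 0))).
(* v = V_t = ⋃_{β ∈ t} P(V_β), by recursion along t *)
Definition is_V (v t : nat) : fml :=
  Ex (is_fun 0 (1 + t)
      ∧ BAll (1 + t) (All (maps 2 1 0 → is_rank_step 2 1 0))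
      ∧ is_rank_step 0 (1 + t) (1 + v)).

Fixpoint is_numeral (k : nat) (x : nat) : fml :=
  match k with
  | 0 => is_empty x
  | S k => Ex (is_numeral k 0 ∧ is_succ (1 + x) 0)
  end.
(* c = (k, x) and c = (k, (x, y)) for the numeral k *)
Definition is_tag1 (k c x : nat) : fml :=
  Ex (is_numeral k 0 ∧ is_opair (1 + c) 0 (1 + x)).
Definition is_tag2 (k c x y : nat) : fml :=
  Ex (is_opair 0 (1 + x) (1 + y) ∧ is_tag1 k (1 + c) 0).

(* The functions s and t with domain m agree except possibly at i. *)
Definition agree_off (m i s t : nat) : fml :=
  BAll m (¬ 0 ≡ 1 + i → All (maps (2 + s) 1 0 ↔ maps (2 + t) 1 0)).

(* U = {s ∈ ᵐA : p}, where variable 0 of [p] is s *)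
Definition is_truth_set (U m A : nat) (p : fml) : fml :=
  All (0 ∈ 1 + U ↔ is_fun_into 0 (1 + m) (1 + A) ∧ p).

(* G is a satisfaction function for the structure (A, ∈): its domain is a set
   of codes of formulas in the variables v_i, i ∈ m, closed under immediate
   subformulas, and it sends each code to the set of assignments in ᵐA that
   satisfy it.  The codes are
     v_i ∈ v_j : (0, (i, j)),  v_i = v_j : (1, (i, j)),
     ¬ d : (2, d),  d ∧ e : (3, (d, e)),  ∃ v_i d : (4, (i, d)).
   By Foundation, such a set contains nothing but codes of formulas, and G is
   determined by its domain. *)
Definition is_satisfaction (G A m : nat) : fml :=
  Ex (is_fun (1 + G) 0)
  ∧ All (All (maps (2 + G) 1 0 →
      (* 0 : truth set,  1 : code *)
      BEx (2 + m) (BEx (3 + m)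
        (is_tag2 0 3 1 0
         ∧ is_truth_set 2 (4 + m) (4 + A)
             (Ex (Ex (maps 2 4 1 ∧ maps 2 3 0 ∧ 1 ∈ 0)))))
      ∨ BEx (2 + m) (BEx (3 + m)
        (is_tag2 1 3 1 0
         ∧ is_truth_set 2 (4 + m) (4 + A)
             (Ex (Ex (maps 2 4 1 ∧ maps 2 3 0 ∧ 1 ≡ 0)))))
      ∨ Ex (Ex
        (maps (4 + G) 1 0 ∧ is_tag1 2 3 1
         ∧ is_truth_set 2 (4 + m) (4 + A) (¬ 0 ∈ 1)))
      ∨ Ex (Ex (Ex (Ex
        (maps (6 + G) 3 2 ∧ maps (6 + G) 1 0 ∧ is_tag2 3 5 3 1
         ∧ is_truth_set 4 (6 + m) (6 + A) (0 ∈ 3 ∧ 0 ∈ 1)))))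
      ∨ BEx (2 + m) (Ex (Ex
        (maps (5 + G) 1 0 ∧ is_tag2 4 4 2 1
         ∧ is_truth_set 3 (5 + m) (5 + A)
             (BEx 1 (agree_off (7 + m) 4 1 0))))))).

(* "a ∈ OD": for some ordinal θ there are a formula c and an assignment s in
   (V_θ, ∈), with s(0) = a and s(i) an ordinal for i ≠ 0, such that s satisfies
   c and no other value at 0 does.  Inside the block of quantifiers,
   7 : θ,  6 : V_θ,  5 : m,  4 : satisfaction function,  3 : c,
   2 : truth set of c,  1 : s,  0 : the empty set. *)
Definition is_OD (a : nat) : fml :=
  Ex (Ex (Ex (Ex (Ex (Ex (Ex (Ex
    (is_ord 7 ∧ is_V 6 7 ∧ is_nat 5 ∧ is_satisfaction 4 6 5
     ∧ maps 4 3 2 ∧ 1 ∈ 2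
     ∧ is_empty 0 ∧ maps 1 0 (8 + a)
     ∧ BAll 5 (¬ 0 ≡ 1 → All (maps 3 1 0 → is_ord 0))
     ∧ BAll 2 (agree_off 6 1 2 0 → maps 0 1 (9 + a)))))))))).

(* x belongs to the transitive closure of {a} *)
Definition in_trcl (x a : nat) : fml :=
  All (is_transitive 0 ∧ 1 + a ∈ 0 → 1 + x ∈ 0).
Definition is_HOD (a : nat) : fml := All (in_trcl 0 (1 + a) → is_OD 0).
Definition V_eq_HOD : fml := All (is_HOD 0).

(* The relation defined by p(x, y) is a strict well-ordering of the universe:
   a linear order for which every nonempty set has a least element. *)
Definition well_orders_universe (p : fml) : fml :=
  All (¬ at2 p 0 0 1)
  ∧ All (All (All (at2 p 2 1 3 ∧ at2 p 1 0 3 → at2 p 2 0 3)))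
  ∧ All (All (at2 p 1 0 2 ∨ 1 ≡ 0 ∨ at2 p 0 1 2))
  ∧ All (Ex (0 ∈ 1) → BEx 0 (BAll 1 (0 ≡ 1 ∨ at2 p 1 0 3))).

Definition has_definable_well_ordering (M : structure) : Prop :=
  exists p, free_below 2 p /\ models M (well_orders_universe p).

(* Beyond the listed values the environment is irrelevant to formulas with
   [free_below (length (x :: params))]. *)
Definition env {M : structure} (x : M) (params : list M) (i : nat) : M :=
  nth i (x :: params) x.

Definition defines {M : structure} (p : fml) (params : list M) (a : M) : Prop :=
  free_below (S (length params)) p /\
  forall x : M, sat (env x params) p <-> x = a.

Definition ordinal {M : structure} (a : M) : Prop := sat (env a []) (is_ord 0).

Definition definable {M : structure} (a : M) : Prop :=
  exists p, defines p [] a.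
Definition Pi2_definable {M : structure} (a : M) : Prop :=
  exists p, Pi 2 p /\ defines p [] a.
Definition ordinal_definable {M : structure} (a : M) : Prop :=
  exists p params, Forall ordinal params /\ defines p params a.

Definition every_nonempty_has_element (M : structure) (P Q : M -> Prop) : Prop :=
  forall a : M, P a -> (exists x, mem x a) -> exists x, mem x a /\ Q x.

(* Main.v *)
(* Ordinal definability in the external sense agrees with the sentence "a ∈ OD":
   by reflection a definition may be evaluated in some V_θ, and the satisfaction
   function of a standard formula is a finite set.  The data (θ, m, c, s) that
   witness a ∈ OD have a definable well-ordering: codes are built from ordinals by
   pairing, and assignments are finite sequences.  So OD has a definable
   well-ordering, and least elements give (2), (3), (5) under V = HOD.

   For (6) => (1), call v = V_λ allowed if the relativized well-ordering
   well-orders OD^v.  Then OD^v ⊆ OD, since the least element of OD^v that is not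
   OD would be definable from λ; by reflection every OD set is in some OD^v.  Hence
   "a ∉ OD" is the Pi_2 condition that a ∉ OD^u for all allowed u.  If V ≠ HOD, let
   e = V_α with α least such that some subset of e is not OD, and let v be the least
   allowed level with e ∈ v and P(e) ∩ OD ⊆ OD^v.  The set of all {v, e, a} with
   a ⊆ e and a ∉ OD is Pi_2-definable: the level v bounds all quantifiers needed to
   describe it, except in the conditions that v and e are levels, that a ∉ OD, and
   that v is least.  It has no ordinal-definable element. *)
From Stdlib Require Import Arith List Lia Classical ClassicalEpsilon FunctionalExtensionality Setoid Morphisms.
Require Import Defs.
Import ListNotations.

(** * Definability with restricted parameters *)

Notation "x ∊ y" := (mem x y) (at level 70).

(** [M] may be ill-founded with nonstandard ω, so induction, recursion and collection in [M] apply
    only to predicates given by a formula. [Dfn K C P] carries this obligation, with the formula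
    class [K] and the class [C] of admissible parameters left variable: all sets for the axiom
    schemes, ordinals for ordinal definability, none for plain definability, and [K = Delta0] for
    counting quantifiers. Codes in [M] may be nonstandard too, so they are ordered through ranks of
    pairs, not by recursion on formulas. The final set answers a complexity problem. Being OD is
    Sigma_2 and its failure Pi_2; the set of all non-OD subsets of e involves both. A level v that
    decides OD correctly for the subsets of e makes both bounded in v, and putting v and e into
    every element lets the set determine them. For this, allowedness must be Pi_1: it quantifies
    once over the subsets to be given a least element, and soundness of OD^v is derived from it
    instead of being demanded. *)

Lemma sat_ext {M : structure} (p : fml) : forall rho rho' : nat -> M,
  (forall i, rho i = rho' i) -> sat rho p <-> sat rho' p.
Proof.
  induction p; intros rho rho' H; cbn;
    try (rewrite !H; tauto);
    try (rewrite (IHp rho rho' H); tauto);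
    try (rewrite (IHp1 rho rho' H), (IHp2 rho rho' H); tauto).
  - assert (E : forall a, sat (scons a rho) p <-> sat (scons a rho') p)
      by (intro a; apply IHp; intros [|i]; cbn; auto).
    split; intros G a; apply E; auto.
  - assert (E : forall a, sat (scons a rho) p <-> sat (scons a rho') p)
      by (intro a; apply IHp; intros [|i]; cbn; auto).
    split; intros [a G]; exists a; apply E; auto.
Qed.

Lemma sat_rename {M : structure} (p : fml) : forall (f : nat -> nat) (rho : nat -> M),
  sat rho (rename f p) <-> sat (fun i => rho (f i)) p.
Proof.
  induction p; intros f rho; cbn; try tauto;
    try (rewrite IHp; tauto); try (rewrite IHp1, IHp2; tauto).
  - assert (E : forall a, sat (scons a rho) (rename (up f) p)
                          <-> sat (scons a (fun i => rho (f i))) p)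
      by (intro a; rewrite IHp; apply sat_ext; intros [|i]; reflexivity).
    split; intros G a; apply E; auto.
  - assert (E : forall a, sat (scons a rho) (rename (up f) p)
                          <-> sat (scons a (fun i => rho (f i))) p)
      by (intro a; rewrite IHp; apply sat_ext; intros [|i]; reflexivity).
    split; intros [a G]; exists a; apply E; auto.
Qed.

Lemma free_below_mono (p : fml) : forall n m, n <= m -> free_below n p -> free_below m p.
Proof.
  induction p; cbn; intros n m L H; intuition; try lia; eauto.
  all: eapply IHp; [|eassumption]; lia.
Qed.

Lemma free_below_exists (p : fml) : exists n, free_below n p.
Proof.
  induction p; cbn.
  1,2: exists (S (x + y)); lia.
  1: exact IHp.
  1,2,3: destruct IHp1 as [n Hn], IHp2 as [m Hm]; exists (n + m);
    split; eapply free_below_mono; try eassumption; lia.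
  1,2: destruct IHp as [n Hn]; exists n; eapply free_below_mono; try eassumption; lia.
Qed.

Lemma free_below_rename (p : fml) : forall n m f,
  (forall i, i < n -> f i < m) -> free_below n p -> free_below m (rename f p).
Proof.
  induction p; cbn; intros n m f L H; intuition; eauto.
  all: eapply IHp; [|eassumption]; intros [|i] Hi; cbn; [lia|];
    apply -> Nat.succ_lt_mono; apply L; lia.
Qed.

Lemma sat_free_below {M : structure} (p : fml) : forall n (rho rho' : nat -> M),
  free_below n p -> (forall i, i < n -> rho i = rho' i) -> sat rho p <-> sat rho' p.
Proof.
  induction p; cbn; intros n rho rho' F H.
  1,2: rewrite !H by tauto; tauto.
  1: rewrite (IHp n rho rho' F H); tauto.
  1,2,3: rewrite (IHp1 n rho rho'), (IHp2 n rho rho') by tauto; tauto.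
  all: assert (E : forall a, sat (scons a rho) p <-> sat (scons a rho') p)
      by (intro a; apply (IHp (S n)); [exact F|intros [|i] Hi; cbn; [reflexivity|apply H; lia]]).
  - split; intros G a; apply E; auto.
  - split; intros [a G]; exists a; apply E; auto.
Qed.

(** These closure conditions are shared by arbitrary and by Delta_0 formulas, so one family of
    lemmas yields both plain definability and Delta_0 definability. *)
Class formula_class (K : fml -> Prop) : Prop := {
  K_mem x y : K (Mem x y);
  K_eq x y : K (Eq x y);
  K_not p : K p -> K (Not p);
  K_and p q : K p -> K q -> K (And p q);
  K_or p q : K p -> K q -> K (Or p q);
  K_imp p q : K p -> K q -> K (Imp p q);
  K_ball y p : K p -> K (BAll y p);
  K_bex y p : K p -> K (BEx y p);
  K_rename f p : K p -> K (rename f p)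
}.

Definition any_formula (p : fml) : Prop := True.

#[export] Instance any_formula_class : formula_class any_formula.
Proof. split; intros; exact I. Qed.

Lemma Delta0_rename p : Delta0 p -> forall f, Delta0 (rename f p).
Proof.
  induction 1; intro f; cbn;
    first [apply (Delta0_BAll (f y)) | apply (Delta0_BEx (f y)) | constructor]; auto.
Qed.

#[export] Instance Delta0_class : formula_class Delta0.
Proof. split; intros; try (constructor; auto; fail). now apply Delta0_rename. Qed.

Fixpoint pre {M : structure} (l : list M) (rho : nat -> M) : nat -> M :=
  match l with [] => rho | a :: l => scons a (pre l rho) end.

Lemma pre_lt {M : structure} (l : list M) rho i d :
  i < length l -> pre l rho i = nth i l d.
Proof.
  revert i; induction l; cbn; intros [|i] H; cbn; try lia; auto. apply IHl; lia.
Qed.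

Lemma pre_ge {M : structure} (l : list M) rho i : pre l rho (length l + i) = rho i.
Proof. induction l; cbn; auto. Qed.

Definition tl {M : structure} (rho : nat -> M) : nat -> M := fun i => rho (S i).

Definition Dfn {M : structure} (K : fml -> Prop) (C : M -> Prop) (P : (nat -> M) -> Prop) : Prop :=
  exists p l, K p /\ Forall C l /\ forall rho, sat (pre l rho) p <-> P rho.

(** Only variables and parameters: substituting anything more complex could leave the class
    Delta_0. *)
Definition Tm {M : structure} (C : M -> Prop) (t : (nat -> M) -> M) : Prop :=
  (exists i, forall rho, t rho = rho i) \/ (exists a, C a /\ forall rho, t rho = a).

(** Past the end of the list the value is [rho 0], so every entry is again a variable or a
    parameter. *)
Fixpoint tenv {M : structure} (T : list ((nat -> M) -> M)) (rho : nat -> M) : nat -> M :=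
  match T with [] => fun _ => rho 0 | t :: T => scons (t rho) (tenv T rho) end.

Section Definability.
Context {M : structure} {K : fml -> Prop} {HK : formula_class K} {C : M -> Prop}.
Implicit Types P Q : (nat -> M) -> Prop.

Lemma Dfn_ext P Q : (forall rho, P rho <-> Q rho) -> Dfn K C P -> Dfn K C Q.
Proof.
  intros E (p & l & Kp & Cl & H). exists p, l. split; [|split]; auto.
  intro rho. rewrite H. apply E.
Qed.

Lemma tenv_index (T : list ((nat -> M) -> M)) : Forall (Tm C) T ->
  exists l f, Forall C l /\ forall rho i, tenv T rho i = pre l rho (f i).
Proof.
  induction 1 as [|t T [[j Hj]|[a [Ca Ha]]] HT (l & f & Cl & Hf)].
  - exists [], (fun _ => 0). split; auto.
  - exists l, (fun i => match i with 0 => length l + j | S i => f i end).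
    split; auto. intros rho [|i]; cbn; [rewrite pre_ge|]; auto.
  - exists (a :: l), (fun i => match i with 0 => 0 | S i => S (f i) end).
    split; auto. intros rho [|i]; cbn; auto.
Qed.

Lemma Dfn_fml q T : K q -> Forall (Tm C) T -> Dfn K C (fun rho => sat (tenv T rho) q).
Proof.
  intros Kq HT. destruct (tenv_index T HT) as (l & f & Cl & Hf).
  exists (rename f q), l. split; [apply K_rename; assumption|split]; auto.
  intro rho. rewrite sat_rename. apply sat_ext. intro i. now rewrite Hf.
Qed.

Lemma Dfn_subst Q T : Dfn K C Q -> Forall (Tm C) T -> Dfn K C (fun rho => Q (tenv T rho)).
Proof.
  intros (p & l & Kp & Cl & H) HT.
  apply (Dfn_ext (fun rho => sat (tenv (map (fun a _ => a) l ++ T) rho) p)).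
  - intro rho. rewrite <- H. apply sat_ext. clear H. induction l as [|a l IH]; cbn; auto.
    inversion Cl; subst. intros [|i]; cbn; auto.
  - apply Dfn_fml; auto. apply Forall_app; split; auto.
    apply Forall_map. eapply Forall_impl; [|exact Cl]. intros a Ca. right. eauto.
Qed.

Lemma pre_app_l (l l' : list M) : exists f, forall rho i, pre l rho i = pre (l ++ l') rho (f i).
Proof.
  exists (fun i => if i <? length l then i else length l + (length l' + (i - length l))).
  intros rho i. destruct (Nat.ltb_spec i (length l)) as [L|L].
  - rewrite (pre_lt l rho i (rho 0)), (pre_lt (l ++ l') rho i (rho 0)), app_nth1; auto.
    rewrite length_app; lia.
  - replace i with (length l + (i - length l)) at 1 by lia.
    rewrite Nat.add_assoc, <- length_app, !pre_ge. reflexivity.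
Qed.

Lemma pre_app_r (l l' : list M) : exists f, forall rho i, pre l' rho i = pre (l ++ l') rho (f i).
Proof.
  exists (fun i => length l + i). intros rho i. induction l; cbn; auto.
Qed.

Lemma Dfn_bin (op : fml -> fml -> fml) (Op : Prop -> Prop -> Prop) P Q :
  (forall p q, K p -> K q -> K (op p q)) ->
  (forall (rho : nat -> M) p q, sat rho (op p q) <-> Op (sat rho p) (sat rho q)) ->
  (forall A A' B B' : Prop, A <-> A' -> B <-> B' -> Op A B <-> Op A' B') ->
  Dfn K C P -> Dfn K C Q -> Dfn K C (fun rho => Op (P rho) (Q rho)).
Proof.
  intros Kop Hop Hop' (p & l & Kp & Cl & H) (q & l' & Kq & Cl' & H').
  destruct (pre_app_l l l') as [f Hf], (pre_app_r l l') as [g Hg].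
  exists (op (rename f p) (rename g q)), (l ++ l').
  split; [apply Kop; apply K_rename; assumption|split].
  - apply Forall_app; auto.
  - intro rho. rewrite Hop. apply Hop'; rewrite sat_rename.
    + rewrite <- H. apply sat_ext. intro i. now rewrite Hf.
    + rewrite <- H'. apply sat_ext. intro i. now rewrite Hg.
Qed.

Lemma Dfn_and P Q : Dfn K C P -> Dfn K C Q -> Dfn K C (fun rho => P rho /\ Q rho).
Proof. apply (Dfn_bin And and); [intros; now apply K_and|cbn; tauto..]. Qed.

Lemma Dfn_or P Q : Dfn K C P -> Dfn K C Q -> Dfn K C (fun rho => P rho \/ Q rho).
Proof. apply (Dfn_bin Or or); [intros; now apply K_or|cbn; tauto..]. Qed.

Lemma Dfn_imp P Q : Dfn K C P -> Dfn K C Q -> Dfn K C (fun rho => P rho -> Q rho).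
Proof. apply (Dfn_bin Imp (fun A B => A -> B)); [intros; now apply K_imp|cbn; tauto..]. Qed.

Lemma Dfn_iff P Q : Dfn K C P -> Dfn K C Q -> Dfn K C (fun rho => P rho <-> Q rho).
Proof. intros DP DQ. apply Dfn_and; apply Dfn_imp; assumption. Qed.

Lemma Dfn_not P : Dfn K C P -> Dfn K C (fun rho => ~ P rho).
Proof.
  intros (p & l & Kp & Cl & H). exists (Not p), l. split; [apply K_not; assumption|split]; auto.
  intro rho. cbn. now rewrite H.
Qed.

Lemma Dfn_mem s t : Tm C s -> Tm C t -> Dfn K C (fun rho => s rho ∊ t rho).
Proof. intros. apply (Dfn_fml (Mem 0 1) [s; t]); auto. apply K_mem. Qed.

Lemma Dfn_eq s t : Tm C s -> Tm C t -> Dfn K C (fun rho => s rho = t rho).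
Proof. intros. apply (Dfn_fml (Eq 0 1) [s; t]); auto. apply K_eq. Qed.

(** A quantifier binds variable 0, whereas a body read over [pre l] has its parameters first and the
    bound variable at position [length l]. The renaming moves that variable to the front. *)
Lemma pre_scons (l : list M) : exists f, forall rho y i,
  pre l (scons y rho) i = scons y (pre l rho) (f i).
Proof.
  exists (fun i => if i <? length l then S i else if i =? length l then 0 else i).
  intros rho y i. destruct (Nat.ltb_spec i (length l)) as [L|L]; cbn.
  - rewrite !(pre_lt l _ i y) by auto. reflexivity.
  - destruct (Nat.eqb_spec i (length l)) as [->|N].
    + now rewrite <- (Nat.add_0_r (length l)), pre_ge.
    + destruct i as [|i]; [lia|]. cbn.
      replace (S i) with (length l + S (i - length l)) by lia.
      replace i with (length l + (i - length l)) at 2 by lia. now rewrite !pre_ge.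
Qed.

(** Shared by both bounded quantifiers. The bound becomes a single variable [y], possibly a
    parameter slot, so that [BAll y] and [BEx y] apply literally and Delta_0 is preserved. *)
Lemma Dfn_bquant t (Q : (nat -> M) -> M -> Prop) : Tm C t -> Dfn K C (fun rho => Q (tl rho) (rho 0)) ->
  exists y p l, K p /\ Forall C l /\ (forall rho, pre l rho y = t rho) /\
    forall rho x, sat (scons x (pre l rho)) p <-> Q rho x.
Proof.
  intros Ht (p & l & Kp & Cl & H).
  assert (E : Forall (Tm C) [t]) by auto.
  destruct (tenv_index _ E) as (l' & g & Cl' & Hg).
  destruct (pre_app_l l l') as [f Hf], (pre_app_r l l') as [f' Hf'].
  destruct (pre_scons l) as [h Hh].
  exists (f' (g 0)), (rename (fun i => up f (h i)) p), (l ++ l').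
  split; [now apply K_rename|]. split; [apply Forall_app; auto|]. split.
  - intro rho. rewrite <- Hf', <- Hg. reflexivity.
  - intros rho x. rewrite sat_rename, <- (H (scons x rho)). apply sat_ext. intro i.
    rewrite Hh. destruct (h i); cbn; auto.
Qed.

Lemma Dfn_ball t (Q : (nat -> M) -> M -> Prop) : Tm C t -> Dfn K C (fun rho => Q (tl rho) (rho 0)) ->
  Dfn K C (fun rho => forall x, x ∊ t rho -> Q rho x).
Proof.
  intros Ht HQ. destruct (Dfn_bquant t (fun rho x => Q rho x) Ht HQ) as (y & p & l & Kp & Cl & Hy & H).
  exists (BAll y p), l. split; [apply K_ball; assumption|split]; auto.
  intro rho. cbn. rewrite Hy. split; intros G a Ha; apply H; auto.
Qed.

Lemma Dfn_bex t (Q : (nat -> M) -> M -> Prop) : Tm C t -> Dfn K C (fun rho => Q (tl rho) (rho 0)) ->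
  Dfn K C (fun rho => exists x, x ∊ t rho /\ Q rho x).
Proof.
  intros Ht HQ. destruct (Dfn_bquant t (fun rho x => Q rho x) Ht HQ) as (y & p & l & Kp & Cl & Hy & H).
  exists (BEx y p), l. split; [apply K_bex; assumption|split]; auto.
  intro rho. cbn. rewrite Hy. split; intros (a & Ha & G); exists a; split; auto; apply H; auto.
Qed.

Lemma Dfn_all (Q : (nat -> M) -> M -> Prop) : Dfn any_formula C (fun rho => Q (tl rho) (rho 0)) ->
  Dfn any_formula C (fun rho => forall x, Q rho x).
Proof.
  intros (p & l & Kp & Cl & H). destruct (pre_scons l) as [h Hh].
  exists (All (rename h p)), l. split; [exact I|split]; auto. intro rho. cbn.
  assert (E : forall x, sat (scons x (pre l rho)) (rename h p) <-> Q rho x).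
  { intro x. rewrite sat_rename, <- (H (scons x rho)). apply sat_ext. intro i. now rewrite Hh. }
  split; intros G x; apply E, G.
Qed.

Lemma Dfn_ex (Q : (nat -> M) -> M -> Prop) : Dfn any_formula C (fun rho => Q (tl rho) (rho 0)) ->
  Dfn any_formula C (fun rho => exists x, Q rho x).
Proof.
  intros (p & l & Kp & Cl & H). destruct (pre_scons l) as [h Hh].
  exists (Ex (rename h p)), l. split; [exact I|split]; auto. intro rho. cbn.
  assert (E : forall x, sat (scons x (pre l rho)) (rename h p) <-> Q rho x).
  { intro x. rewrite sat_rename, <- (H (scons x rho)). apply sat_ext. intro i. now rewrite Hh. }
  split; intros [x G]; exists x; apply E, G.
Qed.

Lemma Dfn_weaken (C' : M -> Prop) P : (forall a, C a -> C' a) -> Dfn K C P -> Dfn any_formula C' P.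
Proof.
  intros HC (p & l & Kp & Cl & H). exists p, l. split; [exact I|split]; auto.
  eapply Forall_impl; eauto.
Qed.

Lemma Dfn_reindex P (g : nat -> nat) : Dfn K C P -> Dfn K C (fun rho => P (fun i => rho (g i))).
Proof.
  intros (p & l & Kp & Cl & H).
  exists (rename (fun i => if i <? length l then i else length l + g (i - length l)) p), l.
  split; [now apply K_rename|split]; auto. intro rho.
  rewrite sat_rename, <- H. apply sat_ext. intro i.
  destruct (Nat.ltb_spec i (length l)) as [L|L].
  - now rewrite !(pre_lt l _ i (rho 0)).
  - rewrite pre_ge. replace i with (length l + (i - length l)) at 2 by lia. now rewrite pre_ge.
Qed.

End Definability.

(** The language has no function symbols; a set-theoretic operation enters formulas through its
    graph. Eliminating it costs an unbounded quantifier, hence [any_formula]. *)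
Definition DTm {M : structure} (C : M -> Prop) (t : (nat -> M) -> M) : Prop :=
  Dfn any_formula C (fun rho => rho 0 = t (tl rho)).

Ltac tm :=
  cbv beta delta [tl];
  first [ left; eexists; intro; reflexivity
        | right; eexists; split; [|intro; reflexivity]; solve [exact I | assumption] ].

Ltac tms := repeat (apply Forall_cons; [tm|]); apply Forall_nil.

Section DefinableTerms.
Context {M : structure} {C : M -> Prop}.
Implicit Types s t u v w : (nat -> M) -> M.
Notation Dfn := (Dfn any_formula C).
Notation DTm := (DTm C).

Lemma DTm_Tm t : Tm C t -> DTm t.
Proof.
  intro Ht. apply (Dfn_eq (fun rho => rho 0) (fun rho => t (tl rho))); [tm|].
  destruct Ht as [[i Hi]|[a [Ca Ha]]].
  - left. exists (S i). intro rho. apply Hi.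
  - right. exists a. auto.
Qed.

Lemma DTm_tl t : DTm t -> DTm (fun rho => t (tl rho)).
Proof. exact (Dfn_reindex _ (fun i => match i with 0 => 0 | S i => S (S i) end)). Qed.

(** The one place where a defined term is eliminated; the application lemmas below name their
    arguments one at a time by it. *)
Lemma Dfn_let t (Q : (nat -> M) -> M -> Prop) :
  DTm t -> Dfn (fun rho => Q (tl rho) (rho 0)) -> Dfn (fun rho => Q rho (t rho)).
Proof.
  intros Ht HQ. apply (Dfn_ext (fun rho => exists y, y = t rho /\ Q rho y)).
  - intro rho. split; [intros (y & -> & H); exact H|eauto].
  - apply Dfn_ex. apply Dfn_and; assumption.
Qed.

Lemma Dfn_app1 (P : M -> Prop) s :
  Dfn (fun rho => P (rho 0)) -> DTm s -> Dfn (fun rho => P (s rho)).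
Proof. intros DP Hs. now apply (Dfn_let s (fun _ => P)). Qed.

Lemma Dfn_app2 (P : M -> M -> Prop) s t :
  Dfn (fun rho => P (rho 0) (rho 1)) -> DTm s -> DTm t -> Dfn (fun rho => P (s rho) (t rho)).
Proof.
  intros DP Hs Ht. apply (Dfn_let s (fun rho x => P x (t rho))); auto.
  apply (Dfn_let (fun rho => t (tl rho)) (fun rho y => P (rho 0) y)); auto using DTm_tl.
  apply (Dfn_subst (fun rho => P (rho 0) (rho 1)) [fun rho => rho 1; fun rho => rho 0]); [auto|tms].
Qed.

Lemma Dfn_app3 (P : M -> M -> M -> Prop) s t u :
  Dfn (fun rho => P (rho 0) (rho 1) (rho 2)) -> DTm s -> DTm t -> DTm u ->
  Dfn (fun rho => P (s rho) (t rho) (u rho)).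
Proof.
  intros DP Hs Ht Hu. apply (Dfn_let s (fun rho x => P x (t rho) (u rho))); auto.
  apply (Dfn_let (fun rho => t (tl rho)) (fun rho y => P (rho 0) y (u (tl rho)))); auto using DTm_tl.
  apply (Dfn_let (fun rho => u (tl (tl rho))) (fun rho z => P (rho 1) (rho 0) z)).
  - exact (DTm_tl _ (DTm_tl _ Hu)).
  - apply (Dfn_subst (fun rho => P (rho 0) (rho 1) (rho 2))
             [fun rho => rho 2; fun rho => rho 1; fun rho => rho 0]); [auto|tms].
Qed.

Lemma Dfn_app4 (P : M -> M -> M -> M -> Prop) s t u v :
  Dfn (fun rho => P (rho 0) (rho 1) (rho 2) (rho 3)) -> DTm s -> DTm t -> DTm u -> DTm v ->
  Dfn (fun rho => P (s rho) (t rho) (u rho) (v rho)).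
Proof.
  intros DP Hs Ht Hu Hv. apply (Dfn_let s (fun rho x => P x (t rho) (u rho) (v rho))); auto.
  apply (Dfn_let (fun rho => v (tl rho))
           (fun rho y => P (rho 0) (t (tl rho)) (u (tl rho)) y)); auto using DTm_tl.
  apply (Dfn_let (fun rho => t (tl (tl rho)))
           (fun rho y => P (rho 1) y (u (tl (tl rho))) (rho 0))).
  - exact (DTm_tl _ (DTm_tl _ Ht)).
  - apply (Dfn_let (fun rho => u (tl (tl (tl rho))))
           (fun rho y => P (rho 2) (rho 0) y (rho 1))).
    + exact (DTm_tl _ (DTm_tl _ (DTm_tl _ Hu))).
    + apply (Dfn_subst (fun rho => P (rho 0) (rho 1) (rho 2) (rho 3))
             [fun rho => rho 3; fun rho => rho 1; fun rho => rho 0; fun rho => rho 2]); [auto|tms].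
Qed.

Lemma Dfn_app5 (P : M -> M -> M -> M -> M -> Prop) s t u v w :
  Dfn (fun rho => P (rho 0) (rho 1) (rho 2) (rho 3) (rho 4)) ->
  DTm s -> DTm t -> DTm u -> DTm v -> DTm w ->
  Dfn (fun rho => P (s rho) (t rho) (u rho) (v rho) (w rho)).
Proof.
  intros DP Hs Ht Hu Hv Hw.
  apply (Dfn_let s (fun rho x => P x (t rho) (u rho) (v rho) (w rho))); auto.
  apply (Dfn_let (fun rho => t (tl rho))
           (fun rho y => P (rho 0) y (u (tl rho)) (v (tl rho)) (w (tl rho)))); auto using DTm_tl.
  apply (Dfn_let (fun rho => u (tl (tl rho)))
           (fun rho y => P (rho 1) (rho 0) y (v (tl (tl rho))) (w (tl (tl rho))))).
  - exact (DTm_tl _ (DTm_tl _ Hu)).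
  - apply (Dfn_let (fun rho => v (tl (tl (tl rho))))
             (fun rho y => P (rho 2) (rho 1) (rho 0) y (w (tl (tl (tl rho)))))).
    + exact (DTm_tl _ (DTm_tl _ (DTm_tl _ Hv))).
    + apply (Dfn_let (fun rho => w (tl (tl (tl (tl rho)))))
               (fun rho y => P (rho 3) (rho 2) (rho 1) (rho 0) y)).
      * exact (DTm_tl _ (DTm_tl _ (DTm_tl _ (DTm_tl _ Hw)))).
      * apply (Dfn_subst (fun rho => P (rho 0) (rho 1) (rho 2) (rho 3) (rho 4))
          [fun rho => rho 4; fun rho => rho 3; fun rho => rho 2; fun rho => rho 1; fun rho => rho 0]);
          [auto|tms].
Qed.

Lemma Dfn_memT s t : DTm s -> DTm t -> Dfn (fun rho => s rho ∊ t rho).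
Proof. apply (Dfn_app2 (fun x y => x ∊ y)), Dfn_mem; tm. Qed.

Lemma Dfn_eqT s t : DTm s -> DTm t -> Dfn (fun rho => s rho = t rho).
Proof. apply (Dfn_app2 (fun x y => x = y)), Dfn_eq; tm. Qed.

Lemma DTm_app1 (F : M -> M) s :
  Dfn (fun rho => rho 0 = F (rho 1)) -> DTm s -> DTm (fun rho => F (s rho)).
Proof.
  intros HF Hs. apply (Dfn_app2 (fun y x => y = F x) (fun rho => rho 0) (fun rho => s (tl rho)));
    auto using DTm_tl. apply DTm_Tm. tm.
Qed.

Lemma DTm_app2 (F : M -> M -> M) s t :
  Dfn (fun rho => rho 0 = F (rho 1) (rho 2)) -> DTm s -> DTm t -> DTm (fun rho => F (s rho) (t rho)).
Proof.
  intros HF Hs Ht. apply (Dfn_app3 (fun y x x' => y = F x x') (fun rho => rho 0)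
    (fun rho => s (tl rho)) (fun rho => t (tl rho))); auto using DTm_tl. apply DTm_Tm. tm.
Qed.

End DefinableTerms.

Notation DfnP := (Dfn any_formula (fun _ => True)).

Create HintDb dfn.
#[export] Hint Extern 0 (DTm _ _) => (apply DTm_Tm; tm) : dfn.
#[export] Hint Extern 0 (Dfn _ _ (fun rho => _ ∊ _)) => simple apply Dfn_memT : dfn.
#[export] Hint Extern 0 (Dfn _ _ (fun rho => _ = _)) => simple apply Dfn_eqT : dfn.

Ltac dfn_step :=
  lazymatch goal with
  | |- Dfn _ _ (fun rho => _ <-> _) => apply Dfn_iff
  | |- Dfn _ _ (fun rho => _ /\ _) => apply Dfn_and
  | |- Dfn _ _ (fun rho => _ \/ _) => apply Dfn_or
  | |- Dfn _ _ (fun rho => ~ _) => apply Dfn_not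
  | |- Dfn _ _ (fun rho => forall x : carrier _, _) => apply Dfn_all
  | |- Dfn _ _ (fun rho => exists x, _) => apply Dfn_ex
  | |- Dfn _ _ (fun rho => _ -> _) => apply Dfn_imp
  | |- _ => solve [auto 20 with dfn nocore]
  end; cbv beta.

Ltac dfn := cbv beta; repeat dfn_step.

(** * Sets *)

Class ZF_model (M : structure) : Prop := zf_axioms : models_theory M ZF.

(** External choice turns the existence axioms into operations on [M]. Definability of such an
    operation is a separate matter, settled by its membership condition. *)
Definition the {M : structure} (P : M -> Prop) : M := epsilon (carrier_inhabited M) P.

Lemma the_spec {M : structure} (P : M -> Prop) : (exists x, P x) -> P (the P).
Proof. apply epsilon_spec. Qed.

Definition Sub {M : structure} (x y : M) : Prop := forall z, z ∊ x -> z ∊ y.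

Definition upair {M : structure} (x y : M) : M := the (fun a => forall z, z ∊ a <-> z = x \/ z = y).
Definition opr {M : structure} (x y : M) : M := upair (upair x x) (upair x y).
Definition union {M : structure} (a : M) : M := the (fun b => forall x, x ∊ b <-> exists y, y ∊ a /\ x ∊ y).
Definition power {M : structure} (a : M) : M := the (fun b => forall x, x ∊ b <-> Sub x a).
Definition bun {M : structure} (a b : M) : M := union (upair a b).
(** The predicate is an arbitrary external one, and so is the function in [rep]. The intended set is
    guaranteed only for definable ones, hence the hypotheses of [sepE] and [repE]. *)
Definition sep {M : structure} (a : M) (P : M -> Prop) : M :=
  the (fun b => forall x, x ∊ b <-> x ∊ a /\ P x).
Definition rep {M : structure} (a : M) (F : M -> M) : M :=
  the (fun b => forall y, y ∊ b <-> exists x, x ∊ a /\ y = F x).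
Definition emp {M : structure} : M := the (fun a => forall z, ~ z ∊ a).
Definition suc {M : structure} (a : M) : M := bun a (upair a a).

Definition Trans {M : structure} (x : M) : Prop := forall y, y ∊ x -> forall z, z ∊ y -> z ∊ x.
Definition Ord {M : structure} (x : M) : Prop :=
  Trans x /\ forall y, y ∊ x -> forall z, z ∊ x -> z ∊ y \/ z = y \/ y ∊ z.

Section ZFSets.
Context {M : structure} {HZF : ZF_model M}.
Implicit Types a b c f x y z : M.

Lemma ext a b : (forall z, z ∊ a <-> z ∊ b) -> a = b.
Proof.
  intro H. exact (zf_axioms _ ZF_extensionality (fun _ => a) b a H).
Qed.

Lemma found a (x : M) : x ∊ a -> exists y, y ∊ a /\ forall z, z ∊ y -> ~ z ∊ a.
Proof.
  intro H. destruct (zf_axioms _ ZF_foundation (fun _ => a) a (ex_intro _ x H)) as (y & Hy & N).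
  exists y. split; [exact Hy|]. intros z Hz Ha. apply N. exists z. auto.
Qed.

Lemma separation (P : M -> Prop) a : DfnP (fun rho => P (rho 0)) ->
  exists b, forall x, x ∊ b <-> x ∊ a /\ P x.
Proof.
  intros (p & l & _ & _ & H).
  (* [P] looks at [rho 0] only, so all variables beyond the parameters may be identified with the
     separated element. *)
  destruct (zf_axioms _ (ZF_separation (rename (fun i => if i <? length l then S i else 0) p))
             (pre l (fun _ => a)) a) as [b Hb].
  exists b. intro x. specialize (Hb x). cbn in Hb.
  assert (E : sat (scons x (scons b (scons a (pre l (fun _ => a)))))
            (at1 (rename (fun i => if i <? length l then S i else 0) p) 0 3) <-> P x).
  { unfold at1. rewrite !sat_rename. rewrite <- (H (fun _ => x)). apply sat_ext. intro i.
    destruct (Nat.ltb_spec i (length l)); cbn.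
    - now rewrite !(pre_lt l _ i x).
    - replace i with (length l + (i - length l)) by lia. now rewrite pre_ge. }
  rewrite <- E. exact Hb.
Qed.

Lemma replacement (R : M -> M -> Prop) a : DfnP (fun rho => R (rho 0) (rho 1)) ->
  (forall x y y', x ∊ a -> R x y -> R x y' -> y = y') ->
  exists b, forall y, y ∊ b <-> exists x, x ∊ a /\ R x y.
Proof.
  intros D U.
  (* The axiom scheme asks for functionality on the whole universe; conjoining membership in [a]
     reduces this to functionality on [a]. *)
  assert (D' : DfnP (fun rho => rho 0 ∊ a /\ R (rho 0) (rho 1))).
  { apply Dfn_and; [apply Dfn_mem; tm|exact D]. }
  destruct D' as (p & l & _ & _ & H).
  set (q := rename (fun i => if i <? length l then S (S i) else if i =? length l then 0 else 1) p).
  assert (E : forall x y, sat (scons x (scons y (pre l (fun _ => a)))) q <-> x ∊ a /\ R x y).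
  { intros x y. unfold q. rewrite sat_rename, <- (H (scons x (fun _ => y))). apply sat_ext. intro i.
    destruct (Nat.ltb_spec i (length l)); cbn; [now rewrite !(pre_lt l _ i x)|].
    destruct (Nat.eqb_spec i (length l)) as [->|N]; cbn.
    - now rewrite <- (Nat.add_0_r (length l)), pre_ge.
    - replace i with (length l + S (i - length l - 1)) by lia. now rewrite pre_ge. }
  pose proof (zf_axioms _ (ZF_replacement q) (pre l (fun _ => a))) as Rp.
  cbn in Rp. unfold at2 in Rp.
  destruct (fun G => Rp G a) as [b Hb].
  - intros x y y' [H1 H2]. rewrite sat_rename in H1, H2.
    assert (H1' : sat (scons x (scons y (pre l (fun _ => a)))) q)
      by (revert H1; apply sat_ext; intros [|[|i]]; reflexivity).
    assert (H2' : sat (scons x (scons y' (pre l (fun _ => a)))) q)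
      by (revert H2; apply sat_ext; intros [|[|i]]; reflexivity).
    apply E in H1', H2'. apply (U x); tauto.
  - exists b. intro y. etransitivity; [exact (Hb y)|]. split; intros (x & Hx & Hr); exists x; split; auto.
    + rewrite sat_rename in Hr. apply (E x y). revert Hr. apply sat_ext. intros [|[|i]]; reflexivity.
    + rewrite sat_rename. assert (G : x ∊ a /\ R x y) by auto. apply E in G. revert G.
      apply sat_ext. intros [|[|i]]; reflexivity.
Qed.

Lemma sepE a (P : M -> Prop) : DfnP (fun rho => P (rho 0)) ->
  forall x, x ∊ sep a P <-> x ∊ a /\ P x.
Proof. intro D. exact (the_spec (fun b => forall x, x ∊ b <-> x ∊ a /\ P x) (separation P a D)). Qed.

Lemma repE a (F : M -> M) : DfnP (fun rho => rho 0 = F (rho 1)) ->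
  forall y, y ∊ rep a F <-> exists x, x ∊ a /\ y = F x.
Proof.
  intro D. refine (the_spec (fun b => forall y, y ∊ b <-> exists x, x ∊ a /\ y = F x) _).
  apply (replacement (fun x y => y = F x)).
  - apply (Dfn_app2 (fun y x => y = F x) (fun rho => rho 1) (fun rho => rho 0)); auto with dfn.
  - intros; congruence.
Qed.

Lemma unionE a x : x ∊ union a <-> exists y, y ∊ a /\ x ∊ y.
Proof.
  revert x. refine (the_spec (fun b => forall x, x ∊ b <-> exists y, y ∊ a /\ x ∊ y) _).
  exact (zf_axioms _ ZF_union (fun _ => a) a).
Qed.

Lemma powerE a x : x ∊ power a <-> Sub x a.
Proof.
  revert x. refine (the_spec (fun b => forall x, x ∊ b <-> Sub x a) _).
  exact (zf_axioms _ ZF_power (fun _ => a) a).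
Qed.

Lemma upairE x y z : z ∊ upair x y <-> z = x \/ z = y.
Proof.
  revert z. refine (the_spec (fun a => forall z, z ∊ a <-> z = x \/ z = y) _).
  destruct (zf_axioms _ ZF_pairing (fun _ => x) y x) as [a Ha]. exists a. intro z.
  exact (Ha z).
Qed.

Lemma bunE a b x : x ∊ bun a b <-> x ∊ a \/ x ∊ b.
Proof.
  unfold bun. rewrite unionE. split.
  - intros (y & Hy & Hx). apply upairE in Hy as [->| ->]; auto.
  - intros [H|H]; eexists; (split; [apply upairE|exact H]); auto.
Qed.

Lemma empE x : ~ x ∊ emp.
Proof.
  revert x. refine (the_spec (fun a => forall z, ~ z ∊ a) _).
  destruct (carrier_inhabited M) as [a].
  destruct (separation (fun x => x <> x) a) as [b Hb]; [dfn|].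
  exists b. intros z Hz. apply Hb in Hz. tauto.
Qed.

Lemma sucE a x : x ∊ suc a <-> x ∊ a \/ x = a.
Proof. unfold suc. rewrite bunE, upairE. tauto. Qed.

Lemma upair_inj x y x' y' : upair x y = upair x' y' -> (x = x' /\ y = y') \/ (x = y' /\ y = x').
Proof.
  intro E. assert (H : forall z, z = x \/ z = y <-> z = x' \/ z = y').
  { intro z. rewrite <- !upairE, E. tauto. }
  assert (Hx : x = x' \/ x = y') by (apply H; auto).
  assert (Hy : y = x' \/ y = y') by (apply H; auto).
  assert (Hx' : x' = x \/ x' = y) by (apply H; auto).
  assert (Hy' : y' = x \/ y' = y) by (apply H; auto).
  clear E H. destruct Hx, Hy, Hx', Hy'; subst; auto.
Qed.

Lemma opr_inj x y x' y' : opr x y = opr x' y' -> x = x' /\ y = y'.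
Proof.
  unfold opr. intro E. apply upair_inj in E as [[E1 E2]|[E1 E2]];
    apply upair_inj in E1; apply upair_inj in E2;
    destruct E1 as [[]|[]], E2 as [[]|[]]; subst; auto.
Qed.

Lemma mem_irrefl x : ~ x ∊ x.
Proof.
  intro H. destruct (found (upair x x) x) as (y & Hy & N); [apply upairE; auto|].
  apply upairE in Hy. assert (y = x) by tauto. subst y. apply (N x H). apply upairE; auto.
Qed.

Lemma mem_asym x y : x ∊ y -> ~ y ∊ x.
Proof.
  intros H H'. destruct (found (upair x y) x) as (z & Hz & N); [apply upairE; auto|].
  apply upairE in Hz as [-> | ->]; [apply (N y)|apply (N x)]; auto; apply upairE; auto.
Qed.

Lemma emp_ex x : (exists z, z ∊ x) \/ x = emp.
Proof.
  destruct (classic (exists z, z ∊ x)) as [H|H]; [auto|right].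
  apply ext. intro z. pose proof (empE z). firstorder.
Qed.

Lemma eq_set_ext a b : a = b <-> forall z, z ∊ a <-> z ∊ b.
Proof. split; [intros ->; tauto|apply ext]. Qed.

Section Graphs.
Context {C : M -> Prop}.
Notation DTm := (DTm C).
Notation Dfn := (Dfn any_formula C).

Lemma Dfn_Sub s t : DTm s -> DTm t -> Dfn (fun rho => Sub (s rho) (t rho)).
Proof. apply Dfn_app2. unfold Sub. dfn. Qed.

(** Extensionality: the graph of [t] says that [rho 0] has exactly the elements described by [Q]. *)
Lemma DTm_set (t : (nat -> M) -> M) (Q : (nat -> M) -> M -> Prop) :
  (forall rho z, z ∊ t rho <-> Q rho z) -> Dfn (fun rho => Q (tl rho) (rho 0)) -> DTm t.
Proof.
  intros H D.
  apply (Dfn_ext (fun rho => forall z, z ∊ rho 0 <-> Q (tl rho) z)).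
  - intro rho. rewrite eq_set_ext. split; intros G z; specialize (G z); rewrite H in *; exact G.
  - apply Dfn_all. apply Dfn_iff; [apply Dfn_mem; tm|].
    exact (Dfn_reindex _ (fun i => match i with 0 => 0 | S i => S (S i) end) D).
Qed.

Lemma DTm_upair s t : DTm s -> DTm t -> DTm (fun rho => upair (s rho) (t rho)).
Proof.
  apply DTm_app2. apply (DTm_set (fun rho => upair (rho 0) (rho 1)) _ (fun rho => upairE _ _)). dfn.
Qed.

Lemma DTm_union s : DTm s -> DTm (fun rho => union (s rho)).
Proof.
  apply DTm_app1. apply (DTm_set (fun rho => union (rho 0)) _ (fun rho => unionE _)). dfn.
Qed.

Lemma DTm_power s : DTm s -> DTm (fun rho => power (s rho)).
Proof.
  apply DTm_app1. apply (DTm_set (fun rho => power (rho 0)) _ (fun rho => powerE _)). apply Dfn_Sub; auto with dfn.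
Qed.

Lemma DTm_emp : DTm (fun _ => emp).
Proof.
  apply (DTm_set (fun _ => emp) (fun _ x => x <> x)); [|dfn].
  intros rho z. pose proof (empE z). tauto.
Qed.
End Graphs.
End ZFSets.

#[export] Hint Extern 0 (DTm _ (fun rho => upair _ _)) => simple apply DTm_upair : dfn.
#[export] Hint Extern 0 (DTm _ (fun rho => union _)) => simple apply DTm_union : dfn.
#[export] Hint Extern 0 (DTm _ (fun rho => power _)) => simple apply DTm_power : dfn.
#[export] Hint Extern 0 (DTm _ (fun rho => emp)) => simple apply DTm_emp : dfn.
#[export] Hint Extern 0 (Dfn _ _ (fun rho => Sub _ _)) => simple apply Dfn_Sub : dfn.

Section ZFSets2.
Context {M : structure} {HZF : ZF_model M} {C : M -> Prop}.
Notation DTm := (DTm C).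
Notation Dfn := (Dfn any_formula C).

Lemma DTm_bun s t : DTm s -> DTm t -> DTm (fun rho => bun (s rho) (t rho)).
Proof. intros. unfold bun. auto 10 with dfn nocore. Qed.
Lemma DTm_opr s t : DTm s -> DTm t -> DTm (fun rho => opr (s rho) (t rho)).
Proof. intros. unfold opr. auto 10 with dfn nocore. Qed.
Lemma DTm_suc s : DTm s -> DTm (fun rho => suc (s rho)).
Proof. intros. unfold suc, bun. auto 10 with dfn nocore. Qed.
Lemma Dfn_Trans s : DTm s -> Dfn (fun rho => Trans (s rho)).
Proof. apply Dfn_app1. unfold Trans. dfn. Qed.
Lemma Dfn_Ord s : DTm s -> Dfn (fun rho => Ord (s rho)).
Proof. apply Dfn_app1. unfold Ord, Trans. dfn. Qed.
End ZFSets2.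

#[export] Hint Extern 0 (DTm _ (fun rho => bun _ _)) => simple apply DTm_bun : dfn.
#[export] Hint Extern 0 (DTm _ (fun rho => opr _ _)) => simple apply DTm_opr : dfn.
#[export] Hint Extern 0 (DTm _ (fun rho => suc _)) => simple apply DTm_suc : dfn.
#[export] Hint Extern 0 (Dfn _ _ (fun rho => Trans _)) => simple apply Dfn_Trans : dfn.
#[export] Hint Extern 0 (Dfn _ _ (fun rho => Ord _)) => simple apply Dfn_Ord : dfn.

(** * Ordinals and recursion *)

Section Ordinals.
Context {M : structure} {HZF : ZF_model M}.
Implicit Types a b c f x y z : M.

Lemma mem_cycle3 x y z : x ∊ y -> y ∊ z -> ~ z ∊ x.
Proof.
  intros H1 H2 H3. destruct (found (bun (upair x y) (upair z z)) x) as (w & Hw & N).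
  - apply bunE. left. apply upairE. auto.
  - assert (E : forall u, u ∊ bun (upair x y) (upair z z) <-> u = x \/ u = y \/ u = z)
      by (intro u; rewrite bunE, !upairE; tauto).
    apply E in Hw as [->|[->| ->]]; [apply (N z)|apply (N x)|apply (N y)]; auto; apply E; auto.
Qed.

Lemma Ord_mem a b : Ord a -> b ∊ a -> Ord b.
Proof.
  intros [Ta La] Hb. split.
  - intros y Hy z Hz. assert (Hya : y ∊ a) by (eapply Ta; eauto).
    assert (Hza : z ∊ a) by (eapply Ta; eauto).
    destruct (La b Hb z Hza) as [H|[->|H]]; auto.
    + now destruct (mem_asym y b).
    + now destruct (mem_cycle3 b z y).
  - intros y Hy z Hz. apply La; eapply Ta; eauto.
Qed.

Lemma Ord_trans a b c : Ord a -> b ∊ a -> c ∊ b -> c ∊ a.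
Proof. intros [T _] Hb Hc. exact (T b Hb c Hc). Qed.

Lemma Ord_min (P : M -> Prop) a : DfnP (fun rho => P (rho 0)) -> Ord a -> P a ->
  exists b, Ord b /\ P b /\ forall c, c ∊ b -> ~ P c.
Proof.
  intros D Oa Pa.
  destruct (found (sep (suc a) P) a) as (b & Hb & N).
  - apply sepE; [exact D|]. split; [apply sucE|]; auto.
  - apply sepE in Hb as [Hb Pb]; [|exact D].
    assert (Ob : Ord b) by (apply sucE in Hb as [H| ->]; eauto using Ord_mem).
    exists b. split; [|split]; auto. intros c Hc Pc. apply (N c Hc).
    apply sepE; [exact D|]. split; auto. apply sucE. left.
    apply sucE in Hb as [H| ->]; eauto using Ord_trans.
Qed.

(** Definability of [P] is essential: seen from outside, the ordinals of [M] may have descending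
    sequences. *)
Lemma Ord_ind (P : M -> Prop) : DfnP (fun rho => P (rho 0)) ->
  (forall a, Ord a -> (forall b, b ∊ a -> P b) -> P a) -> forall a, Ord a -> P a.
Proof.
  intros D IH a Oa. apply NNPP. intro N.
  destruct (Ord_min (fun x => ~ P x) a) as (b & Ob & Nb & Hb); auto.
  - now apply Dfn_not.
  - apply Nb, IH; auto. intros c Hc. apply NNPP. auto.
Qed.

End Ordinals.

Ltac ord_induction a Oa := pattern a; revert a Oa; apply Ord_ind; cbv beta.

Section OrdinalRecursion.
Context {M : structure} {HZF : ZF_model M}.
Implicit Types a b c f x y z : M.

Lemma Ord_tri a b : Ord a -> Ord b -> a ∊ b \/ a = b \/ b ∊ a.
Proof.
  intros Oa Ob. revert b Ob. ord_induction a Oa; [dfn|].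
  intros a Oa IHa b Ob. ord_induction b Ob; [dfn|].
  intros b Ob IHb. apply NNPP. intro N. apply N. right; left. apply ext. intro z. split; intro Hz.
  - destruct (IHa z Hz b Ob) as [H|[->|H]]; auto; destruct N; eauto using Ord_trans.
  - destruct (IHb z Hz) as [H|[->|H]]; auto; destruct N; eauto using Ord_trans.
Qed.

Lemma Ord_sub a b : Ord a -> Ord b -> Sub a b -> a ∊ b \/ a = b.
Proof.
  intros Oa Ob S. destruct (Ord_tri a b) as [H|[H|H]]; auto.
  now destruct (mem_irrefl b (S b H)).
Qed.

Lemma Ord_suc a : Ord a -> Ord (suc a).
Proof.
  intros Oa. split.
  - intros y Hy z Hz. apply sucE in Hy as [Hy| ->]; apply sucE; eauto using Ord_trans.
  - intros y Hy z Hz. assert (O : forall u, u ∊ suc a -> Ord u)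
      by (intros u Hu; apply sucE in Hu as [Hu| ->]; eauto using Ord_mem).
    destruct (Ord_tri z y) as [H|[H|H]]; auto.
Qed.

Lemma Ord_union a : (forall x, x ∊ a -> Ord x) -> Ord (union a).
Proof.
  intro O. split.
  - intros y Hy z Hz. apply unionE in Hy as (x & Hx & Hy). apply unionE. exists x. split; auto.
    eapply Ord_trans; eauto.
  - intros y Hy z Hz. apply unionE in Hy as (x & Hx & Hy), Hz as (x' & Hx' & Hz).
    destruct (Ord_tri z y) as [H|[H|H]]; eauto using Ord_mem.
Qed.

Lemma Ord_emp : Ord (emp : M).
Proof. split; intros y Hy; now apply empE in Hy. Qed.

Lemma Ord_suc_le a b : Ord b -> a ∊ b -> Sub (suc a) b.
Proof. intros Ob Ha x Hx. apply sucE in Hx as [Hx| ->]; eauto using Ord_trans. Qed.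

Section Recursion.
Context {C : M -> Prop} (K : M -> M -> M).
Hypothesis HK : Dfn any_formula C (fun rho => rho 0 = K (rho 1) (rho 2)).

(** [K] receives the set of earlier values rather than the function. Nothing is asked of [f] outside
    [suc a], so an approximation at [a] is also one at every smaller ordinal. *)
Definition approx f a : Prop := forall b, b ∊ suc a ->
  exists v X, (forall u, opr b u ∊ f <-> u = v) /\ v = K b X /\
    forall y, y ∊ X <-> exists c, c ∊ b /\ opr c y ∊ f.

Definition rec_val a v : Prop := exists f, approx f a /\ opr a v ∊ f.

(** The value [emp] off the ordinals makes the operation total with a definable graph, so that it
    can be used inside [rep]. *)
Definition ord_rec a : M := the (fun v => Ord a /\ rec_val a v \/ ~ Ord a /\ v = emp).

(** [C'] may exceed [C]: the inductions below admit arbitrary parameters, while [DTm_ord_rec] must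
    add none to those of [K]. *)
Lemma Dfn_approx (C' : M -> Prop) s t : (forall x, C x -> C' x) -> DTm C' s -> DTm C' t ->
  Dfn any_formula C' (fun rho => approx (s rho) (t rho)).
Proof.
  intro HC. apply Dfn_app2. unfold approx. dfn.
  apply (Dfn_app3 (fun y a b => y = K a b)); auto with dfn. eapply Dfn_weaken; [exact HC|exact HK].
Qed.

Lemma Dfn_rec_val (C' : M -> Prop) s t : (forall x, C x -> C' x) -> DTm C' s -> DTm C' t ->
  Dfn any_formula C' (fun rho => rec_val (s rho) (t rho)).
Proof.
  intro HC. apply Dfn_app2. unfold rec_val. apply Dfn_ex. apply Dfn_and; [|dfn].
  apply Dfn_approx; auto with dfn.
Qed.

Lemma approx_down f a b : Ord a -> approx f a -> b ∊ a -> approx f b.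
Proof.
  intros Oa A Hb c Hc. apply A. apply sucE. left. apply (Ord_suc_le b a); auto.
Qed.

Lemma approx_unique b : Ord b -> forall f f' v v', approx f b -> approx f' b ->
  opr b v ∊ f -> opr b v' ∊ f' -> v = v'.
Proof.
  intro Ob. ord_induction b Ob.
  { dfn; apply Dfn_approx; auto with dfn. }
  intros b Ob IH f f' v v' A A' Hv Hv'.
  destruct (A b) as (w & X & Ew & -> & EX); [apply sucE; auto|].
  destruct (A' b) as (w' & X' & Ew' & -> & EX'); [apply sucE; auto|].
  apply Ew in Hv. apply Ew' in Hv'. subst v v'. f_equal. apply ext. intro y.
  rewrite EX, EX'.
  assert (G : forall c, c ∊ b -> opr c y ∊ f <-> opr c y ∊ f').
  { intros c Hc. assert (Hs : c ∊ suc b) by (apply sucE; auto).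
    destruct (A c Hs) as (u & _ & Eu & _), (A' c Hs) as (u' & _ & Eu' & _).
    assert (u = u').
    { apply (IH c Hc f f' u u'); [eapply approx_down; eauto..|now apply Eu|now apply Eu']. }
    subst u'. rewrite Eu, Eu'. tauto. }
  split; intros (c & Hc & H); exists c; split; auto; apply G; auto.
Qed.

Lemma rec_val_unique a v v' : Ord a -> rec_val a v -> rec_val a v' -> v = v'.
Proof. intros Oa (f & A & H) (f' & A' & H'). exact (approx_unique a Oa f f' v v' A A' H H'). Qed.

Lemma approx_rec_val f a b y : Ord a -> approx f a -> b ∊ a -> opr b y ∊ f <-> rec_val b y.
Proof.
  intros Oa A Hb. assert (Ab : approx f b) by (eapply approx_down; eauto).
  assert (Ob : Ord b) by (eapply Ord_mem; eauto).
  split; intro H; [exists f; auto|].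
  destruct (Ab b) as (v & _ & Ev & _); [apply sucE; auto|].
  apply Ev. apply (rec_val_unique b); auto. exists f. split; auto. now apply Ev.
Qed.

Lemma rec_val_exists a : Ord a -> exists v, rec_val a v.
Proof.
  intro Oa. ord_induction a Oa.
  { dfn. apply Dfn_rec_val; auto with dfn. }
  intros a Oa IH.
  (* Uniqueness makes [rec_val] functional, so replacement collects the graph below [a] at once; the
     pair [opr a v] completes it to an approximation at [a]. *)
  destruct (replacement (fun c z => exists y, rec_val c y /\ z = opr c y) a) as [f0 Hf0].
  { dfn. apply Dfn_rec_val; auto with dfn. }
  { intros x z z' Hx (y & H & ->) (y' & H' & ->). f_equal. apply (rec_val_unique x); eauto using Ord_mem. }
  destruct (replacement rec_val a) as [X HX].
  { apply Dfn_rec_val; auto with dfn. }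
  { intros x y y' Hx. apply rec_val_unique. eauto using Ord_mem. }
  set (v := K a X).
  assert (E1 : forall c y, c ∊ a -> opr c y ∊ bun f0 (upair (opr a v) (opr a v)) <-> rec_val c y).
  { intros c y Hc. rewrite bunE, upairE, Hf0. split.
    - intros [(c' & _ & y' & H & E)|E].
      + apply opr_inj in E as [-> ->]; auto.
      + assert (E' : opr c y = opr a v) by tauto. apply opr_inj in E' as [-> _].
        now destruct (mem_irrefl a).
    - intro H. left. exists c. split; auto. exists y. auto. }
  assert (E2 : forall y, opr a y ∊ bun f0 (upair (opr a v) (opr a v)) <-> y = v).
  { intros y. rewrite bunE, upairE, Hf0. split.
    - intros [(c' & Hc & y' & H & E)|E].
      + apply opr_inj in E as [-> ->]. now destruct (mem_irrefl c').
      + assert (E' : opr a y = opr a v) by tauto. apply opr_inj in E'. tauto.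
    - intros ->. auto. }
  exists v, (bun f0 (upair (opr a v) (opr a v))). split; [|now apply E2].
  intros b Hb. apply sucE in Hb as [Hb| ->].
  - destruct (IH b Hb) as (w & fb & Ab & Hw). assert (Ob : Ord b) by eauto using Ord_mem.
    destruct (Ab b) as (w' & Xb & Ew & EK & EX); [apply sucE; auto|].
    apply Ew in Hw. subst w'. exists w, Xb. split; [|split]; auto.
    + intro u. rewrite E1 by auto. split; intro H.
      * apply (rec_val_unique b); auto. exists fb. split; auto. now apply Ew.
      * subst u. exists fb. split; auto. now apply Ew.
    + intro y. rewrite EX. split; intros (c & Hc & H); exists c; split; auto;
        assert (Hca : c ∊ a) by eauto using Ord_trans.
      * apply E1; auto. eapply approx_rec_val; eauto.
      * apply E1 in H; auto. eapply approx_rec_val; eauto.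
  - exists v, X. split; [|split]; auto. intro y. rewrite HX.
    split; intros (c & Hc & H); exists c; split; auto; apply E1; auto.
Qed.

Lemma ord_rec_spec a v : Ord a -> v = ord_rec a <-> rec_val a v.
Proof.
  intro Oa. assert (S : Ord a /\ rec_val a (ord_rec a) \/ ~ Ord a /\ ord_rec a = emp).
  { apply (the_spec (fun v => Ord a /\ rec_val a v \/ ~ Ord a /\ v = emp)).
    destruct (rec_val_exists a Oa) as [w Hw]. exists w. auto. }
  destruct S as [[_ S]|[N _]]; [|tauto]. split; [intros ->; auto|].
  intro H. eapply rec_val_unique; eauto.
Qed.

Lemma DTm_ord_rec s : DTm C s -> DTm C (fun rho => ord_rec (s rho)).
Proof.
  apply DTm_app1.
  apply (Dfn_ext (fun rho => Ord (rho 1) /\ rec_val (rho 1) (rho 0) \/ ~ Ord (rho 1) /\ rho 0 = emp)).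
  - intro rho. destruct (classic (Ord (rho 1))) as [O|N].
    + rewrite ord_rec_spec by auto. tauto.
    + assert (S : Ord (rho 1) /\ rec_val (rho 1) (ord_rec (rho 1)) \/ ~ Ord (rho 1) /\ ord_rec (rho 1) = emp).
      { apply (the_spec (fun v => Ord (rho 1) /\ rec_val (rho 1) v \/ ~ Ord (rho 1) /\ v = emp)). eauto. }
      destruct S as [[? _]|[_ ->]]; tauto.
  - dfn. apply Dfn_rec_val; auto with dfn.
Qed.

Lemma Dfn_ord_rec_graph : DfnP (fun rho => rho 0 = ord_rec (rho 1)).
Proof.
  apply (Dfn_weaken (K := any_formula) (C := C)); auto.
  apply Dfn_eqT; [auto with dfn|apply DTm_ord_rec; auto with dfn].
Qed.

Lemma ord_rec_eq a : Ord a -> ord_rec a = K a (rep a ord_rec).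
Proof.
  intro Oa. assert (V : rec_val a (ord_rec a)) by (now apply ord_rec_spec).
  destruct V as (f & A & H). destruct (A a) as (v & X & Ev & EK & EX); [apply sucE; auto|].
  apply Ev in H. rewrite H, EK at 1. f_equal. apply ext. intro y.
  rewrite EX, repE by exact Dfn_ord_rec_graph.
  split; intros (c & Hc & G); exists c; split; auto.
  - apply ord_rec_spec; eauto using Ord_mem. eapply approx_rec_val; eauto.
  - apply ord_rec_spec in G; eauto using Ord_mem. eapply approx_rec_val; eauto.
Qed.
End Recursion.
End OrdinalRecursion.

(** * The cumulative hierarchy *)

Definition V {M : structure} : M -> M := ord_rec (fun _ X => union (rep X power)).

Definition rk {M : structure} (x : M) : M :=
  the (fun a => Ord a /\ Sub x (V a) /\ forall b, b ∊ a -> ~ Sub x (V b)).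

Section Hierarchy.
Context {M : structure} {HZF : ZF_model M}.
Implicit Types a b c f x y z : M.

(** The ordinals inside any inductive set serve as the index set of countable iterations; minimality
    of ω is not asked for. *)
Lemma infinity : exists N : M, emp ∊ N /\ forall n, n ∊ N -> Ord n /\ suc n ∊ N.
Proof.
  destruct (zf_axioms _ ZF_infinity (fun _ => emp)) as (I & (e & He & Ee) & HI).
  cbn in *. exists (sep I Ord).
  assert (D : DfnP (fun rho : nat -> M => Ord (rho 0))) by (auto with dfn).
  split.
  - apply sepE; [exact D|]. split; [|apply Ord_emp]. replace emp with e; auto.
    apply ext. intro z. pose proof (Ee z). pose proof (empE z). cbn in *. tauto.
  - intros n Hn. apply sepE in Hn as [Hn On]; [|exact D]. split; auto.
    apply sepE; [exact D|]. split; [|now apply Ord_suc].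
    destruct (HI n Hn) as (y & Hy & Ey). replace (suc n) with y; auto.
    apply ext. intro z. rewrite sucE. exact (Ey z).
Qed.

(** The iteration is cumulative and runs through all ordinals by one formula, which treats
    successors and limits alike; it is later restricted to the set given by [infinity]. *)
Lemma omega_iteration (G : M -> M) x : DfnP (fun rho => rho 0 = G (rho 1)) ->
  exists F : M -> M, DfnP (fun rho => rho 0 = F (rho 1)) /\
    forall a, Ord a -> forall z, z ∊ F a <-> z ∊ x \/ exists b, b ∊ a /\ z ∊ G (F b).
Proof.
  intro DG.
  assert (E : forall X z, z ∊ bun x (union (rep X G)) <-> z ∊ x \/ exists y, y ∊ X /\ z ∊ G y).
  { intros X z. rewrite bunE, unionE. split; (intros [H|H]; [auto|right]).
    - destruct H as (w & Hw & Hz). apply repE in Hw as (y & Hy & ->); eauto.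
    - destruct H as (y & Hy & Hz). exists (G y). split; auto. apply repE; eauto. }
  assert (DK : DfnP (fun rho => rho 0 = (fun _ X => bun x (union (rep X G))) (rho 1) (rho 2))).
  { apply Dfn_eqT; [auto with dfn|].
    apply (DTm_set (fun rho => bun x (union (rep (rho 2) G))) _ (fun rho => E _)).
    dfn. }
  exists (ord_rec (fun _ X => bun x (union (rep X G)))). split.
  - exact (Dfn_ord_rec_graph _ DK).
  - intros a Oa z. rewrite (ord_rec_eq _ DK a Oa), E.
    split; (intros [H|(y & Hy & Hz)]; [auto|right]).
    + apply repE in Hy as (b & Hb & ->); [eauto|exact (Dfn_ord_rec_graph _ DK)].
    + exists (ord_rec (fun _ X => bun x (union (rep X G))) y). split; auto.
      apply repE; [exact (Dfn_ord_rec_graph _ DK)|eauto].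
Qed.

Lemma transitive_superset x : exists t, Sub x t /\ Trans t.
Proof.
  destruct infinity as (N & N0 & NS).
  destruct (omega_iteration union x) as (F & DF & EF).
  { apply Dfn_eqT; auto with dfn. }
  exists (union (rep N F)). split.
  - intros z Hz. apply unionE. exists (F emp). split; [apply repE; eauto|].
    apply EF; auto using Ord_emp.
  - intros y Hy z Hz. apply unionE in Hy as (w & Hw & Hy).
    apply repE in Hw as (n & Hn & ->); auto. apply unionE. exists (F (suc n)).
    destruct (NS n Hn). split; [apply repE; eauto|]. apply EF; auto using Ord_suc.
    right. exists n. split; [apply sucE; auto|]. apply unionE. eauto.
Qed.

(** Foundation speaks of sets only; a transitive set around [x] turns the class of counterexamples
    into a set. *)
Lemma set_ind (P : M -> Prop) : DfnP (fun rho => P (rho 0)) ->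
  (forall x, (forall y, y ∊ x -> P y) -> P x) -> forall x, P x.
Proof.
  intros D IH x. apply NNPP. intro N.
  destruct (transitive_superset (upair x x)) as (t & St & Tt).
  assert (D' : DfnP (fun rho => ~ P (rho 0))) by (apply Dfn_not; exact D).
  destruct (found (sep t (fun y => ~ P y)) x) as (y & Hy & Ny).
  - apply sepE; auto. split; auto. apply St, upairE. auto.
  - apply sepE in Hy as [Hy Py]; auto. apply Py, IH. intros z Hz. apply NNPP. intro Pz.
    apply (Ny z Hz). apply sepE; auto. split; auto. eapply Tt; eauto.
Qed.

Lemma union_powersE X z : z ∊ union (rep X power) <-> exists y, y ∊ X /\ Sub z y.
Proof.
  assert (D : DfnP (fun rho : nat -> M => rho 0 = power (rho 1))) by (apply Dfn_eqT; auto with dfn).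
  rewrite unionE. split.
  - intros (w & Hw & Hz). apply repE in Hw as (y & Hy & ->); auto. exists y. now rewrite <- powerE.
  - intros (y & Hy & Hz). exists (power y). rewrite powerE. split; auto. apply repE; eauto.
Qed.

Lemma Dfn_V_step C : Dfn any_formula C
  (fun rho : nat -> M => rho 0 = (fun _ X => union (rep X power)) (rho 1) (rho 2)).
Proof.
  apply Dfn_eqT; [auto with dfn|].
  apply (DTm_set (fun rho => union (rep (rho 2) power)) _ (fun rho => union_powersE _)). dfn.
Qed.

Lemma DTm_V C (s : (nat -> M) -> M) : DTm C s -> DTm C (fun rho => V (s rho)).
Proof. apply DTm_ord_rec, Dfn_V_step. Qed.

Lemma Dfn_V_graph : DfnP (fun rho : nat -> M => rho 0 = V (rho 1)).
Proof. apply Dfn_eqT; [auto with dfn|apply DTm_V; auto with dfn]. Qed.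

Lemma VE a x : Ord a -> x ∊ V a <-> exists b, b ∊ a /\ Sub x (V b).
Proof.
  intro Oa. unfold V at 1. rewrite (ord_rec_eq _ (Dfn_V_step (fun _ => True))) by auto. fold (V (M := M)).
  rewrite union_powersE. split.
  - intros (y & Hy & S). apply repE in Hy as (b & Hb & ->); eauto using Dfn_V_graph.
  - intros (b & Hb & S). exists (V b). split; auto. apply repE; eauto using Dfn_V_graph.
Qed.

Lemma V_mono a b : Ord a -> b ∊ a -> Sub (V b) (V a).
Proof.
  intros Oa Hb x Hx. apply VE in Hx as (c & Hc & S); eauto using Ord_mem.
  apply VE; auto. exists c. eauto using Ord_trans.
Qed.

Lemma V_trans a : Ord a -> Trans (V a).
Proof.
  intros Oa y Hy z Hz. apply VE in Hy as (b & Hb & S); auto.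
  apply (V_mono a b); auto.
Qed.

Lemma V_super a x y : Ord a -> y ∊ V a -> Sub x y -> x ∊ V a.
Proof.
  intros Oa Hy Sx. apply VE in Hy as (b & Hb & S); auto. apply VE; auto.
  exists b. split; auto. intros z Hz. auto.
Qed.

Lemma V_in a b : Ord a -> b ∊ a -> V b ∊ V a.
Proof. intros Oa Hb. apply VE; auto. exists b. split; auto. intro z; auto. Qed.

Lemma Ord_sub_V a : Ord a -> Sub a (V a).
Proof.
  intro Oa. ord_induction a Oa.
  { dfn. apply Dfn_Sub; auto with dfn. apply DTm_V; auto with dfn. }
  intros a Oa IH b Hb. apply VE; auto. exists b. split; auto.
Qed.

Lemma rk_unique x a a' :
  (Ord a /\ Sub x (V a) /\ forall b, b ∊ a -> ~ Sub x (V b)) ->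
  (Ord a' /\ Sub x (V a') /\ forall b, b ∊ a' -> ~ Sub x (V b)) -> a = a'.
Proof.
  intros (O & S & L) (O' & S' & L'). destruct (Ord_tri a a') as [H|[H|H]]; auto.
  - now destruct (L' a).
  - now destruct (L a').
Qed.

Lemma rk_spec_of x a : Ord a -> Sub x (V a) ->
  Ord (rk x) /\ Sub x (V (rk x)) /\ forall b, b ∊ rk x -> ~ Sub x (V b).
Proof.
  intros Oa S. apply (the_spec (fun a => Ord a /\ Sub x (V a) /\ forall b, b ∊ a -> ~ Sub x (V b))).
  destruct (Ord_min (fun a => Sub x (V a)) a) as (b & Ob & Sb & Hb); eauto.
  apply Dfn_Sub; [auto with dfn|apply DTm_V; auto with dfn].
Qed.

Lemma Dfn_rk_spec C : Dfn any_formula C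
  (fun rho : nat -> M => Ord (rho 0) /\ Sub (rho 1) (V (rho 0)) /\ forall b, b ∊ rho 0 -> ~ Sub (rho 1) (V b)).
Proof. dfn; apply Dfn_Sub; try apply DTm_V; auto with dfn. Qed.

(** By induction every element has a rank. Replacement makes these ranks a set, and the successor of
    its supremum works for [x]. *)
Lemma in_some_V x : exists a, Ord a /\ Sub x (V a).
Proof.
  revert x. apply set_ind.
  { dfn. apply Dfn_Sub; [auto with dfn|apply DTm_V; auto with dfn]. }
  intros x IH.
  destruct (replacement (fun y a => Ord a /\ Sub y (V a) /\ forall b, b ∊ a -> ~ Sub y (V b)) x) as [A HA].
  { apply (Dfn_subst _ [fun rho => rho 1; fun rho => rho 0] (Dfn_rk_spec _)). tms. }
  { intros y a a' _. apply rk_unique. }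
  assert (OA : forall a, a ∊ A -> Ord a) by (intros a Ha; apply HA in Ha as (y & _ & O & _); exact O).
  exists (suc (union A)). assert (OU : Ord (union A)) by now apply Ord_union.
  split; [now apply Ord_suc|].
  intros y Hy. destruct (IH y Hy) as (a & Oa & S).
  pose proof (rk_spec_of y a Oa S) as R. assert (HR : rk y ∊ A) by (apply HA; eauto).
  apply VE; [now apply Ord_suc|]. exists (rk y). split; [|tauto]. apply sucE.
  apply Ord_sub; try tauto. intros z Hz. apply unionE. eauto.
Qed.

Lemma rk_spec x : Ord (rk x) /\ Sub x (V (rk x)) /\ forall b, b ∊ rk x -> ~ Sub x (V b).
Proof. destruct (in_some_V x) as (a & Oa & S). now apply (rk_spec_of x a). Qed.

Lemma Ord_rk x : Ord (rk x).
Proof. apply rk_spec. Qed.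

Lemma DTm_rk C (s : (nat -> M) -> M) : DTm C s -> DTm C (fun rho => rk (s rho)).
Proof.
  apply DTm_app1. eapply Dfn_ext; [|apply Dfn_rk_spec]. intro rho. cbv beta. split.
  - intro H. apply (rk_unique _ _ _ H), rk_spec.
  - intros ->. apply rk_spec.
Qed.

Lemma in_V_rk a x : Ord a -> x ∊ V a <-> rk x ∊ a.
Proof.
  intro Oa. destruct (rk_spec x) as (O & S & L). rewrite VE by auto. split.
  - intros (b & Hb & Sb). assert (Ob : Ord b) by eauto using Ord_mem.
    destruct (Ord_tri (rk x) b) as [H|[->|H]]; eauto using Ord_trans. now destruct (L b).
  - eauto.
Qed.

Lemma rk_mem x y : y ∊ x -> rk y ∊ rk x.
Proof. intro H. apply in_V_rk; [apply Ord_rk|]. now apply rk_spec. Qed.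

Lemma rk_lt_trans x y z : rk x ∊ rk y -> rk y ∊ rk z -> rk x ∊ rk z.
Proof. intros H1 H2. eapply Ord_trans; eauto using Ord_rk. Qed.

Lemma rk_opr_l x y : rk x ∊ rk (opr x y).
Proof. apply (rk_lt_trans _ (upair x x)); apply rk_mem, upairE; auto. Qed.

Lemma rk_opr_r x y : rk y ∊ rk (opr x y).
Proof. apply (rk_lt_trans _ (upair x y)); apply rk_mem, upairE; auto. Qed.

Lemma rk_min (P : M -> Prop) x : DfnP (fun rho => P (rho 0)) -> P x ->
  exists y, P y /\ forall z, P z -> ~ rk z ∊ rk y.
Proof.
  intros D Px. destruct (Ord_min (fun a => exists y, P y /\ rk y = a) (rk x)) as (a & _ & (y & Py & <-) & L).
  - apply Dfn_ex. apply Dfn_and; [apply (Dfn_app1 P); auto with dfn|].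
    apply Dfn_eqT; [apply DTm_rk|]; auto with dfn.
  - apply Ord_rk.
  - eauto.
  - exists y. split; auto. intros z Pz H. apply (L _ H). eauto.
Qed.

(** Components of pairs and codes of subformulas are not elements of the code, but their rank is
    smaller; this is the induction that reaches them. *)
Lemma rk_ind (P : M -> Prop) : DfnP (fun rho => P (rho 0)) ->
  (forall x, (forall y, rk y ∊ rk x -> P y) -> P x) -> forall x, P x.
Proof.
  intros D IH x. apply NNPP. intro N.
  destruct (rk_min (fun x => ~ P x) x) as (y & Ny & L); auto.
  { now apply Dfn_not. }
  apply Ny, IH. intros z Hz. apply NNPP. intro Pz. now apply (L z).
Qed.

Lemma Ord_notin_V a : Ord a -> ~ a ∊ V a.
Proof.
  intro Oa. ord_induction a Oa.
  { dfn. apply Dfn_memT; [|apply DTm_V]; auto with dfn. }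
  intros a Oa IH H. apply VE in H as (b & Hb & S); auto. apply (IH b Hb). auto.
Qed.

Lemma rk_ord a : Ord a -> rk a = a.
Proof.
  intro Oa. destruct (rk_spec a) as (O & S & L).
  destruct (Ord_tri (rk a) a) as [H|[H|H]]; auto.
  - destruct (Ord_notin_V (rk a)); auto.
  - destruct (L a H). now apply Ord_sub_V.
Qed.

End Hierarchy.

#[export] Hint Extern 0 (DTm _ (fun rho => V _)) => simple apply DTm_V : dfn.
#[export] Hint Extern 0 (DTm _ (fun rho => rk _)) => simple apply DTm_rk : dfn.

(** * Meaning of the formulas in the definition of OD *)

Section Semantics.
Context {M : structure}.
Implicit Types a c d f i m s t x y z A D G U W X : M.

(** This and the next predicates follow the shape of the corresponding formulas, so that
    satisfaction unfolds to them by rewriting and conversion. *)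
Definition Fn f d : Prop :=
  (forall z, z ∊ f -> exists x, x ∊ d /\ exists y, z = opr x y) /\
  (forall x, x ∊ d -> exists y, opr x y ∊ f /\ forall y', opr x y' ∊ f -> y' = y).

Definition FnInto f d A : Prop := Fn f d /\ forall x y, opr x y ∊ f -> y ∊ A.

Definition zero_or_suc x : Prop := x = emp \/ exists y, x = suc y.

Definition Natural x : Prop := Ord x /\ zero_or_suc x /\ forall y, y ∊ x -> zero_or_suc y.

Fixpoint num (k : nat) : M := match k with 0 => emp | S k => suc (num k) end.

Definition truth_set U m A (P : M -> Prop) : Prop := forall s, s ∊ U <-> FnInto s m A /\ P s.

Definition agree m i s t : Prop :=
  forall k, k ∊ m -> k <> i -> forall y, opr k y ∊ s <-> opr k y ∊ t.

Definition clause G A m c U : Prop :=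
  (exists i, i ∊ m /\ exists j, j ∊ m /\ c = opr (num 0) (opr i j) /\
     truth_set U m A (fun s => exists x y, opr i x ∊ s /\ opr j y ∊ s /\ x ∊ y)) \/
  (exists i, i ∊ m /\ exists j, j ∊ m /\ c = opr (num 1) (opr i j) /\
     truth_set U m A (fun s => exists x y, opr i x ∊ s /\ opr j y ∊ s /\ x = y)) \/
  (exists d W, opr d W ∊ G /\ c = opr (num 2) d /\ truth_set U m A (fun s => ~ s ∊ W)) \/
  (exists d W e X, opr d W ∊ G /\ opr e X ∊ G /\ c = opr (num 3) (opr d e) /\
     truth_set U m A (fun s => s ∊ W /\ s ∊ X)) \/
  (exists i, i ∊ m /\ exists d W, opr d W ∊ G /\ c = opr (num 4) (opr i d) /\
     truth_set U m A (fun s => exists t, t ∊ W /\ agree m i s t)).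

Definition SatFn G A m : Prop :=
  (exists D, Fn G D) /\ forall c U, opr c U ∊ G -> clause G A m c U.

(** Only the four data to be well-ordered are arguments. [G] and [U] stay existential because the
    truth set [U] is determined by θ, m and c. *)
Definition OD_data a θ m c s : Prop :=
  Ord θ /\ Natural m /\ exists G U, SatFn G (V θ) m /\ opr c U ∊ G /\ s ∊ U /\ opr emp a ∊ s /\
  (forall i, i ∊ m -> i <> emp -> forall y, opr i y ∊ s -> Ord y) /\
  forall t, t ∊ U -> agree m emp s t -> opr emp a ∊ t.

Definition OD a : Prop := exists θ m c s, OD_data a θ m c s.
End Semantics.

Section Unfolding.
Context {M : structure} {HZF : ZF_model M}.
Implicit Types rho : nat -> M.

Ltac unf := cbn [sat scons Nat.add BAll BEx Iff].

Lemma sat_is_subset rho x y : sat rho (is_subset x y) <-> Sub (rho x) (rho y).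
Proof. reflexivity. Qed.

Lemma sat_is_empty rho x : sat rho (is_empty x) <-> rho x = emp.
Proof.
  split; [|intros E a; cbn; rewrite E; apply empE].
  intro H. destruct (emp_ex (rho x)) as [[z Hz]|E]; auto. now destruct (H z).
Qed.

Lemma sat_is_succ rho y x : sat rho (is_succ y x) <-> rho y = suc (rho x).
Proof.
  rewrite eq_set_ext. unfold is_succ. unf. setoid_rewrite sucE. reflexivity.
Qed.

Lemma sat_is_pair rho z x y : sat rho (is_pair z x y) <-> rho z = upair (rho x) (rho y).
Proof.
  rewrite eq_set_ext. unfold is_pair. unf. setoid_rewrite upairE. reflexivity.
Qed.

Lemma sat_is_opair rho z x y : sat rho (is_opair z x y) <-> rho z = opr (rho x) (rho y).
Proof.
  unfold is_opair. unf. setoid_rewrite sat_is_pair. unf. split.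
  - intros (p & q & -> & -> & ->). reflexivity.
  - intros ->. eexists _, _. unfold opr. eauto.
Qed.

Lemma sat_maps rho f x y : sat rho (maps f x y) <-> opr (rho x) (rho y) ∊ rho f.
Proof.
  unfold maps. unf. setoid_rewrite sat_is_opair. unf. split.
  - intros (z & Hz & ->). auto.
  - eauto.
Qed.

Lemma sat_is_fun rho f d : sat rho (is_fun f d) <-> Fn (rho f) (rho d).
Proof.
  unfold is_fun. unf. setoid_rewrite sat_is_opair. setoid_rewrite sat_maps. unf. reflexivity.
Qed.

Lemma sat_is_fun_into rho f d A : sat rho (is_fun_into f d A) <-> FnInto (rho f) (rho d) (rho A).
Proof.
  unfold is_fun_into. unf. rewrite sat_is_fun. setoid_rewrite sat_maps. unf. reflexivity.
Qed.

Lemma sat_is_ord rho x : sat rho (is_ord x) <-> Ord (rho x).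
Proof. reflexivity. Qed.

Lemma sat_is_nat rho x : sat rho (is_nat x) <-> Natural (rho x).
Proof.
  unfold is_nat, is_zero_or_succ. unf. setoid_rewrite sat_is_empty. setoid_rewrite sat_is_succ.
  rewrite sat_is_ord. unf. reflexivity.
Qed.

Lemma sat_is_rank_step rho f b w : sat rho (is_rank_step f b w) <->
  forall x, x ∊ rho w <-> exists c, c ∊ rho b /\ exists y, opr c y ∊ rho f /\ Sub x y.
Proof.
  unfold is_rank_step. unf. setoid_rewrite sat_maps. setoid_rewrite sat_is_subset. reflexivity.
Qed.

Lemma sat_is_numeral k : forall rho x, sat rho (is_numeral k x) <-> rho x = num k.
Proof.
  induction k; intros rho x; cbn [is_numeral num]; [apply sat_is_empty|].
  unf. setoid_rewrite IHk. setoid_rewrite sat_is_succ. unf. split.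
  - intros (y & -> & ->). auto.
  - eauto.
Qed.

Lemma sat_is_tag1 rho k c x : sat rho (is_tag1 k c x) <-> rho c = opr (num k) (rho x).
Proof.
  unfold is_tag1. unf. setoid_rewrite sat_is_numeral. setoid_rewrite sat_is_opair. unf.
  split; [intros (y & -> & ->); auto|eauto].
Qed.

Lemma sat_is_tag2 rho k c x y : sat rho (is_tag2 k c x y) <-> rho c = opr (num k) (opr (rho x) (rho y)).
Proof.
  unfold is_tag2. unf. setoid_rewrite sat_is_tag1. setoid_rewrite sat_is_opair. unf.
  split; [intros (z & -> & ->); auto|eauto].
Qed.

Lemma sat_agree_off rho m i s t :
  sat rho (agree_off m i s t) <-> agree (rho m) (rho i) (rho s) (rho t).
Proof. unfold agree_off. unf. setoid_rewrite sat_maps. reflexivity. Qed.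

Lemma sat_is_truth_set rho U m A p :
  sat rho (is_truth_set U m A p) <->
  truth_set (rho U) (rho m) (rho A) (fun s => sat (scons s rho) p).
Proof. unfold is_truth_set. unf. setoid_rewrite sat_is_fun_into. reflexivity. Qed.

Lemma sat_is_satisfaction rho G A m :
  sat rho (is_satisfaction G A m) <-> SatFn (rho G) (rho A) (rho m).
Proof.
  unfold is_satisfaction, SatFn, clause, truth_set. unf. 
  setoid_rewrite sat_is_fun. setoid_rewrite sat_is_truth_set. setoid_rewrite sat_maps.
  setoid_rewrite sat_is_tag1. setoid_rewrite sat_is_tag2. unfold truth_set. unf.
  setoid_rewrite sat_maps. setoid_rewrite sat_agree_off. unf. reflexivity.
Qed.

Lemma sat_is_V rho v t : Ord (rho t) -> sat rho (is_V v t) <-> rho v = V (rho t).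
Proof.
  intro Ot. unfold is_V. unf. setoid_rewrite sat_is_fun. setoid_rewrite sat_maps.
  setoid_rewrite sat_is_rank_step. unf. split.
  - intros (f & [Ff Uf] & Hf & Hv).
    (* A function obeying the recursion on [rho t] is forced to take the values [V b], by induction
       on [b]. *)
    assert (E : forall b, Ord b -> b ∊ rho t -> forall y, opr b y ∊ f -> y = V b).
    { intros b Ob. ord_induction b Ob; [dfn|]. intros b Ob IH Hb y Hy. apply ext. intro x.
      rewrite (Hf b Hb y Hy x), VE by auto. split; intros (c & Hc & H); exists c; (split; [auto|]);
        assert (Hct : c ∊ rho t) by eauto using Ord_trans.
      - destruct H as (w & Hw & S). rewrite <- (IH c Hc Hct w Hw). auto.
      - destruct (Uf c Hct) as (w & Hw & _). exists w. split; [auto|]. rewrite (IH c Hc Hct w Hw). auto. }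
    apply ext. intro x. rewrite Hv, VE by auto. split; intros (c & Hc & H); exists c; (split; [auto|]).
    + destruct H as (w & Hw & S). rewrite <- (E c) with (y := w); eauto using Ord_mem.
    + destruct (Uf c Hc) as (w & Hw & _). exists w. split; [auto|]. rewrite (E c) with (y := w); eauto using Ord_mem.
  - intros ->.
    assert (Df : DfnP (fun rho => rho 0 = (fun b => opr b (V b)) (rho 1))) by dfn.
    exists (rep (rho t) (fun b => opr b (V b))).
    assert (Ef : forall b y, opr b y ∊ rep (rho t) (fun b => opr b (V b)) <-> b ∊ rho t /\ y = V b).
    { intros b y. rewrite repE by exact Df. split.
      - intros (b' & Hb & E). apply opr_inj in E as [-> ->]. auto.
      - intros [Hb ->]. eauto. }
    assert (St : forall b, Ord b -> Sub b (rho t) -> forall x, x ∊ V b <->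
      exists c, c ∊ b /\ exists y, opr c y ∊ rep (rho t) (fun b => opr b (V b)) /\ Sub x y).
    { intros b Ob Sb x. rewrite VE by auto.
      split; intros (c & Hc & H); exists c; (split; [auto|]).
      - exists (V c). rewrite Ef. auto.
      - destruct H as (y & Hy & S). apply Ef in Hy as [_ ->]. auto. }
    split; [split|split].
    + intros z Hz. apply repE in Hz as (b & Hb & ->); eauto.
    + intros b Hb. exists (V b). setoid_rewrite Ef. tauto.
    + intros b Hb y Hy. apply Ef in Hy as [_ ->]. apply St; eauto using Ord_mem.
      intros x Hx. eauto using Ord_trans.
    + apply St; auto. intros x Hx; auto.
Qed.

Lemma sat_is_OD rho a : sat rho (is_OD a) <-> OD (rho a).
Proof.
  unfold is_OD, OD, OD_data. unf.
  setoid_rewrite sat_is_nat. setoid_rewrite sat_is_satisfaction. setoid_rewrite sat_maps.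
  setoid_rewrite sat_is_empty. setoid_rewrite sat_agree_off. setoid_rewrite sat_is_ord. unf.
  split.
  - intros (θ & A & m & G & c & U & s & e & Oθ & HA & Hm & HG & Hc & Hs & -> & H).
    apply sat_is_V in HA; [|exact Oθ]. cbn in HA. subst A. exists θ, m, c, s.
    split; [|split]; auto. exists G, U. tauto.
  - intros (θ & m & c & s & Oθ & Hm & G & U & H).
    exists θ, (V θ), m, G, c, U, s, emp. rewrite sat_is_V by exact Oθ. cbn. tauto.
Qed.
End Unfolding.

(** * Truth sets and codes of formulas *)

Lemma Dfn_sat {M : structure} (C : M -> Prop) (p : fml) : Dfn any_formula C (fun rho => sat rho p).
Proof. exists p, []. split; [exact I|]. split; [constructor|]. reflexivity. Qed.

Section FrozenDefinability.
Context {M : structure} {HZF : ZF_model M} {C : M -> Prop}.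
Notation DTm := (DTm C).
Notation Dfn := (Dfn any_formula C).

Lemma Dfn_Fn s t : DTm s -> DTm t -> Dfn (fun rho => Fn (s rho) (t rho)).
Proof. apply Dfn_app2. exact (Dfn_ext _ _ (fun rho => sat_is_fun rho 0 1) (Dfn_sat C _)). Qed.

Lemma Dfn_FnInto s t u : DTm s -> DTm t -> DTm u -> Dfn (fun rho => FnInto (s rho) (t rho) (u rho)).
Proof. apply Dfn_app3. exact (Dfn_ext _ _ (fun rho => sat_is_fun_into rho 0 1 2) (Dfn_sat C _)). Qed.

Lemma Dfn_Natural s : DTm s -> Dfn (fun rho => Natural (s rho)).
Proof. apply Dfn_app1. exact (Dfn_ext _ _ (fun rho => sat_is_nat rho 0) (Dfn_sat C _)). Qed.

Lemma Dfn_agree s t u v : DTm s -> DTm t -> DTm u -> DTm v ->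
  Dfn (fun rho => agree (s rho) (t rho) (u rho) (v rho)).
Proof. apply Dfn_app4. exact (Dfn_ext _ _ (fun rho => sat_agree_off rho 0 1 2 3) (Dfn_sat C _)). Qed.

Lemma Dfn_SatFn s t u : DTm s -> DTm t -> DTm u -> Dfn (fun rho => SatFn (s rho) (t rho) (u rho)).
Proof. apply Dfn_app3. exact (Dfn_ext _ _ (fun rho => sat_is_satisfaction rho 0 1 2) (Dfn_sat C _)). Qed.

Lemma Dfn_OD s : DTm s -> Dfn (fun rho => OD (s rho)).
Proof. apply Dfn_app1. exact (Dfn_ext _ _ (fun rho => sat_is_OD rho 0) (Dfn_sat C _)). Qed.
End FrozenDefinability.

#[export] Hint Extern 0 (Dfn _ _ (fun rho => Fn _ _)) => simple apply Dfn_Fn : dfn.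
#[export] Hint Extern 0 (Dfn _ _ (fun rho => FnInto _ _ _)) => simple apply Dfn_FnInto : dfn.
#[export] Hint Extern 0 (Dfn _ _ (fun rho => Natural _)) => simple apply Dfn_Natural : dfn.
#[export] Hint Extern 0 (Dfn _ _ (fun rho => agree _ _ _ _)) => simple apply Dfn_agree : dfn.
#[export] Hint Extern 0 (Dfn _ _ (fun rho => SatFn _ _ _)) => simple apply Dfn_SatFn : dfn.
#[export] Hint Extern 0 (Dfn _ _ (fun rho => OD _)) => simple apply Dfn_OD : dfn.

(** Satisfaction functions without functionality. This version is visibly preserved by unions, and
    [truth_unique] gives functionality back. *)
Definition closed_rel {M : structure} (G A m : M) : Prop :=
  forall c U, opr c U ∊ G -> clause G A m c U.

(** The feature of codes that suffices to order them. It is expressed inside [M], hence covers codes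
    of nonstandard formulas, which external recursion cannot reach. *)
Definition hereditary_pair {M : structure} (x : M) : Prop :=
  exists S, x ∊ S /\ forall y, y ∊ S -> Ord y \/ exists u, u ∊ S /\ exists v, v ∊ S /\ y = opr u v.

Definition cart {M : structure} (a b : M) : M :=
  sep (power (power (bun a b))) (fun z => exists x, x ∊ a /\ exists y, y ∊ b /\ z = opr x y).

Section Codes.
Context {M : structure} {HZF : ZF_model M}.
Implicit Types a b c d e i m s t u v w x y z A D G S U W X : M.

Lemma cartE a b z : z ∊ cart a b <-> exists x, x ∊ a /\ exists y, y ∊ b /\ z = opr x y.
Proof.
  unfold cart. rewrite sepE by dfn. split; [tauto|]. intro H. split; [|exact H].
  destruct H as (x & Hx & y & Hy & ->). apply powerE. intros p Hp. apply powerE. intros q Hq.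
  unfold opr in Hp. apply upairE in Hp as [-> | ->]; apply upairE in Hq as [-> | ->]; apply bunE; auto.
Qed.

Lemma num_mem k x : x ∊ num k <-> exists j, j < k /\ x = num j.
Proof.
  induction k; cbn [num].
  - split; [intro H; now apply empE in H|intros (j & Hj & _); lia].
  - rewrite sucE, IHk. split.
    + intros [(j & Hj & ->)| ->]; [exists j|exists k]; auto with arith.
    + intros (j & Hj & ->). destruct (Nat.eq_dec j k) as [->|N]; [auto|left].
      exists j. split; [lia|auto].
Qed.

Lemma num_inj j k : num j = num k :> M -> j = k.
Proof.
  intro E. destruct (Nat.lt_trichotomy j k) as [L|[->|L]]; auto; exfalso.
  - apply (mem_irrefl (num k)). rewrite <- E at 1. apply num_mem. eauto.
  - apply (mem_irrefl (num k)). rewrite <- E at 2. apply num_mem. eauto.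
Qed.

Lemma Ord_num k : Ord (num k : M).
Proof. induction k; cbn; auto using Ord_emp, Ord_suc. Qed.

Lemma truth_set_unique U U' m A P P' : truth_set U m A P -> truth_set U' m A P' ->
  (forall s, P s <-> P' s) -> U = U'.
Proof. intros H H' E. apply ext. intro s. rewrite (H s), (H' s), E. tauto. Qed.

(* By Foundation: induction on the rank of the code. *)
Lemma truth_unique G G' A m : closed_rel G A m -> closed_rel G' A m ->
  forall c U U', opr c U ∊ G -> opr c U' ∊ G' -> U = U'.
Proof.
  intros HG HG' c. pattern c. revert c. apply rk_ind; [dfn|].
  intros c IH U U' H H'. apply HG in H. apply HG' in H'.
  (* Of the 25 pairs of clauses, distinct tags exclude all but the five diagonal ones; in the atomic
     ones the two truth conditions coincide. *)
  assert (tag : forall k z k' z', c = opr (num k) z -> c = opr (num k') z' -> k = k' /\ z = z').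
  { intros k z k' z' -> E. apply opr_inj in E as [E1 E2]. apply num_inj in E1. auto. }
  assert (lt1 : forall k d, c = opr (num k) d -> rk d ∊ rk c) by (intros k d ->; apply rk_opr_r).
  assert (lt2 : forall k d e, c = opr (num k) (opr d e) -> rk d ∊ rk c /\ rk e ∊ rk c).
  { intros k d e ->. split; (eapply rk_lt_trans; [|apply rk_opr_r]); [apply rk_opr_l|apply rk_opr_r]. }
  destruct H as [(i & Hi & j & Hj & E & T)|[(i & Hi & j & Hj & E & T)|[(d & W & HW & E & T)|
      [(d & W & e & X & HW & HX & E & T)|(i & Hi & d & W & HW & E & T)]]]],
    H' as [(i' & Hi' & j' & Hj' & E' & T')|[(i' & Hi' & j' & Hj' & E' & T')|[(d' & W' & HW' & E' & T')|
      [(d' & W' & e' & X' & HW' & HX' & E' & T')|(i' & Hi' & d' & W' & HW' & E' & T')]]]];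
    destruct (tag _ _ _ _ E E') as [K Z]; try discriminate K; clear K;
    try (apply opr_inj in Z as [Z1 Z2]); try subst i'; try subst j'; try subst d'; try subst e';
    apply (truth_set_unique _ _ _ _ _ _ T T'); intro s; try tauto.
  - now rewrite (IH d (lt1 _ _ E) W W').
  - destruct (lt2 _ _ _ E) as [Ld Le]. now rewrite (IH d Ld W W'), (IH e Le X X').
  - destruct (lt2 _ _ _ E) as [_ Ld]. now rewrite (IH d Ld W W').
Qed.

(** A transitive Kuratowski pair would contain x, forcing x = {x} or x = {x, y}. So the two
    alternatives in [hereditary_pair] exclude each other. *)
Lemma not_Ord_opr x y : ~ Ord (opr x y).
Proof.
  intros [T _]. assert (H : x ∊ opr x y).
  { apply (T (upair x x)); apply upairE; auto. }
  apply upairE in H as [H|H]; apply (mem_irrefl x); rewrite H at 2; apply upairE; auto.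
Qed.

Lemma hereditary_pair_opr x y : hereditary_pair (opr x y) -> hereditary_pair x /\ hereditary_pair y.
Proof.
  intros (S & H & HS). destruct (HS _ H) as [O|(u & Hu & v & Hv & E)].
  - now apply not_Ord_opr in O.
  - apply opr_inj in E as [-> ->]. split; exists S; auto.
Qed.

Lemma hereditary_pair_code G A m c U : Ord m -> closed_rel G A m -> opr c U ∊ G -> hereditary_pair c.
Proof.
  intros Om HG Hc.
  set (D := sep (union (union G)) (fun c => exists U, opr c U ∊ G)).
  assert (ED : forall d W, opr d W ∊ G -> d ∊ D).
  { intros d W H. apply sepE; [dfn|]. split; [|eauto].
    apply unionE. exists (upair d d). split; [|apply upairE; auto].
    apply unionE. exists (opr d W). split; auto. apply upairE. auto. }
  (* The tags 0, ..., 4 are the elements of [num 5]. The product [cart W W] added below accounts for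
     the inner pair of a binary code, which need not lie in [W]. *)
  set (W := bun D (bun m (num 5))).
  assert (WD : forall d X, opr d X ∊ G -> d ∊ W) by (intros; apply bunE; eauto).
  assert (Wm : forall i, i ∊ m -> i ∊ W) by (intros; apply bunE; right; apply bunE; auto).
  assert (Wn : forall k, k < 5 -> num k ∊ W).
  { intros k L. apply bunE. right. apply bunE. right. apply num_mem. eauto. }
  assert (HW1 : forall z, z ∊ W -> z ∊ bun W (cart W W)) by (intros; apply bunE; auto).
  assert (HW2 : forall x y, x ∊ W -> y ∊ W -> opr x y ∊ bun W (cart W W)).
  { intros x y Hx Hy. apply bunE. right. apply cartE. exists x. split; auto. exists y. auto. }
  exists (bun W (cart W W)). split; [eauto|].
  intros y Hy. apply bunE in Hy as [Hy|Hy].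
  - apply bunE in Hy as [Hy|Hy].
    + right. apply sepE in Hy as [_ (Y & HY)]; [|dfn]. apply HG in HY.
      destruct HY as [(i & Hi & j & Hj & -> & T)|[(i & Hi & j & Hj & -> & T)|[(d & X & HX & -> & T)|
        [(d & X & e & Z & HX & HZ & -> & T)|(i & Hi & d & X & HX & -> & T)]]]];
        (eexists; split; [apply HW1, Wn|eexists; split; [|reflexivity]]); eauto with arith.
    + left. apply bunE in Hy as [Hy|Hy]; [eauto using Ord_mem|].
      apply num_mem in Hy as (j & _ & ->). apply Ord_num.
  - right. apply cartE in Hy as (u & Hu & v & Hv & ->). exists u. split; auto. exists v. auto.
Qed.

Lemma Dfn_hereditary_pair C (s : (nat -> M) -> M) : DTm C s -> Dfn any_formula C (fun rho => hereditary_pair (s rho)).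
Proof. apply Dfn_app1. unfold hereditary_pair. dfn. Qed.

End Codes.

#[export] Hint Extern 0 (Dfn _ _ (fun rho => hereditary_pair _)) => simple apply Dfn_hereditary_pair : dfn.

(** * The definable well-ordering of the ordinal-definable sets *)

(** [R] is the comparison of components, whose ranks are smaller. Two ordinals of equal rank are
    equal, so no clause for them is required. *)
Definition code_cmp {M : structure} (R x y : M) : Prop :=
  rk x ∊ rk y \/ rk x = rk y /\
    (Ord x /\ ~ Ord y \/
     exists x0 x1 y0 y1, x = opr x0 x1 /\ y = opr y0 y1 /\
       (opr x0 y0 ∊ R \/ x0 = y0 /\ opr x1 y1 ∊ R)).

Definition code_rel {M : structure} : M -> M :=
  ord_rec (fun a X => sep (cart (V a) (V a))
    (fun p => exists x y, p = opr x y /\ code_cmp (union X) x y)).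

Definition code_lt {M : structure} (x y : M) : Prop := exists a, Ord a /\ opr x y ∊ code_rel a.

Section CodeOrder.
Context {M : structure} {HZF : ZF_model M}.
Implicit Types a b c d e i m s t u v w x y z A D G S U W X : M.

Lemma Dfn_code_cmp C (s t u : (nat -> M) -> M) : DTm C s -> DTm C t -> DTm C u ->
  Dfn any_formula C (fun rho => code_cmp (s rho) (t rho) (u rho)).
Proof. apply Dfn_app3. unfold code_cmp. dfn. Qed.

Hint Extern 0 (Dfn _ _ (fun rho => code_cmp _ _ _)) => simple apply Dfn_code_cmp : dfn.

Lemma code_stepE a X z : z ∊ sep (cart (V a) (V a))
    (fun p => exists x y, p = opr x y /\ code_cmp (union X) x y) <->
  exists x, x ∊ V a /\ exists y, y ∊ V a /\ z = opr x y /\ code_cmp (union X) x y.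
Proof.
  rewrite sepE, cartE by dfn. split.
  - intros [(x & Hx & y & Hy & ->) (x' & y' & E & H)]. apply opr_inj in E as [<- <-]. eauto 6.
  - intros (x & Hx & y & Hy & -> & H). eauto 10.
Qed.

Lemma Dfn_code_step C : Dfn any_formula C (fun rho : nat -> M => rho 0 =
  (fun a X => sep (cart (V a) (V a))
    (fun p => exists x y, p = opr x y /\ code_cmp (union X) x y)) (rho 1) (rho 2)).
Proof.
  apply Dfn_eqT; [auto with dfn|].
  apply (DTm_set (fun rho => _) _ (fun rho => code_stepE (rho 1) (rho 2))). dfn.
Qed.

Lemma DTm_code_rel C (s : (nat -> M) -> M) : DTm C s -> DTm C (fun rho => code_rel (s rho)).
Proof. apply DTm_ord_rec, Dfn_code_step. Qed.

Hint Extern 0 (DTm _ (fun rho => code_rel _)) => simple apply DTm_code_rel : dfn.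

Lemma Dfn_code_lt C (s t : (nat -> M) -> M) : DTm C s -> DTm C t ->
  Dfn any_formula C (fun rho => code_lt (s rho) (t rho)).
Proof. apply Dfn_app2. unfold code_lt. dfn. Qed.

Lemma code_relE a x y : Ord a -> opr x y ∊ code_rel a <->
  x ∊ V a /\ y ∊ V a /\ code_cmp (union (rep a code_rel)) x y.
Proof.
  intro Oa. unfold code_rel at 1. rewrite (ord_rec_eq _ (Dfn_code_step (fun _ => True))) by auto.
  fold (code_rel (M := M)). rewrite code_stepE. split.
  - intros (x' & Hx & y' & Hy & E & H). apply opr_inj in E as [<- <-]. auto.
  - intros (Hx & Hy & H). eauto 7.
Qed.

Lemma Ord_bound a b c : Ord a -> Ord b -> Ord c ->
  exists d, Ord d /\ a ∊ d /\ b ∊ d /\ c ∊ d.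
Proof.
  intros Oa Ob Oc. set (A := bun (upair a b) (upair c c)).
  assert (HA : forall z, z ∊ A <-> z = a \/ z = b \/ z = c)
    by (intro z; unfold A; rewrite bunE, !upairE; tauto).
  assert (OU : Ord (union A)) by (apply Ord_union; intros z Hz; apply HA in Hz as [->|[->| ->]]; auto).
  exists (suc (union A)). split; [now apply Ord_suc|].
  assert (L : forall z, Ord z -> z ∊ A -> z ∊ suc (union A)).
  { intros z Oz Hz. apply sucE, Ord_sub; auto. intros w Hw. apply unionE. eauto. }
  split; [|split]; apply L; auto; apply HA; auto.
Qed.

(** [code_cmp] is positive in [R]: a comparison found at one stage stays available at all later
    ones, so the union of the stages satisfies the recursion itself. *)
Lemma code_ltE x y : code_lt x y <->
  rk x ∊ rk y \/ rk x = rk y /\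
    (Ord x /\ ~ Ord y \/
     exists x0 x1 y0 y1, x = opr x0 x1 /\ y = opr y0 y1 /\
       (code_lt x0 y0 \/ x0 = y0 /\ code_lt x1 y1)).
Proof.
  assert (DR : DfnP (fun rho : nat -> M => rho 0 = code_rel (rho 1))) by dfn.
  assert (up1 : forall a p, Ord a -> p ∊ union (rep a code_rel) -> exists b, Ord b /\ p ∊ code_rel b).
  { intros a p Oa H. apply unionE in H as (w & Hw & Hp). apply repE in Hw as (b & Hb & ->); auto.
    eauto using Ord_mem. }
  assert (in1 : forall a b p, b ∊ a -> p ∊ code_rel b -> p ∊ union (rep a code_rel)).
  { intros a b p Hb Hp. apply unionE. exists (code_rel b). split; auto. apply repE; eauto. }
  split.
  - intros (a & Oa & H). apply code_relE in H as (_ & _ & [H|[E [H|H]]]); auto.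
    right. split; auto. right. destruct H as (x0 & x1 & y0 & y1 & Ex & Ey & H).
    exists x0, x1, y0, y1. split; [|split]; auto. destruct H as [H|[E0 H]]; [left|right; split; auto];
      apply up1 in H as (b & Ob & Hb); auto; exists b; auto.
  - intro H.
    assert (G : exists b, Ord b /\ forall a, Ord a -> b ∊ a -> code_cmp (union (rep a code_rel)) x y).
    { destruct H as [H|[E [H|(x0 & x1 & y0 & y1 & Ex & Ey & [(b & Ob & H)|[E0 (b & Ob & H)]])]]].
      - exists emp. split; [apply Ord_emp|]. left. auto.
      - exists emp. split; [apply Ord_emp|]. right. auto.
      - exists b. split; auto. intros a Oa Hb. right. split; auto. right.
        exists x0, x1, y0, y1. eauto 6.
      - exists b. split; auto. intros a Oa Hb. right. split; auto. right.
        exists x0, x1, y0, y1. eauto 7. }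
    destruct G as (b & Ob & G).
    destruct (Ord_bound b (rk x) (rk y)) as (a & Oa & Hb & Hx & Hy); auto using Ord_rk.
    exists a. split; auto. apply code_relE; auto. rewrite !in_V_rk by auto. auto.
Qed.

Hint Extern 0 (Dfn _ _ (fun rho => code_lt _ _)) => simple apply Dfn_code_lt : dfn.

Lemma code_lt_asym x y : code_lt x y -> ~ code_lt y x.
Proof.
  revert y. pattern x. revert x. apply rk_ind; [dfn|].
  intros x IH y H1 H2. apply code_ltE in H1. apply code_ltE in H2.
  destruct H1 as [H1|[E1 H1]], H2 as [H2|[E2 H2]].
  - now destruct (mem_asym _ _ H1).
  - rewrite E2 in H1. now destruct (mem_irrefl _ H1).
  - rewrite E1 in H2. now destruct (mem_irrefl _ H2).
  - destruct H1 as [[O1 N1]|(x0 & x1 & y0 & y1 & -> & -> & H1)],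
      H2 as [[O2 N2]|(x0' & x1' & y0' & y1' & Ex & Ey & H2)]; try tauto.
    + rewrite Ey in O1. now apply not_Ord_opr in O1.
    + now apply not_Ord_opr in O2.
    + apply opr_inj in Ex as [<- <-]. apply opr_inj in Ey as [<- <-].
      destruct H1 as [H1|[-> H1]], H2 as [H2|[E H2]]; subst;
        first [ eapply (IH x0); [apply rk_opr_l|eassumption..]
              | eapply (IH y0); [apply rk_opr_l|eassumption..]
              | eapply (IH x1); [apply rk_opr_r|eassumption..] ].
Qed.

(** Induction on the rank of a member of [X]. At least rank, an ordinal wins if there is one;
    otherwise all candidates are pairs, and the induction hypothesis gives first a least first
    component [u], then a least second component among the pairs starting with [u]. *)
Lemma code_lt_min_set x : forall X, x ∊ X -> (forall y, y ∊ X -> hereditary_pair y) ->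
  exists y, y ∊ X /\ forall z, z ∊ X -> z = y \/ code_lt y z.
Proof.
  pattern x. revert x. apply rk_ind; [dfn|].
  intros x IH X Hx HX.
  destruct (classic (exists y, y ∊ X /\ rk y ∊ rk x)) as [(y & Hy & L)|N]; [eauto|].
  assert (L : forall y, y ∊ X -> rk x ∊ rk y \/ rk y = rk x).
  { intros y Hy. destruct (Ord_tri (rk x) (rk y)) as [H|[H|H]]; auto using Ord_rk. destruct N; eauto. }
  destruct (classic (exists y, y ∊ X /\ rk y = rk x /\ Ord y)) as [(y & Hy & E & Oy)|N'].
  { exists y. split; auto. intros z Hz. rewrite code_ltE, E. destruct (L z Hz) as [H|H]; auto.
    destruct (classic (Ord z)) as [Oz|Nz]; [left|auto 6].
    rewrite (rk_ord y Oy) in E. rewrite (rk_ord z Oz) in H. congruence. }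
  assert (P : forall z, z ∊ X -> rk z = rk x -> exists u v, z = opr u v /\
             rk u ∊ rk x /\ rk v ∊ rk x /\ hereditary_pair u /\ hereditary_pair v).
  { intros z Hz E. destruct (HX z Hz) as (S & HzS & HS).
    destruct (HS z HzS) as [O|(u & Hu & v & Hv & ->)]; [destruct N'; eauto|].
    exists u, v. rewrite <- E. split; auto. split; [apply rk_opr_l|]. split; [apply rk_opr_r|].
    apply hereditary_pair_opr; auto. }
  set (X0 := sep (V (rk x)) (fun u => exists v, opr u v ∊ X /\ rk (opr u v) = rk x)).
  assert (E0 : forall u, u ∊ X0 <-> exists v, opr u v ∊ X /\ rk (opr u v) = rk x).
  { intro u. unfold X0. rewrite sepE by dfn. split; [tauto|]. intro H. split; auto.
    destruct H as (v & _ & <-). apply in_V_rk; [apply Ord_rk|apply rk_opr_l]. }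
  destruct (P x Hx eq_refl) as (x0 & x1 & Ex & L0 & L1 & H0 & H1).
  assert (HX0 : forall u, u ∊ X0 -> hereditary_pair u).
  { intros u Hu. apply E0 in Hu as (v & Hv & _). apply HX in Hv. now apply hereditary_pair_opr in Hv. }
  destruct (IH x0 L0 X0) as (u & Hu & Lu); auto.
  { apply E0. exists x1. rewrite <- Ex. auto. }
  set (X1 := sep (V (rk x)) (fun v => opr u v ∊ X /\ rk (opr u v) = rk x)).
  assert (E1 : forall v, v ∊ X1 <-> opr u v ∊ X /\ rk (opr u v) = rk x).
  { intro v. unfold X1. rewrite sepE by dfn. split; [tauto|]. intro H. split; auto.
    destruct H as (_ & <-). apply in_V_rk; [apply Ord_rk|apply rk_opr_r]. }
  apply E0 in Hu as (v1 & Hv1 & R1).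
  destruct (IH v1) with (X := X1) as (v & Hv & Lv).
  { rewrite <- R1. apply rk_opr_r. }
  { now apply E1. }
  { intros w Hw. apply E1 in Hw as [Hw _]. apply HX in Hw. now apply hereditary_pair_opr in Hw. }
  apply E1 in Hv as [Hv R]. exists (opr u v). split; auto.
  intros z Hz. rewrite code_ltE, R. destruct (L z Hz) as [H|H]; auto.
  destruct (P z Hz H) as (z0 & z1 & -> & _).
  destruct (Lu z0) as [-> |Q]; [apply E0; eauto| |].
  - destruct (Lv z1) as [-> |Q]; [apply E1; auto|auto|]. right. right. split; auto. right.
    exists u, v, u, z1. auto.
  - right. right. split; auto. right. exists u, v, z0, z1. auto.
Qed.

Lemma code_lt_min (P : M -> Prop) x : DfnP (fun rho => P (rho 0)) ->
  (forall x, P x -> hereditary_pair x) -> P x ->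
  exists y, P y /\ forall z, P z -> z = y \/ code_lt y z.
Proof.
  intros D HPP Px. destruct (rk_min P x D Px) as (y & Py & L).
  set (X := sep (V (suc (rk y))) P).
  assert (O : Ord (suc (rk y))) by auto using Ord_suc, Ord_rk.
  assert (EX : forall z, z ∊ X <-> P z /\ rk z = rk y).
  { intro z. unfold X. rewrite sepE by exact D. rewrite in_V_rk, sucE by auto. split.
    - intros [[H|H] Pz]; auto. now destruct (L z).
    - intros [Pz E]. auto. }
  destruct (code_lt_min_set y X) as (z & Hz & Lz).
  - now apply EX.
  - intros z Hz. apply EX in Hz. apply HPP. tauto.
  - apply EX in Hz as [Pz Rz]. exists z. split; auto. intros w Pw.
    destruct (Ord_tri (rk w) (rk y)) as [H|[H|H]]; auto using Ord_rk.
    + now destruct (L w).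
    + apply Lz, EX. auto.
    + right. apply code_ltE. rewrite Rz. auto.
Qed.

End CodeOrder.

#[export] Hint Extern 0 (Dfn _ _ (fun rho => code_lt _ _)) => simple apply Dfn_code_lt : dfn.

(* The value at 0, which is the defined object, is not compared. *)
Definition seq_lt {M : structure} (k s t : M) : Prop :=
  exists i, i ∊ k /\ i <> emp /\ (exists x y, opr i x ∊ s /\ opr i y ∊ t /\ x ∊ y) /\ agree i emp s t.

Definition ord_seq {M : structure} (m s : M) : Prop :=
  Fn s m /\ forall i, i ∊ m -> i <> emp -> forall y, opr i y ∊ s -> Ord y.

Section SequenceOrder.
Context {M : structure} {HZF : ZF_model M}.
Implicit Types a b c d e i j k m s t u v w x y z A D G S U W X : M.

Lemma Dfn_seq_lt C (s t u : (nat -> M) -> M) : DTm C s -> DTm C t -> DTm C u ->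
  Dfn any_formula C (fun rho => seq_lt (s rho) (t rho) (u rho)).
Proof. apply Dfn_app3. unfold seq_lt. dfn. Qed.

Lemma Dfn_ord_seq C (s t : (nat -> M) -> M) : DTm C s -> DTm C t ->
  Dfn any_formula C (fun rho => ord_seq (s rho) (t rho)).
Proof. apply Dfn_app2. unfold ord_seq. dfn. Qed.

Hint Extern 0 (Dfn _ _ (fun rho => seq_lt _ _ _)) => simple apply Dfn_seq_lt : dfn.
Hint Extern 0 (Dfn _ _ (fun rho => ord_seq _ _)) => simple apply Dfn_ord_seq : dfn.

Lemma Fn_dom f d x y : Fn f d -> opr x y ∊ f -> x ∊ d.
Proof. intros [F _] H. apply F in H as (x' & Hx & y' & E). apply opr_inj in E as [-> _]. auto. Qed.

Lemma Fn_val f d x y y' : Fn f d -> opr x y ∊ f -> opr x y' ∊ f -> y = y'.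
Proof.
  intros F H H'. pose proof (Fn_dom _ _ _ _ F H) as Hx. destruct F as [_ F].
  destruct (F x Hx) as (w & _ & U). rewrite (U y H), (U y' H'). auto.
Qed.

Lemma agree_sym m i s t : agree m i s t -> agree m i t s.
Proof. intros H k Hk N y. symmetry. now apply H. Qed.

Lemma agree_trans m i s t u : agree m i s t -> agree m i t u -> agree m i s u.
Proof. intros H H' k Hk N y. rewrite (H k Hk N), (H' k Hk N). tauto. Qed.

Lemma seq_lt_asym m s t : Ord m -> Fn s m -> Fn t m -> seq_lt m s t -> ~ seq_lt m t s.
Proof.
  intros Om Fs Ft (i & Hi & Ni & (x & y & Hx & Hy & L) & A) (j & Hj & Nj & (x' & y' & Hx' & Hy' & L') & A').
  destruct (Ord_tri i j) as [H|[<-|H]]; eauto using Ord_mem.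
  - apply (A' i H Ni) in Hy. rewrite (Fn_val _ _ _ _ _ Fs Hx Hy) in L. now apply mem_irrefl in L.
  - rewrite (Fn_val _ _ _ _ _ Ft Hx' Hy), (Fn_val _ _ _ _ _ Fs Hy' Hx) in L'. now destruct (mem_asym _ _ L).
  - apply (A j H Nj) in Hy'. rewrite (Fn_val _ _ _ _ _ Ft Hx' Hy') in L'. now apply mem_irrefl in L'.
Qed.

(** Lexicographic least elements exist because [m] is a natural number of [M]: going up to [m], one
    coordinate is minimized after another. The induction is internal, since [m] may be
    nonstandard. *)
Lemma seq_lt_min (P : M -> Prop) m s0 : DfnP (fun rho => P (rho 0)) -> Natural m ->
  (forall s, P s -> ord_seq m s) -> P s0 ->
  exists s, P s /\ forall t, P t -> agree m emp s t \/ seq_lt m s t.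
Proof.
  intros D (Om & Zm & Zk) Hval P0.
  assert (G : forall k, Ord k -> k = m \/ k ∊ m ->
    exists s, P s /\ forall t, P t -> agree k emp s t \/ seq_lt k s t).
  { intros k Ok. ord_induction k Ok.
    { dfn; apply (Dfn_app1 P); auto with dfn. }
    intros k Ok IH Hk.
    assert (Z : zero_or_suc k) by (destruct Hk as [->|Hk]; auto).
    destruct Z as [->|[j ->]].
    { exists s0. split; auto. intros t Pt. left. intros i Hi. now apply empE in Hi. }
    assert (Hjs : j ∊ suc j) by (apply sucE; auto).
    assert (Hj : j ∊ m) by (destruct Hk as [<-|Hk]; eauto using Ord_trans).
    assert (Oj : Ord j) by eauto using Ord_mem.
    destruct (IH j Hjs (or_intror Hj)) as (s & Ps & Ls).
    (* Position 0 holds the defined object and is skipped. *)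
    destruct (classic (j = emp)) as [->|Nj].
    - exists s. split; auto. intros t Pt. left. intros i Hi Ni. apply sucE in Hi as [Hi|Hi]; [|tauto].
      now apply empE in Hi.
    - destruct (Hval s Ps) as [Fs Os].
      destruct (proj2 Fs j Hj) as (x & Hx & _).
      (* Among the sequences that agree with the minimal [s] below [j], one with the least entry at
         [j] is minimal up to [suc j]. *)
      destruct (Ord_min (fun x => exists s', P s' /\ agree j emp s s' /\ opr j x ∊ s') x)
        as (x1 & Ox1 & (s1 & P1 & A1 & Hx1) & L1).
      + dfn.
      + eauto.
      + exists s. split; [auto|split; [|auto]]. intros i Hi Ni y. tauto.
      + exists s1. split; auto. intros t Pt. destruct (Hval t Pt) as [Ft Ot].
        destruct (Hval s1 P1) as [F1 _].
        destruct (Ls t Pt) as [A|(i & Hi & Ni & (y & y' & Hy & Hy' & L) & A)].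
        * destruct (proj2 Ft j Hj) as (y & Hy & Uy).
          assert (Oy : Ord y) by eauto.
          destruct (Ord_tri x1 y) as [H|[H|H]]; auto.
          -- right. exists j. split; auto. split; auto. split; [eauto|].
             eauto using agree_trans, agree_sym.
          -- left. intros i Hi Ni w. apply sucE in Hi as [Hi| ->].
             ++ rewrite <- (A1 i Hi Ni w), (A i Hi Ni w). tauto.
             ++ subst y. split; intro Hw.
                ** now rewrite (Fn_val _ _ _ _ _ F1 Hw Hx1).
                ** now rewrite (Fn_val _ _ _ _ _ Ft Hw Hy).
          -- destruct (L1 y H). eauto.
        * right. exists i. assert (Hij : i ∊ suc j) by (apply sucE; auto). split; auto. split; auto.
          split; [exists y, y'; split; [now apply (A1 i Hi Ni)|auto]|].
          intros l Hl Nl w. rewrite <- (A l Hl Nl w). symmetry. apply A1; eauto using Ord_trans. }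
  destruct (G m Om (or_introl eq_refl)) as (s & H). eauto.
Qed.
End SequenceOrder.

#[export] Hint Extern 0 (Dfn _ _ (fun rho => seq_lt _ _ _)) => simple apply Dfn_seq_lt : dfn.
#[export] Hint Extern 0 (Dfn _ _ (fun rho => ord_seq _ _)) => simple apply Dfn_ord_seq : dfn.

(** * The order on defining data and on the sets they define *)

Definition data_lt {M : structure} (θ m c s θ' m' c' s' : M) : Prop :=
  θ ∊ θ' \/ θ = θ' /\ (m ∊ m' \/ m = m' /\ (code_lt c c' \/ c = c' /\ seq_lt m s s')).

(** Amounts to comparing least data without choosing them: the least assignment is determined only
    up to its value at 0. If [b] has no data the second part is vacuous, but asymmetry survives, as
    [od_lt b a] requires data for [b]. *)
Definition od_lt {M : structure} (a b : M) : Prop :=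
  exists θ m c s, OD_data a θ m c s /\
    forall θ' m' c' s', OD_data b θ' m' c' s' -> data_lt θ m c s θ' m' c' s'.

Section DataOrder.
Context {M : structure} {HZF : ZF_model M}.
Implicit Types a b c d e i j k m s t u v w x y z A D G S U W X : M.

Lemma Dfn_OD_data C (a th m c s : (nat -> M) -> M) :
  DTm C a -> DTm C th -> DTm C m -> DTm C c -> DTm C s ->
  Dfn any_formula C (fun rho => OD_data (a rho) (th rho) (m rho) (c rho) (s rho)).
Proof. apply Dfn_app5. unfold OD_data. dfn. Qed.

Hint Extern 0 (Dfn _ _ (fun rho => OD_data _ _ _ _ _)) => simple apply Dfn_OD_data : dfn.

Lemma Dfn_od_lt C (s t : (nat -> M) -> M) : DTm C s -> DTm C t ->
  Dfn any_formula C (fun rho => od_lt (s rho) (t rho)).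
Proof. apply Dfn_app2. unfold od_lt, data_lt. dfn. Qed.

Lemma SatFn_closed G A m : SatFn G A m -> closed_rel G A m.
Proof. intros [_ H]. exact H. Qed.

Lemma clause_FnInto G A m c U s : clause G A m c U -> s ∊ U -> FnInto s m A.
Proof.
  intros H Hs. destruct H as [(i & Hi & j & Hj & E & T)|[(i & Hi & j & Hj & E & T)|[(d & W & HW & E & T)|
      [(d & W & e & X & HW & HX & E & T)|(i & Hi & d & W & HW & E & T)]]]];
    apply T in Hs; tauto.
Qed.

Lemma OD_data_valid a θ m c s : OD_data a θ m c s -> Ord θ /\ Natural m /\ hereditary_pair c /\ ord_seq m s.
Proof.
  intros (Oθ & Nm & G & U & HG & Hc & Hs & Ha & Ho & _).
  split; [auto|]. split; [auto|]. split.
  - eapply hereditary_pair_code; [apply Nm|apply SatFn_closed; exact HG|exact Hc].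
  - split; auto. apply SatFn_closed in HG. apply HG in Hc. now apply (clause_FnInto _ _ _ _ _ _ Hc).
Qed.

(** Equal θ, m and c have the same truth set, so the uniqueness clause for [a] applies to the
    assignment [t]. *)
Lemma OD_data_unique a b θ m c s t :
  OD_data a θ m c s -> OD_data b θ m c t -> agree m emp s t -> a = b.
Proof.
  intros Ha Hb A. destruct (OD_data_valid _ _ _ _ _ Hb) as (_ & _ & _ & [Ft _]).
  destruct Ha as (_ & _ & G & U & HG & Hc & _ & _ & _ & Hu).
  destruct Hb as (_ & _ & G' & U' & HG' & Hc' & Ht & Hbt & _ & _).
  rewrite <- (truth_unique G G' _ _ (SatFn_closed _ _ _ HG) (SatFn_closed _ _ _ HG') c U U' Hc Hc') in Ht.
  apply (Fn_val _ _ _ _ _ Ft (Hu t Ht A) Hbt).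
Qed.

Lemma data_lt_asym a b θ m c s θ' m' c' s' :
  OD_data a θ m c s -> OD_data b θ' m' c' s' ->
  data_lt θ m c s θ' m' c' s' -> ~ data_lt θ' m' c' s' θ m c s.
Proof.
  intros Ha Hb H H'.
  apply OD_data_valid in Ha as (_ & [Om _] & _ & [Fs _]).
  apply OD_data_valid in Hb as (_ & _ & _ & [Fs' _]).
  destruct H as [H|[E H]], H' as [H'|[E' H']]; subst;
    try (now apply mem_irrefl in H); try (now apply mem_irrefl in H'); try (now destruct (mem_asym _ _ H)).
  destruct H as [H|[E H]], H' as [H'|[E1 H']]; subst;
    try (now apply mem_irrefl in H); try (now apply mem_irrefl in H'); try (now destruct (mem_asym _ _ H)).
  destruct H as [H|[E H]], H' as [H'|[E2 H']]; subst.
  - now destruct (code_lt_asym _ _ H).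
  - now destruct (code_lt_asym _ _ H).
  - now destruct (code_lt_asym _ _ H').
  - now destruct (seq_lt_asym _ _ _ Om Fs Fs' H).
Qed.

Lemma data_min (P : M -> M -> M -> M -> Prop) θ0 m0 c0 s0 :
  DfnP (fun rho => P (rho 0) (rho 1) (rho 2) (rho 3)) ->
  (forall θ m c s, P θ m c s -> Ord θ /\ Natural m /\ hereditary_pair c /\ ord_seq m s) ->
  P θ0 m0 c0 s0 ->
  exists θ m c s, P θ m c s /\ forall θ' m' c' s', P θ' m' c' s' ->
    data_lt θ m c s θ' m' c' s' \/ θ = θ' /\ m = m' /\ c = c' /\ agree m emp s s'.
Proof.
  intros D Hval H0.
  destruct (Ord_min (fun θ => exists m c s, P θ m c s) θ0) as (θ & Oθ & (m1 & c1 & s1 & H1) & Lθ).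
  { dfn; apply (Dfn_app4 P); auto with dfn. }
  { apply (Hval _ _ _ _ H0). }
  { eauto. }
  destruct (Ord_min (fun m => exists c s, P θ m c s) m1) as (m & Om & (c2 & s2 & H2) & Lm).
  { dfn; apply (Dfn_app4 P); auto with dfn. }
  { apply (Hval _ _ _ _ H1). }
  { eauto. }
  destruct (code_lt_min (fun c => exists s, P θ m c s) c2) as (c & (s3 & H3) & Lc).
  { dfn; apply (Dfn_app4 P); auto with dfn. }
  { intros c [s H]. apply (Hval _ _ _ _ H). }
  { eauto. }
  destruct (seq_lt_min (fun s => P θ m c s) m s3) as (s & Hs & Ls).
  { apply (Dfn_app4 P); auto with dfn. }
  { apply (Hval _ _ _ _ H3). }
  { intros s H. apply (Hval _ _ _ _ H). }
  { auto. }
  exists θ, m, c, s. split; auto. intros θ' m' c' s' H'.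
  pose proof (Hval _ _ _ _ H') as (Oθ' & [Om' _] & _).
  destruct (Ord_tri θ θ' Oθ Oθ') as [H|[E|H]]; [left; left; exact H| |exfalso; apply (Lθ _ H); eauto].
  subst θ'. destruct (Ord_tri m m' Om Om') as [H|[E|H]];
    [left; right; auto| |exfalso; apply (Lm _ H); eauto].
  subst m'. destruct (Lc c' (ex_intro _ s' H')) as [E|H]; [|left; right; auto 8].
  subst c'. destruct (Ls s' H') as [H|H]; [right; auto|left; right; auto 8].
Qed.

Lemma od_lt_asym a b : od_lt a b -> ~ od_lt b a.
Proof.
  intros (θ & m & c & s & H & L) (θ' & m' & c' & s' & H' & L').
  apply (data_lt_asym _ _ _ _ _ _ _ _ _ _ H H'); auto.
Qed.

(** Least elements of definable classes together with asymmetry carry the whole well-ordering: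
    linearity and transitivity come from least elements of sets with two or three members. *)
Lemma od_lt_min (Q : M -> Prop) x : DfnP (fun rho => Q (rho 0)) ->
  (forall y, Q y -> OD y) -> Q x ->
  exists y, Q y /\ forall z, Q z -> z = y \/ od_lt y z.
Proof.
  intros D HQ Qx. destruct (HQ x Qx) as (θ0 & m0 & c0 & s0 & H0).
  destruct (data_min (fun θ m c s => exists y, Q y /\ OD_data y θ m c s) θ0 m0 c0 s0)
    as (θ & m & c & s & (y & Qy & Hy) & L).
  - dfn; apply (Dfn_app1 Q); auto with dfn.
  - intros θ m c s (y & _ & H). eapply OD_data_valid; eauto.
  - eauto.
  - exists y. split; auto. intros z Qz.
    destruct (classic (z = y)) as [E|N]; [auto|right].
    exists θ, m, c, s. split; auto. intros θ' m' c' s' Hz.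
    destruct (L θ' m' c' s') as [H|(<- & <- & <- & A)]; eauto.
    destruct N. symmetry. eapply OD_data_unique; eauto.
Qed.
End DataOrder.

#[export] Hint Extern 0 (Dfn _ _ (fun rho => od_lt _ _)) => simple apply Dfn_od_lt : dfn.

(** * Reflection *)

Fixpoint sat_in {M : structure} (v : M) (rho : nat -> M) (p : fml) : Prop :=
  match p with
  | Mem x y => rho x ∊ rho y
  | Eq x y => rho x = rho y
  | Not p => ~ sat_in v rho p
  | And p q => sat_in v rho p /\ sat_in v rho q
  | Or p q => sat_in v rho p \/ sat_in v rho q
  | Imp p q => sat_in v rho p -> sat_in v rho q
  | All p => forall a : M, a ∊ v -> sat_in v (scons a rho) p
  | Ex p => exists a : M, a ∊ v /\ sat_in v (scons a rho) p
  end.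

Definition reflects {M : structure} (v : M) (p : fml) : Prop :=
  forall rho : nat -> M, (forall i, rho i ∊ v) -> sat_in v rho p <-> sat rho p.

(** The formulas for which a witness must be found; for a universal quantifier this is a
    counterexample. *)
Fixpoint bodies (p : fml) : list fml :=
  match p with
  | Mem _ _ | Eq _ _ => []
  | Not p => bodies p
  | And p q | Or p q | Imp p q => bodies p ++ bodies q
  | All p => Not p :: bodies p
  | Ex p => p :: bodies p
  end.

Definition has_witness {M : structure} (v : M) (rho : nat -> M) (q : fml) : Prop :=
  (exists y, sat (scons y rho) q) -> exists y, y ∊ v /\ sat (scons y rho) q.

(** The Tarski-Vaught criterion: truth is tested in [M] and only the witness has to lie in [v]. *)
Lemma reflects_of_witnesses {M : structure} (v : M) (p : fml) :
  (forall q, In q (bodies p) -> forall rho, (forall i, rho i ∊ v) -> has_witness v rho q) ->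
  reflects v p.
Proof.
  induction p; intros H rho Hr; cbn in *; try tauto.
  - rewrite (IHp H rho Hr). tauto.
  - rewrite (IHp1 (fun q Hq => H q (in_or_app _ _ _ (or_introl Hq))) rho Hr),
      (IHp2 (fun q Hq => H q (in_or_app _ _ _ (or_intror Hq))) rho Hr). tauto.
  - rewrite (IHp1 (fun q Hq => H q (in_or_app _ _ _ (or_introl Hq))) rho Hr),
      (IHp2 (fun q Hq => H q (in_or_app _ _ _ (or_intror Hq))) rho Hr). tauto.
  - rewrite (IHp1 (fun q Hq => H q (in_or_app _ _ _ (or_introl Hq))) rho Hr),
      (IHp2 (fun q Hq => H q (in_or_app _ _ _ (or_intror Hq))) rho Hr). tauto.
  - assert (E : forall a, a ∊ v -> sat_in v (scons a rho) p <-> sat (scons a rho) p).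
    { intros a Ha. apply IHp; [auto|]. intros [|i]; cbn; auto. }
    split; intro G; [|intros a Ha; now apply E].
    apply NNPP. intro N. destruct (H (Not p) (or_introl eq_refl) rho Hr) as (y & Hy & Ny).
    + cbn. apply not_all_ex_not. exact N.
    + apply Ny, E; auto.
  - assert (E : forall a, a ∊ v -> sat_in v (scons a rho) p <-> sat (scons a rho) p).
    { intros a Ha. apply IHp; [auto|]. intros [|i]; cbn; auto. }
    split; intro G.
    + destruct G as (a & Ha & G). exists a. now apply E.
    + destruct (H p (or_introl eq_refl) rho Hr G) as (a & Ha & G'). exists a. split; auto. now apply E.
Qed.

Section Reflection.
Context {M : structure} {HZF : ZF_model M}.
Implicit Types a b c x y z A : M.

Lemma scons_tl (rho : nat -> M) : scons (rho 0) (tl rho) = rho.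
Proof. apply functional_extensionality. intros [|i]; reflexivity. Qed.

(** A formula has finitely many free variables, so the remaining environment can be frozen into a
    finite list of parameters. *)
Lemma Dfn_fix (P : (nat -> M) -> Prop) rho : DfnP P ->
  DfnP (fun sg => P (scons (sg 0) (scons (sg 1) rho))).
Proof.
  intros (p & l & _ & _ & H). destruct (free_below_exists p) as [n Hn].
  set (T := map (fun a (_ : nat -> M) => a) l ++
            [fun sg => sg 0; fun sg => sg 1] ++ map (fun i (_ : nat -> M) => rho i) (seq 0 n)).
  apply (Dfn_ext (fun sg => sat (tenv T sg) p)).
  - intro sg. rewrite <- H. apply (sat_free_below p n); auto. intros i Hi.
    unfold T. clear T H Hn. revert i Hi.
    assert (G : forall k m i, i < m ->
      tenv (map (fun i (_ : nat -> M) => rho i) (seq k m)) sg i = rho (k + i)).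
    { intros k m. revert k. induction m; intros k i Hi; [lia|].
      destruct i; cbn; [now rewrite Nat.add_0_r|]. rewrite IHm by lia. f_equal; lia. }
    induction l as [|a l IH]; intros i Hi; cbn.
    + destruct i as [|[|i]]; cbn; auto. rewrite G by lia. reflexivity.
    + destruct i as [|i]; cbn; auto. apply IH. lia.
  - apply Dfn_fml; [exact I|]. apply Forall_app. split.
    + apply Forall_map. apply Forall_forall. intros a _. right. eauto.
    + apply Forall_app. split; [tms|]. apply Forall_map. apply Forall_forall. intros i _. right. eauto.
Qed.

(** The length [n] is an external number, so tuples are treated by [n] successive quantifiers. For
    each, replacement collects the least bounds, and monotonicity lets an ordinal above all of them
    serve every element of [A]. *)
Lemma collect A n : forall Q : (nat -> M) -> M -> Prop,
  DfnP (fun rho => Q (tl rho) (rho 0)) ->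
  (forall rho b b', Ord b' -> b ∊ b' -> Q rho b -> Q rho b') ->
  (forall rho, exists b, Ord b /\ Q rho b) ->
  forall rho, exists b, Ord b /\
    forall l, length l = n -> Forall (fun x => x ∊ A) l -> Q (pre l rho) b.
Proof.
  induction n; intros Q D Mono Ex rho.
  - destruct (Ex rho) as (b & Ob & Hb). exists b. split; auto. intros [|x l] L F; [auto|discriminate].
  - destruct (IHn (fun rho b => forall x, x ∊ A -> Q (scons x rho) b)) with (rho := rho)
      as (b & Ob & Hb).
    + apply Dfn_all. apply Dfn_imp; [apply Dfn_mem; tm|].
      refine (Dfn_ext _ _ _ (Dfn_reindex _ (fun i => match i with 0 => 1 | 1 => 0 | S (S i) => S (S i) end) D)).
      intro sg. cbv [tl].
      replace (scons (sg 0) (fun i => sg (S (S i)))) with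
        (fun i => sg match S i with 0 => 1 | 1 => 0 | S (S i) => S (S i) end); [reflexivity|].
      apply functional_extensionality. intros [|i]; reflexivity.
    + eauto.
    + intro sg.
      assert (D2 : DfnP (fun s => Q (scons (s 1) sg) (s 0))) by exact (Dfn_fix _ sg D).
      destruct (replacement (fun x b => Ord b /\ Q (scons x sg) b /\ forall b', b' ∊ b -> ~ Q (scons x sg) b') A)
        as [B HB].
      { assert (D3 : DfnP (fun s => Q (scons (s 0) sg) (s 1)))
          by exact (Dfn_reindex _ (fun i => match i with 0 => 1 | 1 => 0 | S (S i) => S (S i) end) D2).
        apply Dfn_and; [dfn|]. apply Dfn_and; [exact D3|].
        apply Dfn_all. apply Dfn_imp; [dfn|]. apply Dfn_not.
        exact D2. }
      { intros x b b' _ (O & H & L) (O' & H' & L'). destruct (Ord_tri b b' O O') as [G|[G|G]]; auto.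
        - now destruct (L' b).
        - now destruct (L b'). }
      assert (OU : Ord (union B)).
      { apply Ord_union. intros b Hb. apply HB in Hb as (x & _ & O & _). exact O. }
      exists (suc (union B)). split; [now apply Ord_suc|]. intros x Hx.
      destruct (Ex (scons x sg)) as (b0 & Ob0 & Hb0).
      destruct (Ord_min (fun b => Q (scons x sg) b) b0) as (b & Ob & Hb & L); auto.
      { refine (Dfn_subst (fun s => Q (scons (s 1) sg) (s 0)) [fun s => s 0; fun _ => x] D2 _). tms. }
      apply (Mono _ b); auto using Ord_suc. apply sucE, Ord_sub; auto.
      intros z Hz. apply unionE. exists b. split; auto. apply HB. eauto.
    + exists b. split; auto. intros [|x l] L F; [discriminate|]. cbn.
      inversion F; subst. apply Hb; auto.
Qed.

(** A quantifier over lists of fixed external length is a block of [n] bounded quantifiers. *)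
Lemma Dfn_forall_list n : forall (t : (nat -> M) -> M) (Q : (nat -> M) -> Prop),
  Tm (fun _ => True) t -> DfnP Q ->
  DfnP (fun rho => forall l, length l = n -> Forall (fun x => x ∊ t rho) l -> Q (pre l rho)).
Proof.
  induction n; intros t Q Ht D.
  - refine (Dfn_ext _ _ _ D). intro rho. split; [|intro G; exact (G [] eq_refl (Forall_nil _))].
    intros H [|x l] L; [auto|discriminate].
  - apply (Dfn_ext (fun rho => forall x, x ∊ t rho ->
      forall l, length l = n -> Forall (fun x => x ∊ t rho) l -> Q (pre l (scons x rho)))).
    + intro rho. split.
      * intros H l L F. destruct l as [|x l _] using rev_ind; [discriminate|].
        rewrite length_app in L. cbn in L. apply Forall_app in F as [F1 F2]. inversion F2; subst.
        assert (E : pre (l ++ [x]) rho = pre l (scons x rho)) by (clear; induction l; cbn; congruence).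
        rewrite E. apply H; auto. lia.
      * intros H x Hx l L F. assert (E : pre (l ++ [x]) rho = pre l (scons x rho)) by (clear; induction l; cbn; congruence).
        rewrite <- E. apply H; [rewrite length_app; cbn; lia|]. apply Forall_app. auto.
    + apply (Dfn_ball t (fun rho x => forall l, length l = n -> Forall (fun x => x ∊ t rho) l -> Q (pre l (scons x rho)))); auto.
      refine (Dfn_ext _ _ _ (IHn (fun rho => t (tl rho)) Q _ D)).
      * intro rho. rewrite scons_tl. reflexivity.
      * destruct Ht as [[i Hi]|[a [_ Ha]]]; [left; exists (S i)|right; exists a]; auto.
Qed.

Theorem reflection (L : list fml) a : Ord a ->
  exists lam, Ord lam /\ a ∊ lam /\ forall p, In p L -> reflects (V lam) p.
Proof.
  intro Oa. set (bs := flat_map bodies L).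
  (* Variable 0 is the witness, so [N] bounds the remaining variables. *)
  assert (HN : exists N, Forall (free_below (S N)) bs).
  { generalize bs. intro l. induction l as [|q l [N IH]]; [exists 0; auto|].
    destruct (free_below_exists q) as [m Hm]. exists (N + m). constructor.
    - eapply free_below_mono; [|exact Hm]; lia.
    - eapply Forall_impl; [|exact IH]. intros r. apply free_below_mono. lia. }
  destruct HN as [N HN].
  set (W := fun (rho : nat -> M) b => Forall (has_witness (V b) rho) bs).
  assert (DW : DfnP (fun rho => W (tl rho) (rho 0))).
  { unfold W. generalize bs. intro l. induction l as [|q l IH].
    - apply (Dfn_ext (fun rho => rho 0 = rho 0)); [|dfn]. intro rho. split; auto.
    - apply (Dfn_ext (fun rho => has_witness (V (rho 0)) (tl rho) q /\ Forall (has_witness (V (rho 0)) (tl rho)) l)).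
      + intro rho. rewrite Forall_cons_iff. tauto.
      + apply Dfn_and; [|exact IH]. unfold has_witness.
        assert (Dq : DfnP (fun rho : nat -> M => sat (scons (rho 0) (tl (tl rho))) q)).
        { refine (Dfn_ext _ _ _ (Dfn_reindex _ (fun i => match i with 0 => 0 | S i => S (S i) end) (Dfn_sat _ q))).
          intro rho. apply sat_ext. intros [|i]; reflexivity. }
        apply Dfn_imp.
        * apply Dfn_ex. exact Dq.
        * apply Dfn_ex. apply Dfn_and; [dfn|exact Dq]. }
  assert (MW : forall rho b b', Ord b' -> b ∊ b' -> W rho b -> W rho b').
  { intros rho b b' Ob' Hb. apply Forall_impl. intros q H E. destruct (H E) as (y & Hy & G).
    exists y. split; auto. apply (V_mono b' b); auto. }
  assert (EW : forall rho, exists b, Ord b /\ W rho b).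
  { intro rho. unfold W. generalize bs. intro l. induction l as [|q l (b & Ob & Hb)].
    - exists emp. auto using Ord_emp.
    - destruct (classic (exists y, sat (scons y rho) q)) as [[y Hy]|Nq].
      + destruct (Ord_bound b (rk y) emp) as (d & Od & H1 & H2 & _); auto using Ord_rk, Ord_emp.
        exists d. split; auto. constructor.
        * intros _. exists y. split; auto. apply in_V_rk; auto.
        * eapply Forall_impl; [|exact Hb]. intros r H E. destruct (H E) as (z & Hz & G).
          exists z. split; auto. apply (V_mono d b); auto.
      + exists b. split; auto. constructor; auto. intro. tauto. }
  assert (NW : forall rho rho' b, (forall i, i < N -> rho i = rho' i) -> W rho b -> W rho' b).
  { intros rho rho' b E H. unfold W in *. rewrite Forall_forall in *. intros q Hq.
    assert (S : forall y, sat (scons y rho) q <-> sat (scons y rho') q).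
    { intro y. apply (sat_free_below q (S N)); auto. intros [|i] Hi; cbn; [auto|]. apply E. lia. }
    specialize (H q Hq). unfold has_witness in *. setoid_rewrite <- S. exact H. }
  (* The tail [emp] is a filler: by [NW] only the first [N] values count. *)
  set (G := fun A b => Ord b /\ forall l, length l = N -> Forall (fun x => x ∊ V A) l -> W (pre l (fun _ => emp)) b).
  assert (DG : DfnP (fun rho => G (rho 0) (rho 1))).
  { apply Dfn_and; [dfn|].
    apply (Dfn_app2 (fun b v => forall l, length l = N -> Forall (fun x => x ∊ v) l ->
       W (pre l (fun _ => emp)) b) (fun rho => rho 1) (fun rho => V (rho 0))); auto with dfn.
    assert (DQ : DfnP (fun sg => W sg (sg N)))
      by exact (Dfn_reindex _ (fun i => match i with 0 => N | S i => i end) DW).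
    refine (Dfn_ext _ _ _ (Dfn_forall_list N (fun rho => rho 1) _ _ DQ)); [|tm].
    intro rho. split; intros H l Hl F; specialize (H l Hl F);
      (assert (E : pre l rho N = rho 0) by (rewrite <- Hl, <- (Nat.add_0_r (length l)); apply pre_ge));
      rewrite E in *; revert H; apply NW; intros i Hi;
      rewrite !(pre_lt l _ i emp) by lia; reflexivity. }
  set (g := fun A => the (fun b => G A b /\ forall b', b' ∊ b -> ~ G A b')).
  assert (Hg : forall A, G A (g A) /\ forall b', b' ∊ g A -> ~ G A b').
  { intro A. apply (the_spec (fun b => G A b /\ forall b', b' ∊ b -> ~ G A b')).
    destruct (collect (V A) N W DW MW EW (fun _ => emp)) as (b0 & Ob0 & Hb0).
    destruct (Ord_min (G A) b0) as (b & _ & Hb); auto.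
    - apply (Dfn_app2 G (fun _ => A) (fun rho => rho 0)); auto with dfn.
    - split; auto.
    - eauto. }
  assert (Dg : DfnP (fun rho => rho 0 = g (rho 1))).
  { apply (Dfn_ext (fun rho => G (rho 1) (rho 0) /\ forall b', b' ∊ rho 0 -> ~ G (rho 1) b')).
    - intro rho. split; [|intros ->; apply Hg]. intros [H1 H2].
      destruct (Hg (rho 1)) as [H3 H4].
      destruct (Ord_tri (rho 0) (g (rho 1))) as [H|[H|H]]; auto; try apply H1; try apply H3.
      + now destruct (H4 _ H).
      + now destruct (H2 _ H).
    - dfn; apply (Dfn_app2 G); auto with dfn. }
  destruct infinity as (I & I0 & IS).
  (* Starting from [suc a] puts [a] below the limit; each further stage supplies witnesses for all
     parameters from the earlier ones. *)
  destruct (omega_iteration g (suc a) Dg) as (F & DF & EF).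
  assert (OF : forall n, n ∊ I -> Ord (F n)).
  { intros n Hn. destruct (IS n Hn) as [On _].
    assert (T : forall z, z ∊ F n -> exists w, Ord w /\ z ∊ w /\ Sub w (F n)).
    { intros z Hz. apply EF in Hz; auto. destruct Hz as [Hz|(b & Hb & Hz)].
      - exists (suc a). split; [now apply Ord_suc|]. split; auto. intros w Hw. apply EF; auto.
      - exists (g (F b)). split; [apply Hg|]. split; auto. intros w Hw. apply EF; eauto. }
    split.
    - intros y Hy z Hz. destruct (T y Hy) as (w & Ow & Hw & S). apply S. eauto using Ord_trans.
    - intros y Hy z Hz. destruct (T y Hy) as (w & Ow & Hw & _), (T z Hz) as (w' & Ow' & Hw' & _).
      destruct (Ord_tri z y) as [H|[H|H]]; eauto using Ord_mem. }
  assert (MF : forall n n', n' ∊ I -> n ∊ n' -> Sub (F n) (F n')).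
  { intros n n' Hn' H z Hz. destruct (IS n' Hn') as [On' _].
    apply EF in Hz; [|eauto using Ord_mem]. apply EF; auto. destruct Hz as [Hz|(b & Hb & Hz)]; auto.
    right. exists b. eauto using Ord_trans. }
  set (lam := union (rep I F)).
  assert (El : forall z, z ∊ lam <-> exists n, n ∊ I /\ z ∊ F n).
  { intro z. unfold lam. rewrite unionE. split.
    - intros (w & Hw & Hz). apply repE in Hw as (n & Hn & ->); eauto.
    - intros (n & Hn & Hz). exists (F n). split; auto. apply repE; eauto. }
  assert (Ol : Ord lam).
  { apply Ord_union. intros w Hw. apply repE in Hw as (n & Hn & ->); auto. }
  assert (MV : forall n, n ∊ I -> forall w, Ord w -> Sub (F n) w -> Sub (V (F n)) (V w)).
  { intros n Hn w Ow Sw x Hx. apply VE in Hx as (b & Hb & Sb); auto. apply VE; auto. exists b. auto. }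
  exists lam. split; [auto|]. split.
  { apply El. exists emp. split; auto. apply EF; auto using Ord_emp. left. apply sucE. auto. }
  intros p Hp. apply reflects_of_witnesses. intros q Hq rho Hr.
  assert (Hqb : In q bs) by (apply in_flat_map; eauto).
  (* An external environment can be cofinal in [lam], but finitely many of its values always lie in
     a common stage. *)
  assert (B : forall k, exists n, n ∊ I /\ forall i, i < k -> rho i ∊ V (F n)).
  { induction k as [|k (n & Hn & Hk)].
    - exists emp. split; auto. intros; lia.
    - specialize (Hr k). apply VE in Hr as (b & Hb & Sb); auto. apply El in Hb as (n' & Hn' & Hb).
      assert (Hk' : rho k ∊ V (F n')) by (apply VE; eauto).
      destruct (IS n Hn) as [On _], (IS n' Hn') as [On' _].
      destruct (Ord_tri n n' On On') as [H|[H|H]].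
      + exists n'. split; auto. intros i Hi. destruct (Nat.eq_dec i k) as [->|Ni]; auto.
        apply (MV n Hn (F n')); auto. apply Hk. lia.
      + subst n'. exists n. split; auto. intros i Hi. destruct (Nat.eq_dec i k) as [->|Ni]; auto.
        apply Hk. lia.
      + exists n. split; auto. intros i Hi. destruct (Nat.eq_dec i k) as [->|Ni].
        * apply (MV n' Hn' (F n)); auto.
        * apply Hk. lia. }
  destruct (B N) as (n & Hn & Hrn). destruct (IS n Hn) as [On HSn].
  destruct (Hg (F n)) as [[Og Wg] _].
  assert (HW : W rho (g (F n))).
  { apply (NW (pre (map rho (seq 0 N)) (fun _ => emp))).
    - intros i Hi. rewrite (pre_lt _ _ i (rho 0)) by (rewrite length_map, length_seq; lia).
      rewrite map_nth, seq_nth by lia. reflexivity.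
    - apply Wg; [now rewrite length_map, length_seq|].
      apply Forall_map, Forall_forall. intros i Hi. apply in_seq in Hi. apply Hrn. lia. }
  intro E. unfold W in HW. rewrite Forall_forall in HW. destruct (HW q Hqb E) as (y & Hy & Sy).
  exists y. split; auto. apply VE in Hy as (b & Hb & Sb); auto. apply VE; auto. exists b. split; auto.
  apply El. exists (suc n). split; auto. apply EF; [now apply Ord_suc|]. right. exists n.
  split; auto. apply sucE. auto.
Qed.
End Reflection.

(** * Coding of formulas *)

(** The number of variable names needed for bound variables. *)
Fixpoint depth (p : fml) : nat :=
  match p with
  | Mem _ _ | Eq _ _ => 0
  | Not p => depth p
  | And p q | Or p q | Imp p q => Nat.max (depth p) (depth q)
  | All p | Ex p => S (depth p)
  end.

Definition ap {M : structure} (f x : M) : M := the (fun y => opr x y ∊ f).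

(** Codes use named variables, formulas de Bruijn indices. A map [nm] sends index i to the name of
    its variable, and a quantifier entered with k names in use binds the k-th one. *)
Definition ncons (k : nat) (nm : nat -> nat) (i : nat) : nat :=
  match i with 0 => k | S i => nm i end.

Section Coding.
Context {M : structure} {HZF : ZF_model M}.
Implicit Types a b c d f m s t x y z A G U W : M.

Lemma apE f d A x y : FnInto f d A -> opr x y ∊ f <-> x ∊ d /\ y = ap f x.
Proof.
  intros [F _]. assert (H : x ∊ d -> opr x (ap f x) ∊ f).
  { intro Hx. apply (the_spec (fun y => opr x y ∊ f)). destruct (proj2 F x Hx) as (w & Hw & _). eauto. }
  split.
  - intro Hy. assert (Hx : x ∊ d) by (eapply Fn_dom; eauto). split; auto.
    eapply Fn_val; eauto.
  - intros [Hx ->]. auto.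
Qed.

Lemma ap_in f d A x : FnInto f d A -> x ∊ d -> ap f x ∊ A.
Proof. intros F Hx. apply (proj2 F x). apply (apE f d A); auto. Qed.

Lemma FnInto_sub f d A : FnInto f d A -> Sub f (cart d A).
Proof.
  intros F z Hz. pose proof (proj1 (proj1 F) z Hz) as (x & Hx & y & ->).
  apply cartE. exists x. split; auto. exists y. split; auto. exact (proj2 F x y Hz).
Qed.

Lemma truth_set_exists m A (P : M -> Prop) : DfnP (fun rho => P (rho 0)) ->
  exists U, truth_set U m A P.
Proof.
  intro D. exists (sep (power (cart m A)) (fun s => FnInto s m A /\ P s)). intro s.
  rewrite sepE by (dfn; exact D). rewrite powerE. split; [tauto|].
  intros [F Ps]. auto using FnInto_sub.
Qed.

Lemma update_exists s m A i a : FnInto s m A -> i ∊ m -> a ∊ A ->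
  exists t, FnInto t m A /\ agree m i s t /\ opr i a ∊ t.
Proof.
  intros F Hi Ha.
  set (t := sep (cart m A) (fun z => exists x y, z = opr x y /\ (x <> i /\ z ∊ s \/ x = i /\ y = a))).
  assert (E : forall x y, opr x y ∊ t <-> x <> i /\ opr x y ∊ s \/ x = i /\ y = a).
  { intros x y. unfold t. rewrite sepE by dfn. split.
    - intros [_ (x' & y' & E & H)]. apply opr_inj in E as [<- <-]. auto.
    - intro H. split; [|eauto 6]. apply cartE. destruct H as [[_ H]|[-> ->]]; [|eauto 6].
      apply FnInto_sub in F. apply F, cartE in H. exact H. }
  exists t. split; [split; [split|]|split].
  - intros z Hz. unfold t in Hz. apply sepE in Hz as [Hz _]; [|dfn].
    apply cartE in Hz as (x & Hx & y & _ & ->). eauto.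
  - intros x Hx. destruct (classic (x = i)) as [->|N].
    + exists a. split; [apply E; auto|]. intros y Hy. apply E in Hy. tauto.
    + exists (ap s x). split.
      * apply E. left. split; auto. apply (apE s m A); auto.
      * intros y Hy. apply E in Hy as [[_ Hy]|[]]; [|tauto]. apply (apE s m A) in Hy; tauto.
  - intros x y Hy. apply E in Hy as [[_ Hy]|[_ ->]]; auto. apply (proj2 F x y Hy).
  - intros k Hk Nk y. rewrite E. tauto.
  - apply E. auto.
Qed.

(** An external sequence of standard length is a set of [M], by external induction on the length. *)
Lemma finite_seq_exists (v : nat -> M) A K : (forall j, j < K -> v j ∊ A) ->
  exists s, FnInto s (num K) A /\ forall i y, opr i y ∊ s -> exists j, j < K /\ i = num j /\ y = v j.
Proof.
  intro Hv.
  assert (E : exists s, forall z, z ∊ s <-> exists j, j < K /\ z = opr (num j) (v j)).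
  { clear Hv. induction K as [|K [s Hs]].
    - exists emp. intro z. split; [intro H; now apply empE in H|intros (j & Hj & _); lia].
    - exists (bun s (upair (opr (num K) (v K)) (opr (num K) (v K)))). intro z.
      rewrite bunE, upairE, Hs. split.
      + intros [(j & Hj & ->)|H]; [exists j; auto with arith|exists K; intuition].
      + intros (j & Hj & ->). destruct (Nat.eq_dec j K) as [->|N]; auto. left. exists j. split; auto. lia. }
  destruct E as [s Hs]. exists s.
  assert (E : forall i y, opr i y ∊ s -> exists j, j < K /\ i = num j /\ y = v j).
  { intros i y H. apply Hs in H as (j & Hj & E). apply opr_inj in E as [-> ->]. eauto. }
  split; auto. split; [split|].
  - intros z Hz. apply Hs in Hz as (j & Hj & ->). exists (num j). rewrite num_mem. eauto.
  - intros x Hx. apply num_mem in Hx as (j & Hj & ->). exists (v j). split; [apply Hs; eauto|].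
    intros y Hy. apply E in Hy as (j' & Hj' & Ej & ->). apply num_inj in Ej. now subst.
  - intros i y H. apply E in H as (j & Hj & _ & ->). auto.
Qed.

Lemma Natural_num K : Natural (num K : M).
Proof.
  assert (Z : forall k, zero_or_suc (num k : M)).
  { intros [|k]; [left|right; exists (num k)]; reflexivity. }
  split; [apply Ord_num|]. split; auto. intros y Hy. apply num_mem in Hy as (j & _ & ->). auto.
Qed.

Lemma clause_mono G G' A m c U : Sub G G' -> clause G A m c U -> clause G' A m c U.
Proof.
  intros S H. destruct H as [(i & Hi & j & Hj & E & T)|[(i & Hi & j & Hj & E & T)|[(d & W & HW & E & T)|
      [(d & W & e & X & HW & HX & E & T)|(i & Hi & d & W & HW & E & T)]]]].
  - left. eauto 8.
  - right. left. eauto 8.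
  - right. right. left. exists d, W. auto.
  - right. right. right. left. exists d, W, e, X. auto.
  - right. right. right. right. exists i. split; auto. exists d, W. auto.
Qed.

Definition pair_set G : Prop := forall z, z ∊ G -> exists c U, z = opr c U.

Lemma closed_rel_bun G G' A m :
  closed_rel G A m -> closed_rel G' A m -> closed_rel (bun G G') A m.
Proof.
  intros H H' c U Hc. apply bunE in Hc as [Hc|Hc]; [apply H in Hc|apply H' in Hc];
    (eapply clause_mono; [|exact Hc]); intros z Hz; apply bunE; auto.
Qed.

Lemma closed_rel_add G A m c U : closed_rel G A m -> clause G A m c U ->
  closed_rel (bun G (upair (opr c U) (opr c U))) A m.
Proof.
  intros H Hc c' U' Hc'. apply (clause_mono G).
  - intros z Hz. apply bunE. auto.
  - apply bunE in Hc' as [Hc'|Hc']; auto. apply upairE in Hc'.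
    assert (E : opr c' U' = opr c U) by tauto. apply opr_inj in E as [-> ->]. auto.
Qed.

Lemma SatFn_closed_rel G A m : closed_rel G A m -> pair_set G -> SatFn G A m.
Proof.
  intros HG PG. split; [|exact HG].
  exists (sep (union (union G)) (fun c => exists U, opr c U ∊ G)).
  assert (E : forall c, c ∊ sep (union (union G)) (fun c => exists U, opr c U ∊ G) <-> exists U, opr c U ∊ G).
  { intro c. rewrite sepE by dfn. split; [tauto|]. intros [U H]. split; [|eauto].
    apply unionE. exists (upair c c). split; [|apply upairE; auto].
    apply unionE. exists (opr c U). split; auto. apply upairE. auto. }
  split.
  - intros z Hz. destruct (PG z Hz) as (c & U & ->). exists c. rewrite E. eauto.
  - intros c Hc. apply E in Hc as [U HU]. exists U. split; auto. intros U' HU'.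
    exact (truth_unique G G A m HG HG c U' U HU' HU).
Qed.

Section Fixed.
Variables (A : M) (K : nat).
Notation m := (num K : M).

Definition val s (nm : nat -> nat) (i : nat) : M := ap s (num (nm i)).

(** A closed relation instead of a satisfaction function, so that the relations for two subformulas
    can be united; [pair_set] is kept because [SatFn_closed_rel] requires it. *)
Definition coded (p : fml) (nm : nat -> nat) : Prop :=
  exists G c U, closed_rel G A m /\ pair_set G /\ opr c U ∊ G /\
    truth_set U m A (fun s => sat_in A (val s nm) p).

Lemma coded_ext p q nm : (forall rho, sat_in A rho p <-> sat_in A rho q) -> coded p nm -> coded q nm.
Proof.
  intros E (G & c & U & HG & PG & Hc & T). exists G, c, U. split; [|split; [|split]]; auto.
  intro s. rewrite (T s). rewrite (E (val s nm)). tauto.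
Qed.

Lemma coded_clause G c P p nm : closed_rel G A m -> pair_set G -> DfnP (fun rho => P (rho 0)) ->
  (forall U, truth_set U m A P -> clause G A m c U) ->
  (forall s, FnInto s m A -> P s <-> sat_in A (val s nm) p) -> coded p nm.
Proof.
  intros HG PG D HC Hsat. destruct (truth_set_exists m A P D) as [U HU].
  exists (bun G (upair (opr c U) (opr c U))), c, U.
  split; [apply closed_rel_add; auto|]. split; [|split].
  - intros z Hz. apply bunE in Hz as [Hz|Hz]; auto. apply upairE in Hz.
    exists c, U. tauto.
  - apply bunE. right. apply upairE. auto.
  - intro s. rewrite (HU s). split; intros [F H]; split; auto; apply (Hsat s F); auto.
Qed.

Lemma coded_not p nm : coded p nm -> coded (Not p) nm.
Proof.
  intros (G & d & W & HG & PG & Hd & T).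
  apply (coded_clause G (opr (num 2) d) (fun s => ~ s ∊ W)); auto; [dfn| |].
  - intros U HU. right. right. left. exists d, W. auto.
  - intros s F. rewrite (T s). cbn. tauto.
Qed.

Lemma coded_and p q nm : coded p nm -> coded q nm -> coded (And p q) nm.
Proof.
  intros (G & d & W & HG & PG & Hd & T) (G' & d' & W' & HG' & PG' & Hd' & T').
  apply (coded_clause (bun G G') (opr (num 3) (opr d d')) (fun s => s ∊ W /\ s ∊ W')); auto using closed_rel_bun.
  - intros z Hz. apply bunE in Hz as [Hz|Hz]; auto.
  - dfn.
  - intros U HU. right. right. right. left. exists d, W, d', W'. rewrite !bunE. auto.
  - intros s F. rewrite (T s), (T' s). cbn. tauto.
Qed.

(** The name [k] is not in use for the other variables, so changing an assignment at [k] leaves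
    their values alone. *)
Lemma coded_ex p nm k : (forall i : nat, nm i < k) -> k < K -> coded p (ncons k nm) -> coded (Ex p) nm.
Proof.
  intros Hnm Hk (G & d & W & HG & PG & Hd & T).
  assert (Hkm : num k ∊ m) by (apply num_mem; eauto).
  assert (Hnmm : forall i : nat, num (nm i) ∊ m)
    by (intro i; apply num_mem; exists (nm i); split; auto; specialize (Hnm i); lia).
  assert (Hneq : forall i : nat, num (nm i) <> num k :> M)
    by (intros i E; apply num_inj in E; specialize (Hnm i); lia).
  assert (Ev : forall s t, FnInto s m A -> FnInto t m A -> agree m (num k) s t ->
    val t (ncons k nm) = scons (ap t (num k)) (val s nm)).
  { intros s t Fs Ft Ag. apply functional_extensionality. intros [|i]; [reflexivity|]. cbn. unfold val. cbn.
    assert (H : opr (num (nm i)) (ap t (num (nm i))) ∊ t) by (apply (apE t m A); auto).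
    apply (Ag (num (nm i))) in H; auto. apply (apE s m A) in H; tauto. }
  apply (coded_clause G (opr (num 4) (opr (num k) d)) (fun s => exists t, t ∊ W /\ agree m (num k) s t)); auto.
  - dfn.
  - intros U HU. right. right. right. right. exists (num k). split; auto. exists d, W. auto.
  - intros s Fs. split.
    + intros (t & Ht & Ag). apply T in Ht as [Ft Ht]. exists (ap t (num k)).
      split; [apply (ap_in t m A); auto|]. rewrite <- (Ev s t); auto.
    + intros (a & Ha & H). destruct (update_exists s m A (num k) a) as (t & Ft & Ag & Hat); auto.
      exists t. split; auto. apply T. split; auto. rewrite (Ev s t); auto.
      apply (apE t m A) in Hat as [_ <-]; auto.
Qed.

Lemma coded_formula p : forall nm k, (forall i : nat, nm i < k) -> k + depth p <= K -> coded p nm.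
Proof.
  assert (at_ : forall nm k, (forall i : nat, nm i < k) -> k + 0 <= K -> forall i : nat, num (nm i) ∊ m).
  { intros nm k Hnm Hk i. apply num_mem. exists (nm i). split; auto. specialize (Hnm i). lia. }
  assert (E0 : closed_rel emp A m) by (intros c U H; now apply empE in H).
  assert (P0 : pair_set emp) by (intros z H; now apply empE in H).
  assert (Ea : forall s x y, FnInto s m A -> x ∊ m -> y ∊ m -> forall R : M -> M -> Prop,
    (exists u v, opr x u ∊ s /\ opr y v ∊ s /\ R u v) <-> R (ap s x) (ap s y)).
  { intros s x y F Hx Hy R. split.
    - intros (u & v & Hu & Hv & H). apply (apE s m A) in Hu as [_ ->]; auto.
      apply (apE s m A) in Hv as [_ ->]; auto.
    - intro H. exists (ap s x), (ap s y). rewrite !(apE s m A) by auto. auto. }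
  induction p; cbn [depth]; intros nm k Hnm Hk.
  - pose proof (at_ nm k Hnm Hk x) as Hx. pose proof (at_ nm k Hnm Hk y) as Hy.
    apply (coded_clause emp (opr (num 0) (opr (num (nm x)) (num (nm y))))
       (fun s => exists u v, opr (num (nm x)) u ∊ s /\ opr (num (nm y)) v ∊ s /\ u ∊ v)); [exact E0|exact P0| | |].
    + dfn.
    + intros U HU. left. eauto 8.
    + intros s F. apply (Ea s (num (nm x)) (num (nm y)) F Hx Hy (fun u v => u ∊ v)).
  - pose proof (at_ nm k Hnm Hk x) as Hx. pose proof (at_ nm k Hnm Hk y) as Hy.
    apply (coded_clause emp (opr (num 1) (opr (num (nm x)) (num (nm y))))
       (fun s => exists u v, opr (num (nm x)) u ∊ s /\ opr (num (nm y)) v ∊ s /\ u = v)); [exact E0|exact P0| | |].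
    + dfn.
    + intros U HU. right. left. eauto 8.
    + intros s F. apply (Ea s (num (nm x)) (num (nm y)) F Hx Hy (fun u v => u = v)).
  - apply coded_not. eauto.
  - apply coded_and; [apply (IHp1 nm k)|apply (IHp2 nm k)]; auto; lia.
  (* Codes know negation, conjunction and existence only; the other connectives are replaced by
     classical equivalents. *)
  - apply (coded_ext (Not (And (Not p1) (Not p2)))); [intro rho; cbn; tauto|].
    apply coded_not, coded_and; apply coded_not; [apply (IHp1 nm k)|apply (IHp2 nm k)]; auto; lia.
  - apply (coded_ext (Not (And p1 (Not p2)))); [intro rho; cbn; tauto|].
    apply coded_not, coded_and; [|apply coded_not]; [apply (IHp1 nm k)|apply (IHp2 nm k)]; auto; lia.
  - apply (coded_ext (Not (Ex (Not p)))).
    { intro rho. cbn. split.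
      - intros H a Ha. apply NNPP. intro N. eauto.
      - intros H (a & Ha & N). auto. }
    apply coded_not, (coded_ex _ _ k); [auto|lia|]. apply coded_not. apply (IHp _ (S k)); [|lia].
    intros [|i]; cbn; [lia|]. specialize (Hnm i). lia.
  - apply (coded_ex _ _ k); [auto|lia|]. apply (IHp _ (S k)); [|lia].
    intros [|i]; cbn; [lia|]. specialize (Hnm i). lia.
Qed.
End Fixed.

Theorem OD_of_Dfn a : Dfn any_formula Ord (fun rho => rho 0 = a) -> OD a.
Proof.
  intros (p & l & _ & Ol & H).
  assert (B : exists b, Ord b /\ Forall (fun x => x ∊ V b) (a :: l)).
  { generalize (a :: l). intro L. induction L as [|x L (b & Ob & Hb)].
    - exists emp. auto using Ord_emp.
    - destruct (Ord_bound b (rk x) emp) as (d & Od & H1 & H2 & _); auto using Ord_rk, Ord_emp.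
      exists d. split; auto. constructor; [now apply in_V_rk|].
      eapply Forall_impl; [|exact Hb]. intros y. apply (V_mono d b); auto. }
  destruct B as (b & Ob & Hb).
  destruct (reflection [p] b Ob) as (lam & Olam & Hblam & R).
  assert (Hin : Forall (fun x => x ∊ V lam) (a :: l))
    by (eapply Forall_impl; [|exact Hb]; intros y; apply (V_mono lam b); auto).
  inversion Hin as [|x l' Ha Hl]; subst x l'. rewrite Forall_forall in Hl.
  assert (Hemp : emp ∊ V lam) by (apply VE; auto; exists b; split; auto; intros z Hz; now apply empE in Hz).
  (* Name 0 is the one that [OD_data] gives to the defined object, and the parameters take the names
     from 1 on. All other variables also go to 0, matching the constant environment at which the
     definition is read. *)
  set (nm := fun i => if i <? length l then S i else 0).
  set (K := S (length l) + depth p).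
  assert (Hnm : forall i : nat, nm i < S (length l)).
  { intro i. unfold nm. destruct (Nat.ltb_spec i (length l)); lia. }
  destruct (coded_formula (V lam) K p nm _ Hnm) as (G & c & U & HG & PG & Hc & T); [unfold K; lia|].
  (* The positions reserved for bound variables receive [emp], which lies in [V lam] and is an
     ordinal, as is demanded of every entry except the one at 0. *)
  set (v := fun j => match j with 0 => a | S j => nth j l emp end).
  destruct (finite_seq_exists v (V lam) K) as (s & Fs & Hs).
  { intros [|j] _; cbn; auto. destruct (nth_in_or_default j l emp) as [I| ->]; auto. }
  assert (Hsv : forall j, j < K -> opr (num j) (v j) ∊ s).
  { intros j Hj. destruct (proj2 (proj1 Fs) (num j)) as (y & Hy & _); [apply num_mem; eauto|].
    destruct (Hs _ _ Hy) as (j' & _ & E & ->). apply num_inj in E. now subst. }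
  assert (Hm : forall j, j < K -> num j ∊ (num K : M)) by (intros; apply num_mem; eauto).
  assert (Ev : forall t x, FnInto t (num K) (V lam) -> (forall j, S j < K -> opr (num (S j)) (v (S j)) ∊ t) ->
    opr (num 0) x ∊ t -> val t nm = pre l (fun _ => x)).
  { intros t x Ft Ht Hx. apply functional_extensionality. intro i. unfold val, nm.
    destruct (Nat.ltb_spec i (length l)) as [L|L].
    - rewrite (pre_lt l _ i emp) by auto. symmetry. apply (apE t (num K) (V lam)); auto.
      apply (Ht i). unfold K. lia.
    - replace i with (length l + (i - length l)) by lia. rewrite pre_ge. symmetry.
      apply (apE t (num K) (V lam)); auto. }
  assert (Rp : forall x, x ∊ V lam -> sat_in (V lam) (pre l (fun _ => x)) p <-> x = a).
  { intros x Hx. etransitivity; [apply (R p (or_introl eq_refl))|apply (H (fun _ => x))].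
    - intro i. destruct (Nat.lt_ge_cases i (length l)) as [L|L].
      + rewrite (pre_lt l _ i emp) by auto. apply Hl, nth_In, L.
      + replace i with (length l + (i - length l)) by lia. rewrite pre_ge. auto. }
  assert (HK0 : 0 < K) by (unfold K; lia).
  exists lam, (num K), c, s. split; [auto|]. split; [apply Natural_num|].
  exists G, U. split; [now apply SatFn_closed_rel|]. split; auto. split; [|split; [|split]].
  - apply T. split; auto. rewrite (Ev s a); [now apply Rp|auto|auto|apply (Hsv 0 HK0)].
  - apply (Hsv 0 HK0).
  - intros i Hi Ni y Hy. destruct (Hs i y Hy) as ([|j] & Hj & -> & ->); [now destruct Ni|]. cbn.
    rewrite Forall_forall in Ol. destruct (nth_in_or_default j l emp) as [I| ->]; auto using Ord_emp.
  - intros t Ht Ag. apply T in Ht as [Ft Ht].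
    assert (H0 : opr (num 0) (ap t (num 0)) ∊ t) by (apply (apE t (num K) (V lam)); auto).
    rewrite (Ev t (ap t (num 0))) in Ht; auto.
    + apply Rp in Ht; [now rewrite Ht in H0|]. apply (ap_in t (num K) (V lam)); auto.
    + intros j Hj. apply Ag; auto. intro E. apply (num_inj (S j) 0) in E. discriminate.
Qed.
End Coding.

(** * Sigma_1 and Pi_2 predicates *)

(** Satisfaction in a set becomes a Delta_0 formula in which that set is a variable; so conditions
    about OD^v can occur in bounded formulas. *)
Fixpoint relativize (v : nat) (p : fml) : fml :=
  match p with
  | Mem x y => Mem x y
  | Eq x y => Eq x y
  | Not p => Not (relativize v p)
  | And p q => And (relativize v p) (relativize v q)
  | Or p q => Or (relativize v p) (relativize v q)
  | Imp p q => Imp (relativize v p) (relativize v q)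
  | All p => BAll v (relativize (S v) p)
  | Ex p => BEx v (relativize (S v) p)
  end.

Lemma Delta0_relativize p : forall v, Delta0 (relativize v p).
Proof. induction p; intro v; cbn; constructor; auto. Qed.

Lemma sat_relativize {M : structure} p : forall v (rho : nat -> M), sat rho (relativize v p) <-> sat_in (rho v) rho p.
Proof.
  induction p; intros v rho; cbn; try tauto; try (rewrite IHp; tauto); try (rewrite IHp1, IHp2; tauto).
  - split; intros H a Ha; apply (IHp (S v) (scons a rho)); auto.
  - split; intros (a & Ha & H); exists a; split; auto; apply (IHp (S v) (scons a rho)); auto.
Qed.

Lemma sat_in_rename {M : structure} (v : M) p : forall f (rho : nat -> M),
  sat_in v rho (rename f p) <-> sat_in v (fun i => rho (f i)) p.
Proof.
  induction p; intros f rho; cbn; try tauto; try (rewrite IHp; tauto); try (rewrite IHp1, IHp2; tauto).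
  - assert (E : forall a, sat_in v (scons a rho) (rename (up f) p) <-> sat_in v (scons a (fun i => rho (f i))) p).
    { intro a. rewrite IHp. replace (fun i => scons a rho (up f i)) with (scons a (fun i => rho (f i))); [tauto|].
      apply functional_extensionality. intros [|i]; reflexivity. }
    split; intros H a Ha; apply E; auto.
  - assert (E : forall a, sat_in v (scons a rho) (rename (up f) p) <-> sat_in v (scons a (fun i => rho (f i))) p).
    { intro a. rewrite IHp. replace (fun i => scons a rho (up f i)) with (scons a (fun i => rho (f i))); [tauto|].
      apply functional_extensionality. intros [|i]; reflexivity. }
    split; intros (a & Ha & H); exists a; split; auto; apply E; auto.
Qed.

Scheme Sigma_mut := Induction for Sigma Sort Prop with Pi_mut := Induction for Pi Sort Prop.

Lemma Pi_rename n p : Pi n p -> forall f, Pi n (rename f p).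
Proof.
  apply (Pi_mut (fun n p _ => forall f, Sigma n (rename f p)) (fun n p _ => forall f, Pi n (rename f p)));
    intros; cbn; constructor; auto; apply (K_rename (K := Delta0)); auto.
Qed.

Section Sigma1.
Context {M : structure}.
Notation D0 := (Dfn Delta0 (fun _ : M => False)).

(** [Sigma] admits prenex formulas only. Quantifiers are therefore pulled out at the level of
    predicates, where no indices have to be shifted. *)
Inductive Sigma1_pred : ((nat -> M) -> Prop) -> Prop :=
| Sigma1_pred_D0 P : D0 P -> Sigma1_pred P
| Sigma1_pred_ex (Q : (nat -> M) -> M -> Prop) :
    Sigma1_pred (fun rho => Q (tl rho) (rho 0)) -> Sigma1_pred (fun rho => exists x, Q rho x)
| Sigma1_pred_ext P Q : (forall rho, P rho <-> Q rho) -> Sigma1_pred P -> Sigma1_pred Q.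

Lemma D0_formula P : D0 P -> exists p, Delta0 p /\ forall rho, sat rho p <-> P rho.
Proof. intros (p & [|a l] & Dp & F & H); [eauto|]. inversion F; contradiction. Qed.

Lemma Sigma1_pred_formula P : Sigma1_pred P -> exists p, Sigma 1 p /\ forall rho, sat rho p <-> P rho.
Proof.
  induction 1 as [P D|Q _ (p & Sp & H)|P Q E _ (p & Sp & H)].
  - apply D0_formula in D as (p & Dp & H). exists p. split; auto. now constructor; constructor.
  - exists (Ex p). split; [now apply Sigma_Ex|]. intro rho. cbn.
    split; intros [x Hx]; exists x; apply (H (scons x rho)); auto.
  - exists p. split; auto. intro rho. rewrite H. apply E.
Qed.

Lemma Sigma1_pred_reindex P : Sigma1_pred P -> forall g : nat -> nat, Sigma1_pred (fun rho => P (fun i => rho (g i))).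
Proof.
  induction 1 as [P D|Q _ IH|P Q E _ IH]; intro g.
  - apply Sigma1_pred_D0. exact (Dfn_reindex _ g D).
  - apply (Sigma1_pred_ex (fun rho x => Q (fun i => rho (g i)) x)). exact (IH (up g)).
  - apply (Sigma1_pred_ext (fun rho => P (fun i => rho (g i)))); auto.
Qed.

Lemma Sigma1_pred_tl P : Sigma1_pred P -> Sigma1_pred (fun rho => P (tl rho)).
Proof. intro H. exact (Sigma1_pred_reindex P H S). Qed.

Lemma Sigma1_pred_and_D0 Q : Sigma1_pred Q -> forall P, D0 P -> Sigma1_pred (fun rho => P rho /\ Q rho).
Proof.
  induction 1 as [Q D|Q _ IH|Q Q' E _ IH]; intros P DP.
  - apply Sigma1_pred_D0. now apply Dfn_and.
  - apply (Sigma1_pred_ext (fun rho => exists x, P rho /\ Q rho x)); [firstorder|].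
    apply Sigma1_pred_ex. apply IH. exact (Dfn_reindex _ S DP).
  - apply (Sigma1_pred_ext (fun rho => P rho /\ Q rho)); auto. intro rho. rewrite E. tauto.
Qed.

Lemma Sigma1_pred_imp_D0 Q : Sigma1_pred Q -> forall P, D0 P -> Sigma1_pred (fun rho => P rho -> Q rho).
Proof.
  induction 1 as [Q D|Q _ IH|Q Q' E _ IH]; intros P DP.
  - apply Sigma1_pred_D0. now apply Dfn_imp.
  - apply (Sigma1_pred_ext (fun rho => exists x, P rho -> Q rho x)).
    + intro rho. split; [firstorder|]. intro H. destruct (classic (P rho)) as [p|n].
      * destruct (H p) as [x Hx]. eauto.
      (* When the premise fails, any element serves as the witness that has been pulled out of the
         conclusion. *)
      * destruct (carrier_inhabited M) as [x]. exists x. tauto.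
    + apply Sigma1_pred_ex. apply IH. exact (Dfn_reindex _ S DP).
  - apply (Sigma1_pred_ext (fun rho => P rho -> Q rho)); auto. intro rho. rewrite E. tauto.
Qed.

Lemma Sigma1_pred_and P : Sigma1_pred P -> forall Q, Sigma1_pred Q -> Sigma1_pred (fun rho => P rho /\ Q rho).
Proof.
  induction 1 as [P D|P _ IH|P P' E _ IH]; intros Q HQ.
  - now apply Sigma1_pred_and_D0.
  - apply (Sigma1_pred_ext (fun rho => exists x, P rho x /\ Q rho)); [firstorder|].
    apply Sigma1_pred_ex. apply (IH (fun rho => Q (tl rho))). now apply Sigma1_pred_tl.
  - apply (Sigma1_pred_ext (fun rho => P rho /\ Q rho)); auto. intro rho. rewrite E. tauto.
Qed.

Definition Pi2_pred (P : (nat -> M) -> Prop) : Prop := exists p, Pi 2 p /\ forall rho, sat rho p <-> P rho.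

Lemma Pi2_pred_Sigma1 P : Sigma1_pred P -> Pi2_pred P.
Proof. intro H. apply Sigma1_pred_formula in H as (p & Sp & H). exists p. split; auto. now constructor. Qed.

Lemma Pi2_pred_all (Q : (nat -> M) -> M -> Prop) :
  Pi2_pred (fun rho => Q (tl rho) (rho 0)) -> Pi2_pred (fun rho => forall x, Q rho x).
Proof.
  intros (p & Sp & H). exists (All p). split; [now apply Pi_All|]. intro rho. cbn.
  split; intros G x; apply (H (scons x rho)); auto.
Qed.

Lemma Pi2_definable_of_pred (P : M -> Prop) a :
  Pi2_pred (fun rho => P (rho 0)) -> (forall x, P x <-> x = a) -> Pi2_definable a.
Proof.
  intros (p & Pp & H) E. exists (rename (fun _ => 0) p). split; [now apply Pi_rename|]. split.
  - destruct (free_below_exists p) as [n Hn]. apply (free_below_rename p n); auto.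
  - intro x. rewrite sat_rename, H. apply E.
Qed.

Lemma Dfn_defines (C : M -> Prop) (a : M) :
  (exists p l, Forall C l /\ defines p l a) <-> Dfn any_formula C (fun rho => rho 0 = a).
Proof.
  split.
  - intros (p & l & Cl & Fp & H).
    apply (Dfn_ext (fun rho => sat (tenv ((fun rho => rho 0) :: map (fun a _ => a) l) rho) p)).
    + intro rho. rewrite <- H. apply (sat_free_below p _ _ _ Fp). intros [|i] Hi; [reflexivity|].
      cbn in Hi |- *. clear - Hi. revert i Hi. generalize (rho 0). intro d.
      induction l as [|b l IH]; intros i Hi; [cbn in Hi; lia|].
      destruct i; cbn; auto. apply IH. cbn in Hi. lia.
    + apply Dfn_fml; [exact I|]. constructor; [tm|]. apply Forall_map.
      eapply Forall_impl; [|exact Cl]. intros b Cb. right. exists b. auto.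
  - intros (p & l & _ & Cl & H).
    exists (rename (fun i => if i <? length l then S i else 0) p), l. split; [exact Cl|]. split.
    + destruct (free_below_exists p) as [n Hn]. apply (free_below_rename p n); auto.
      intros i _. destruct (Nat.ltb_spec i (length l)); lia.
    + intro x. rewrite sat_rename, <- (H (fun _ => x)). apply sat_ext. intro i.
      destruct (Nat.ltb_spec i (length l)) as [L|L].
      * rewrite (pre_lt l _ i x) by auto. reflexivity.
      * replace i with (length l + (i - length l)) by lia. rewrite pre_ge. reflexivity.
Qed.

Lemma ordinal_definable_Dfn (a : M) :
  ordinal_definable a <-> Dfn any_formula Ord (fun rho => rho 0 = a).
Proof. apply (Dfn_defines Ord a). Qed.

Lemma definable_Dfn (a : M) :
  definable a <-> Dfn any_formula (fun _ => False) (fun rho => rho 0 = a).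
Proof.
  rewrite <- Dfn_defines. split.
  - intros [p H]. exists p, []. auto.
  - intros (p & [|b l] & F & H); [exists p; auto|]. inversion F; contradiction.
Qed.
End Sigma1.

Ltac d0_step :=
  lazymatch goal with
  | |- Tm _ _ => tm
  | |- Dfn _ _ (fun rho => _ <-> _) => apply Dfn_iff
  | |- Dfn _ _ (fun rho => _ /\ _) => apply Dfn_and
  | |- Dfn _ _ (fun rho => _ \/ _) => apply Dfn_or
  | |- Dfn _ _ (fun rho => ~ _) => apply Dfn_not
  | |- Dfn _ _ (fun rho => _ ∊ _) => apply Dfn_mem
  | |- Dfn _ _ (fun rho => _ = _) => apply Dfn_eq
  | |- Dfn _ _ (fun rho => forall x, x ∊ _ -> _) => apply Dfn_ball
  | |- Dfn _ _ (fun rho => exists x, x ∊ _ /\ _) => apply Dfn_bex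
  | |- Dfn _ _ (fun rho => _ -> _) => apply Dfn_imp
  | |- Dfn _ _ _ => solve [auto 2 with d0 nocore]
  end; cbv beta.

Ltac d0 := cbv beta; repeat d0_step.

(** * A Pi_2-definable set without ordinal-definable elements *)

(* "x is some V_α": x belongs to a set h such that u = ⋃{P(u') : u' ∈ h ∩ u} for all u ∈ h. *)
Definition level_fml : fml :=
  Ex (BAll 0 (All (0 ∈ 1 ↔ BEx 2 (0 ∈ 2 ∧ is_subset 1 0))) ∧ 1 ∈ 0)%fml.

Section Levels.
Context {M : structure} {HZF : ZF_model M}.
Implicit Types a b e h u v w x y z A B : M.

(** A member of a history is computed from the earlier members alone, without ordinals or functions.
    This keeps the notion absolute for transitive sets that contain all subsets of their members. *)
Definition history h : Prop :=
  forall u, u ∊ h -> forall y, y ∊ u <-> exists w, w ∊ h /\ w ∊ u /\ Sub y w.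

Definition level x : Prop := exists h, history h /\ x ∊ h.

Lemma sat_level rho : sat rho level_fml <-> level (rho 0).
Proof. reflexivity. Qed.

Lemma level_V a : Ord a -> level (V a).
Proof.
  intro Oa. exists (rep (suc a) V).
  assert (E : forall z, z ∊ rep (suc a) V <-> exists b, b ∊ suc a /\ z = V b)
    by (intro z; apply repE, Dfn_V_graph).
  assert (Os : Ord (suc a)) by now apply Ord_suc.
  split; [|apply E; exists a; split; auto; apply sucE; auto].
  intros u Hu y. apply E in Hu as (b & Hb & ->). assert (Ob : Ord b) by eauto using Ord_mem. split.
  - intro Hy. apply VE in Hy as (c & Hc & S); auto. exists (V c).
    split; [apply E; exists c; eauto using Ord_trans|]. auto using V_in.
  - intros (w & _ & Hw & S). eapply V_super; eauto.
Qed.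

(** For [rk y] below [rk u], the set [u] is not included in [V (rk y)], so some earlier level [u']
    has rank at least [rk y]; it includes [y], which puts [y] into [u]. *)
Lemma history_V h : history h -> forall u, u ∊ h -> u = V (rk u).
Proof.
  intros H u. pattern u. revert u. apply set_ind; [dfn|]. intros u IH Hu.
  apply ext. intro y. rewrite in_V_rk by apply Ord_rk. split; [apply rk_mem|]. intro L.
  destruct (rk_spec u) as (Ou & _ & Lu). destruct (rk_spec y) as (Oy & Sy & _).
  specialize (Lu _ L). apply not_all_ex_not in Lu as [w Lu]. apply imply_to_and in Lu as [Hw Nw].
  apply (H u Hu) in Hw as (u' & Hu' & Huu & S). apply (H u Hu). exists u'. split; auto. split; auto.
  pose proof (IH u' Huu Hu') as E.
  destruct (Ord_tri (rk y) (rk u') Oy (Ord_rk _)) as [G|[G|G]].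
  - rewrite E. intros z Hz. apply (V_mono (rk u') (rk y)); auto using Ord_rk.
  - rewrite E, <- G. exact Sy.
  - destruct Nw. apply VE; auto. exists (rk u'). rewrite <- E. auto.
Qed.

(** The same rank comparison with the covering levels in place of a history; transitivity brings the
    elements of these levels into [v]. *)
Lemma V_of_cover v : Trans v -> (forall x, x ∊ v -> exists u, u ∊ v /\ u = V (rk u) /\ x ∊ u) -> v = V (rk v).
Proof.
  intros T C. apply ext. intro y. rewrite in_V_rk by apply Ord_rk. split; [apply rk_mem|]. intro L.
  destruct (rk_spec v) as (Ov & _ & Lv). destruct (rk_spec y) as (Oy & Sy & _).
  specialize (Lv _ L). apply not_all_ex_not in Lv as [w Lv]. apply imply_to_and in Lv as [Hw Nw].
  destruct (C w Hw) as (u & Hu & E & Hwu). apply (T u Hu). rewrite E in Hwu |- *.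
  rewrite in_V_rk in Nw, Hwu |- * by auto using Ord_rk.
  destruct (Ord_tri (rk y) (rk w) Oy (Ord_rk _)) as [G|[G|G]]; [eauto using Ord_trans, Ord_rk| |tauto].
  now rewrite G.
Qed.

(** * Allowed levels *)

Section Relativized.
Variable lt_fml : fml.
Hypothesis sat_lt : forall rho : nat -> M, sat rho lt_fml <-> od_lt (rho 0) (rho 1).

Definition inV v a (p : fml) : Prop := a ∊ v /\ sat_in v (fun _ => a) p.

Definition ltV v a b : Prop := sat_in v (scons a (fun _ => b)) lt_fml.

(* [v] is some V_λ in which the relativized OD-order well-orders the relativized
   class OD; the subsets [y] of [v] range over all sets. *)
Definition allow v y : Prop :=
  Trans v /\ (forall u, u ∊ v -> (forall z, z ∊ y -> z ∊ u) -> y ∊ v) /\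
  (forall x, x ∊ v -> exists u, u ∊ v /\ inV v u level_fml /\ x ∊ u) /\
  (forall a, a ∊ v -> forall b, b ∊ v -> ltV v a b -> ~ ltV v b a) /\
  ((exists z, z ∊ y /\ z = z) -> (forall z, z ∊ y -> inV v z (is_OD 0)) ->
   exists a, a ∊ y /\ forall b, b ∊ y -> b = a \/ ltV v a b).

Definition allowed v : Prop := forall y, allow v y.

Lemma D0_inV C (s t : (nat -> M) -> M) p : Tm C s -> Tm C t ->
  Dfn Delta0 C (fun rho => inV (s rho) (t rho) p).
Proof.
  intros Hs Ht. apply Dfn_and; [now apply Dfn_mem|].
  apply (Dfn_ext (fun rho => sat (tenv [s; t] rho) (relativize 0 (rename (fun _ => 1) p)))).
  - intro rho. rewrite sat_relativize, sat_in_rename. reflexivity.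
  - apply Dfn_fml; [apply Delta0_relativize|auto].
Qed.

Lemma D0_ltV C (s t u : (nat -> M) -> M) : Tm C s -> Tm C t -> Tm C u ->
  Dfn Delta0 C (fun rho => ltV (s rho) (t rho) (u rho)).
Proof.
  intros Hs Ht Hu. unfold ltV.
  apply (Dfn_ext (fun rho => sat (tenv [s; t; u] rho)
    (relativize 0 (rename (fun i => match i with 0 => 1 | S _ => 2 end) lt_fml)))).
  - intro rho. rewrite sat_relativize, sat_in_rename.
    replace (scons (t rho) (fun _ => u rho)) with
      (fun i => tenv [s; t; u] rho match i with 0 => 1 | S _ => 2 end); [reflexivity|].
    apply functional_extensionality. intros [|i]; reflexivity.
  - apply Dfn_fml; [apply Delta0_relativize|auto].
Qed.

Hint Extern 0 (Dfn _ _ (fun rho => inV _ _ _)) => simple apply D0_inV; tm : d0.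
Hint Extern 0 (Dfn _ _ (fun rho => ltV _ _ _)) => simple apply D0_ltV; tm : d0.

(** Every quantifier in [allow] is bounded; the conjunct z = z gives nonemptiness the syntactic form
    of a bounded quantifier. Hence [allowed] is Pi_1. *)
Lemma D0_allow C (s t : (nat -> M) -> M) : Tm C s -> Tm C t ->
  Dfn Delta0 C (fun rho => allow (s rho) (t rho)).
Proof.
  intros Hs Ht. apply (Dfn_subst (fun rho => allow (rho 0) (rho 1)) [s; t]); [|auto].
  unfold allow, Trans. d0.
Qed.

Hint Extern 0 (Dfn _ _ (fun rho => allow _ _)) => simple apply D0_allow; tm : d0.

Lemma Dfn_inV C (s t : (nat -> M) -> M) p : DTm C s -> DTm C t ->
  Dfn any_formula C (fun rho => inV (s rho) (t rho) p).
Proof. apply (Dfn_app2 (fun x y => inV x y p)). apply (Dfn_weaken (K := Delta0) (C := C)); auto. apply D0_inV; tm. Qed.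

Lemma Dfn_ltV C (s t u : (nat -> M) -> M) : DTm C s -> DTm C t -> DTm C u ->
  Dfn any_formula C (fun rho => ltV (s rho) (t rho) (u rho)).
Proof. apply (Dfn_app3 ltV). apply (Dfn_weaken (K := Delta0) (C := C)); auto. apply D0_ltV; tm. Qed.

Lemma Dfn_allowed C (s : (nat -> M) -> M) : DTm C s ->
  Dfn any_formula C (fun rho => allowed (s rho)).
Proof.
  apply (Dfn_app1 allowed). apply Dfn_all. apply (Dfn_weaken (K := Delta0) (C := C)); auto. apply D0_allow; tm.
Qed.

Hint Extern 0 (Dfn _ _ (fun rho => inV _ _ _)) => simple apply Dfn_inV : dfn.
Hint Extern 0 (Dfn _ _ (fun rho => ltV _ _ _)) => simple apply Dfn_ltV : dfn.
Hint Extern 0 (Dfn _ _ (fun rho => allowed _)) => simple apply Dfn_allowed : dfn.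

(** A history in the sense of [v] is a true one. For y in [v] both readings agree, and for y outside
    [v] both sides of the equivalence fail, as [v] is transitive and contains all subsets of its
    members. *)
Lemma inV_level v u : allowed v -> inV v u level_fml -> u = V (rk u).
Proof.
  intros Av [Hu (h & Hh & H & Huh)]. cbn in *.
  destruct (Av v) as (T & _). assert (Sv : forall y w, w ∊ v -> Sub y w -> y ∊ v).
  { intros y w Hw S. destruct (Av y) as (_ & G & _). eauto. }
  apply (history_V h); auto. intros x Hx y.
  assert (Hxv : x ∊ v) by (eapply T; eauto).
  destruct (classic (y ∊ v)) as [Hy|Ny].
  - specialize (H x Hxv Hx y Hy) as [H1 H2]. split.
    + intro G. destruct (H1 G) as (w & Hw & Hwh & Hwx & S). exists w. split; auto. split; auto.
      intros z Hz. apply S; auto. eapply T; eauto.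
    + intros (w & Hwh & Hwx & S). apply H2. exists w.
      refine (conj (T x Hxv w Hwx) (conj Hwh (conj Hwx _))). intros z _ Hz. auto.
  - split; [intro G; destruct Ny; eapply T; eauto|].
    intros (w & Hwh & Hwx & S). destruct Ny. apply (Sv y w); auto. eapply T; eauto.
Qed.

Lemma allowed_V v : allowed v -> v = V (rk v).
Proof.
  intro Av. destruct (Av v) as (T & _ & C & _). apply V_of_cover; auto.
  intros x Hx. destruct (C x Hx) as (u & Hu & L & Hxu). exists u. split; auto. split; auto.
  now apply (inV_level v).
Qed.

(* The least element that is not OD would be definable from the rank of [v]. *)
Lemma allowed_sound v a : allowed v -> inV v a (is_OD 0) -> OD a.
Proof.
  intros Av Ha. apply NNPP. intro Na.
  assert (Ev := allowed_V v Av). assert (Ol := Ord_rk v). revert Ev Ol. generalize (rk v). intros lam Ev Ol.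
  set (Y := sep v (fun x => inV v x (is_OD 0) /\ ~ OD x)).
  assert (EY : forall x, x ∊ Y <-> inV v x (is_OD 0) /\ ~ OD x).
  { intro x. unfold Y. rewrite sepE by dfn. unfold inV. tauto. }
  destruct (Av Y) as (_ & _ & _ & As & W).
  destruct W as (b & Hb & Lb).
  - exists a. split; auto. apply EY. auto.
  - intros z Hz. now apply EY.
  - apply EY in Hb as [Ib Nb]. apply Nb, OD_of_Dfn.
    (* The definition of [b] mentions true OD, which is a formula over [M]; asymmetry of the
       relativized order makes the least element unique. *)
    apply (Dfn_ext (fun rho => (inV (V lam) (rho 0) (is_OD 0) /\ ~ OD (rho 0)) /\
       forall c, inV (V lam) c (is_OD 0) /\ ~ OD c -> c = rho 0 \/ ltV (V lam) (rho 0) c)).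
    + intro rho. rewrite <- Ev. split.
      * intros [Hr Lr]. destruct (Lr b (conj Ib Nb)) as [E|G]; [auto|].
        destruct (Lb (rho 0)) as [E|G']; [now apply EY|auto|].
        destruct (As (rho 0) (proj1 (proj1 Hr)) b (proj1 Ib) G G').
      * intros ->. split; auto. intros c Hc. apply Lb. now apply EY.
    + dfn.
Qed.

Lemma reflecting_allowed lam : Ord lam ->
  (forall p, In p [is_OD 0; lt_fml; level_fml] -> reflects (V lam) p) ->
  (forall x, x ∊ V lam -> exists u, u ∊ V lam /\ level u /\ x ∊ u) ->
  allowed (V lam) /\
  (forall x, x ∊ V lam -> inV (V lam) x (is_OD 0) <-> OD x) /\
  (forall x, x ∊ V lam -> inV (V lam) x level_fml <-> level x).
Proof.
  intros Ol R C.
  assert (E1 : forall x, x ∊ V lam -> inV (V lam) x (is_OD 0) <-> OD x).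
  { intros x Hx. unfold inV. rewrite (R (is_OD 0) (or_introl eq_refl) (fun _ => x)) by auto.
    rewrite sat_is_OD. tauto. }
  assert (E2 : forall x, x ∊ V lam -> inV (V lam) x level_fml <-> level x).
  { intros x Hx. unfold inV. rewrite (R level_fml (or_intror (or_intror (or_introl eq_refl))) (fun _ => x)) by auto.
    rewrite sat_level. tauto. }
  assert (E3 : forall a b, a ∊ V lam -> b ∊ V lam -> ltV (V lam) a b <-> od_lt a b).
  { intros a b Ha Hb. unfold ltV.
    rewrite (R lt_fml (or_intror (or_introl eq_refl)) (scons a (fun _ => b))) by (intros [|i]; cbn; auto).
    rewrite sat_lt. reflexivity. }
  split; [|auto]. intro y. split; [|split; [|split; [|split]]].
  - now apply V_trans.
  - intros u Hu S. eapply V_super; eauto.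
  - intros x Hx. destruct (C x Hx) as (u & Hu & L & Hxu). exists u. rewrite E2; auto.
  - intros a Ha b Hb. rewrite !E3 by auto. apply od_lt_asym.
  - intros (z & Hz & _) Hy. assert (Hv : forall z, z ∊ y -> z ∊ V lam) by (intros w Hw; now apply Hy).
    destruct (od_lt_min (fun x => x ∊ y) z) as (a & Ha & La); auto.
    { dfn. }
    { intros w Hw. apply E1; auto. }
    exists a. split; auto. intros b Hb. rewrite E3; auto.
Qed.

Lemma allowed_unbounded a : Ord a -> exists lam, Ord lam /\ a ∊ lam /\ allowed (V lam) /\
  (forall x, x ∊ V lam -> inV (V lam) x (is_OD 0) <-> OD x) /\
  (forall x, x ∊ V lam -> inV (V lam) x level_fml <-> level x).
Proof.
  intro Oa.
  (* That every set lies in a level is made a formula and reflected too, so that the covering level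
     is found inside [V lam]. *)
  set (cover := (Ex (rename (fun i => match i with 0 => 0 | S i => S (S i) end) level_fml ∧ 1 ∈ 0))%fml).
  destruct (reflection [is_OD 0; lt_fml; level_fml; cover] a Oa) as (lam & Ol & Ha & R).
  exists lam. split; auto. split; auto. apply reflecting_allowed; auto.
  - intros p Hp. apply R. cbn in *. tauto.
  - intros x Hx.
    destruct (proj2 (R cover (or_intror (or_intror (or_intror (or_introl eq_refl)))) (fun _ => x) (fun _ => Hx)))
      as (u & Hu & L & Hxu).
    + exists (V (suc (rk x))). assert (Or := Ord_rk x). split.
      * apply sat_rename, sat_level. now apply level_V, Ord_suc.
      * cbn. apply in_V_rk; [now apply Ord_suc|]. apply sucE. auto.
    + exists u. split; auto. split; auto.
      apply sat_in_rename in L.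
      apply (R level_fml (or_intror (or_intror (or_introl eq_refl)))) in L; [exact L|].
      intros [|i]; cbn; auto.
Qed.

(** * The Pi_2-definable set *)

Definition triple z v e a : Prop :=
  v ∊ z /\ e ∊ z /\ a ∊ z /\ forall t, t ∊ z -> t = v \/ t = e \/ t = a.

(* x = {{v, e, a} : a ∈ v, a ⊆ e, a ∉ OD^v}, where e is a level with e ⊆ OD^v *)
Definition coded_set x v e : Prop :=
  (exists z, z ∊ x /\ z = z) /\ inV v e level_fml /\
  (forall b, b ∊ e -> inV v b (is_OD 0)) /\
  (forall z, z ∊ x -> exists a, a ∊ v /\ triple z v e a /\ (forall w, w ∊ a -> w ∊ e) /\ ~ inV v a (is_OD 0)) /\
  (forall a, a ∊ v -> (forall w, w ∊ a -> w ∊ e) -> ~ inV v a (is_OD 0) -> exists z, z ∊ x /\ triple z v e a).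

(* The last two clauses say that no a is OD and that v is least. *)
Definition defining x : Prop :=
  forall v e y u a,
    (exists v', exists e', coded_set x v' e') /\
    (coded_set x v e -> allow v y) /\
    (coded_set x v e /\ a ∊ v /\ (forall w, w ∊ a -> w ∊ e) /\ ~ inV v a (is_OD 0) /\ inV u a (is_OD 0) ->
       exists y', ~ allow u y') /\
    (coded_set x v e /\ u ∊ v /\ inV u e level_fml /\ (forall b, b ∊ e -> inV u b (is_OD 0)) /\
     (forall a, a ∊ v -> (forall w, w ∊ a -> w ∊ e) -> inV v a (is_OD 0) -> inV u a (is_OD 0)) ->
       exists y', ~ allow u y').

Lemma D0_coded_set C (s t u : (nat -> M) -> M) : Tm C s -> Tm C t -> Tm C u ->
  Dfn Delta0 C (fun rho => coded_set (s rho) (t rho) (u rho)).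
Proof.
  intros Hs Ht Hu. apply (Dfn_subst (fun rho => coded_set (rho 0) (rho 1) (rho 2)) [s; t; u]); [|auto].
  unfold coded_set, triple. d0.
Qed.

Hint Extern 0 (Dfn _ _ (fun rho => coded_set _ _ _)) => simple apply D0_coded_set; tm : d0.

(** Five universal quantifiers stand in front of a Sigma_1 matrix: [coded_set] and [allow] are
    Delta_0, and failing to be allowed costs one existential quantifier. *)
Lemma Pi2_pred_defining : Pi2_pred (fun rho : nat -> M => defining (rho 0)).
Proof.
  unfold defining. do 5 apply Pi2_pred_all. apply Pi2_pred_Sigma1. cbv beta.
  apply Sigma1_pred_and; [apply Sigma1_pred_ex, Sigma1_pred_ex, Sigma1_pred_D0; d0|].
  apply Sigma1_pred_and; [apply Sigma1_pred_D0; d0|].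
  apply Sigma1_pred_and; (apply Sigma1_pred_imp_D0; [apply Sigma1_pred_ex, Sigma1_pred_D0|]; d0).
Qed.

(** [v] is recognized as the member of [z] to which the others belong, and [e] as the larger of the
    remaining two under inclusion. *)
Lemma triple_inj z v e a v' e' a' :
  triple z v e a -> triple z v' e' a' -> e ∊ v -> a ∊ v -> e' ∊ v' -> a' ∊ v' ->
  Sub a e -> Sub a' e' -> v = v' /\ e = e'.
Proof.
  intros (Hv & He & Ha & H) (Hv' & He' & Ha' & H') Lv La Lv' La' S S'.
  assert (E : v = v').
  { destruct (H' v Hv) as [E|E]; [auto|exfalso].
    assert (G : v ∊ v') by (destruct E; subst; auto).
    destruct (H v' Hv') as [E'|E'].
    - rewrite E' in G. now apply mem_irrefl in G.
    - assert (G' : v' ∊ v) by (destruct E'; subst; auto). now destruct (mem_asym _ _ G). }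
  subst v'. split; auto.
  destruct (H' e He) as [E|[E|E]]; auto; [subst; now destruct (mem_irrefl _ Lv)|].
  destruct (H e' He') as [E'|[E'|E']]; auto; [subst; now destruct (mem_irrefl _ Lv')|].
  subst. apply ext. intro w. split; auto.
Qed.

Lemma triple_ext z z' v e a : triple z v e a -> triple z' v e a -> z = z'.
Proof.
  intros (Hv & He & Ha & H) (Hv' & He' & Ha' & H'). apply ext. intro t.
  split; intro Ht; [apply H in Ht|apply H' in Ht]; destruct Ht as [->|[->| ->]]; auto.
Qed.

Lemma coded_set_ext x x' v e : coded_set x v e -> coded_set x' v e -> x = x'.
Proof.
  intros (_ & _ & _ & H1 & H2) (_ & _ & _ & H1' & H2'). apply ext. intro z. split; intro Hz.
  - destruct (H1 z Hz) as (a & Ha & Ht & S & N). destruct (H2' a Ha S N) as (z' & Hz' & Ht').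
    now rewrite (triple_ext _ _ _ _ _ Ht Ht').
  - destruct (H1' z Hz) as (a & Ha & Ht & S & N). destruct (H2 a Ha S N) as (z' & Hz' & Ht').
    now rewrite (triple_ext _ _ _ _ _ Ht Ht').
Qed.

Lemma not_allowed u : allowed u -> ~ exists y, ~ allow u y.
Proof. intros A [y N]. apply N, A. Qed.

Lemma OD_in_allowed a : OD a -> exists u, allowed u /\ inV u a (is_OD 0).
Proof.
  intro Ha. destruct (allowed_unbounded (rk a) (Ord_rk a)) as (lam & Ol & L & Al & E & _).
  exists (V lam). split; auto. apply E; auto. now apply in_V_rk.
Qed.

Lemma Pi2_set : (exists a, ~ OD a) ->
  exists B, Pi2_definable B /\ (exists z, z ∊ B) /\ forall z, z ∊ B -> ~ ordinal_definable z.
Proof.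
  intros [a0 Na0].
  destruct (Ord_min (fun al => exists a, Sub a (V al) /\ ~ OD a) (rk a0)) as (al & Oal & (a1 & Sa1 & N1) & Lal).
  { dfn. }
  { apply Ord_rk. }
  { exists a0. split; auto. apply rk_spec. }
  set (e := V al).
  (* Elements of V_α are subsets of earlier levels, hence OD by the choice of α. *)
  assert (He : forall b, b ∊ e -> OD b).
  { intros b Hb. apply VE in Hb as (c & Hc & S); auto. apply NNPP. intro N. apply (Lal c Hc). eauto. }
  set (good := fun lam => allowed (V lam) /\ inV (V lam) e level_fml /\ (forall b, b ∊ e -> inV (V lam) b (is_OD 0)) /\
     forall a, Sub a e -> OD a -> inV (V lam) a (is_OD 0)).
  assert (G0 : exists lam, Ord lam /\ good lam).
  { destruct (allowed_unbounded al Oal) as (lam & Ol & L & Al & E & EL).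
    assert (Hin : e ∊ V lam) by (now apply V_in).
    exists lam. split; auto. split; auto. split; [|split].
    - apply EL; auto. now apply level_V.
    - intros b Hb. apply E; auto. eapply V_trans; eauto.
    - intros a S Oa. apply E; auto. eapply V_super; eauto. }
  destruct G0 as (lam0 & Ol0 & G0).
  destruct (Ord_min good lam0) as (lam & Ol & Gl & Ll); auto.
  { unfold good. dfn. }
  clear lam0 Ol0 G0. destruct Gl as (Al & Le & Ze & Zall). set (v := V lam) in *.
  assert (Tv : Trans v) by (now apply V_trans).
  assert (Hev : e ∊ v) by apply Le.
  assert (Sv : forall a, Sub a e -> a ∊ v) by (intros a S; eapply V_super; eauto).
  set (B := rep (sep v (fun a => Sub a e /\ ~ inV v a (is_OD 0))) (fun a => bun (upair v e) (upair a a))).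
  assert (EB : forall z, z ∊ B <-> exists a, Sub a e /\ ~ inV v a (is_OD 0) /\ z = bun (upair v e) (upair a a)).
  { intro z. unfold B. rewrite repE by dfn. split.
    - intros (a & Ha & ->). apply sepE in Ha as [_ [S N]]; [eauto|dfn].
    - intros (a & S & N & ->). exists a. split; auto. apply sepE; [dfn|auto]. }
  assert (Tr : forall a, triple (bun (upair v e) (upair a a)) v e a).
  { intro a. assert (E : forall t, t ∊ bun (upair v e) (upair a a) <-> t = v \/ t = e \/ t = a)
      by (intro t; rewrite bunE, !upairE; tauto).
    unfold triple. rewrite !E. split; [auto|]. split; [auto|]. split; [auto|]. intro t. apply E. }
  assert (CB : coded_set B v e).
  { split; [|split; [|split; [|split]]]; auto.
    - exists (bun (upair v e) (upair a1 a1)). split; auto. apply EB. exists a1. split; [auto|]. split; auto.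
      intro H. apply N1. eapply allowed_sound; eauto.
    - intros z Hz. apply EB in Hz as (a & S & N & ->). exists a. split; auto.
    - intros a Ha S N. exists (bun (upair v e) (upair a a)). split; auto. apply EB. eauto. }
  exists B. split; [|split].
  - apply (Pi2_definable_of_pred defining); [apply Pi2_pred_defining|]. intro x. split.
    + intro D.
      (* The first conjunct does not mention the five variables, so any instance will do. *)
      destruct (D v v v v v) as ((v' & e' & Cx) & _).
      assert (Av' : allowed v') by (intro y; destruct (D v' e' y v v) as (_ & H & _); auto).
      assert (Nu : forall a, a ∊ v' -> Sub a e' -> ~ inV v' a (is_OD 0) -> ~ OD a).
      { intros a Ha S N Oa. destruct (OD_in_allowed a Oa) as (u & Au & Hu).
        destruct (D v' e' v u a) as (_ & _ & H & _). apply (not_allowed u Au). apply H. auto. }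
      pose proof Cx as ((z & Hz & _) & Le' & Ze' & H1 & _).
      pose proof (allowed_V v' Av') as Ev'.
      pose proof (inV_level v' e' Av' Le') as Ee'.
      pose proof (Ord_rk v') as Ov'. pose proof (Ord_rk e') as Oe'.
      destruct (H1 z Hz) as (a & Ha & _ & S & N). pose proof (Nu a Ha S N) as Na.
      (* A smaller [e'] would have the non-OD subset [a], against the choice of α. A larger one
         would have [a1] as an element, which soundness of the allowed level v' would make OD. *)
      assert (Eal : rk e' = al).
      { destruct (Ord_tri (rk e') al Oe' Oal) as [G|[G|G]]; auto; exfalso.
        - apply (Lal _ G). exists a. rewrite <- Ee'. auto.
        - apply N1. apply (allowed_sound v'); auto. apply Ze'. rewrite Ee'.
          apply VE; eauto. }
      assert (E : e' = e) by (rewrite Ee', Eal; reflexivity). subst e'.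
      assert (Tv' : Trans v') by (rewrite Ev'; now apply V_trans).
      assert (Sv' : forall b, Sub b e -> b ∊ v') by (intros b Sb; destruct (Av' b) as (_ & G & _); apply (G e); [apply Le'|auto]).
      assert (Gl' : good (rk v')).
      { unfold good. rewrite <- Ev'. split; auto. split; auto. split; auto.
        intros b Sb Ob. apply NNPP. intro Nb. apply (Nu b); auto. }
      (* Leastness of [lam] excludes a smaller v'. If [v] were an element of v', the leastness
         clause with u = [v] would deny that [v] is allowed; its premise on subsets of e holds by
         soundness of v' and by [Zall]. *)
      assert (Elam : rk v' = lam).
      { destruct (Ord_tri (rk v') lam Ov' Ol) as [G|[G|G]]; auto; exfalso.
        - now apply (Ll _ G).
        - destruct (D v' e v v v) as (_ & _ & _ & H). apply (not_allowed v Al). apply H.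
          split; auto. split; [rewrite Ev'; now apply V_in|]. split; auto. split; auto.
          intros b Hb Sb Ob. apply Zall; auto. apply (allowed_sound v'); auto. }
      assert (E : v' = v) by (rewrite Ev', Elam; reflexivity). subst v'.
      apply (coded_set_ext x B v e); auto.
    + intros ->. intros v' e' y u a. split; [eauto|].
      (* [B] determines [v] and [e], so the universal clauses speak about this one pair only. *)
      assert (T' : coded_set B v' e' -> v' = v /\ e' = e).
      { intro C'. pose proof C' as ((z & Hz & _) & Le' & _ & H & _).
        destruct (H z Hz) as (b & Hb & Ht & S & _). apply EB in Hz as (c & Sc & _ & ->).
        destruct (triple_inj _ v' e' b v e c Ht (Tr c)); auto. apply Le'. }
      split; [|split].
      * intro C'. apply T' in C' as [-> ->]. apply Al.
      * intros (C' & Ha & S & N & Hu). apply T' in C' as [-> ->].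
        apply not_all_ex_not. intro Au. apply N, Zall; auto. apply (allowed_sound u); auto.
      * intros (C' & Huv & Lu & Zu & H). apply T' in C' as [-> ->].
        apply not_all_ex_not. intro Au. pose proof (allowed_V u Au) as Eu.
        apply (Ll (rk u)); [apply in_V_rk; auto|]. unfold good. rewrite <- Eu.
        split; auto 6.
  - exists (bun (upair v e) (upair a1 a1)). apply EB. exists a1. split; [auto|]. split; auto.
    intro H. apply N1. eapply allowed_sound; eauto.
  - intros z Hz Dz. apply EB in Hz as (a & S & N & Ez). apply ordinal_definable_Dfn in Dz.
    assert (Na : ~ OD a) by (intro Oa; apply N, Zall; auto).
    assert (Hae : a <> e).
    { intros ->. apply Na, OD_of_Dfn. unfold e. dfn. }
    assert (Hav : a <> v) by (intros ->; apply (mem_irrefl v); auto).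
    (* An ordinal definition of [z] would yield one of [a], as the only member of [z] other than
       [V lam] and [V al]. *)
    apply Na, OD_of_Dfn.
    apply (Dfn_ext (fun rho => exists z', z' = z /\ rho 0 ∊ z' /\ rho 0 <> V lam /\ rho 0 <> V al)).
    + intro rho. fold v e. split.
      * intros (z' & -> & Hr & Nv & Ne). subst z. destruct (Tr a) as (_ & _ & _ & H).
        destruct (H _ Hr) as [E|[E|E]]; tauto.
      * intros ->. exists z. split; auto. split; auto. subst z. apply (Tr a).
    + apply Dfn_ex. apply Dfn_and; [|dfn].
      exact (Dfn_reindex _ (fun i => i) Dz).
Qed.
End Relativized.
End Levels.

(** * Equivalences *)

Section Equivalences.
Context {M : structure} {HZF : ZF_model M}.
Implicit Types a b x y z : M.

Lemma od_lt_formula : exists p, free_below 2 p /\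
  forall rho : nat -> M, sat rho p <-> od_lt (rho 0) (rho 1).
Proof.
  destruct (Dfn_od_lt (fun _ : M => False) (fun rho => rho 0) (fun rho => rho 1)) as (p & l & _ & F & H);
    [auto with dfn..|].
  destruct l as [|a l]; [|inversion F; contradiction]. cbn in H.
  exists (rename (fun i => match i with 0 => 0 | S _ => 1 end) p). split.
  - destruct (free_below_exists p) as [n Hn]. apply (free_below_rename p n); auto.
    intros [|i] _; lia.
  - intro rho. rewrite sat_rename, H. tauto.
Qed.

Lemma V_eq_HOD_iff : models M V_eq_HOD <-> forall a, OD a.
Proof.
  split.
  - intros H a. specialize (H (fun _ => a) a a). apply sat_is_OD in H; [exact H|].
    intros t [_ Ha]. exact Ha.
  - intros H rho a x _. apply sat_is_OD. apply H.
Qed.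

Lemma sat_at2 p (rho : nat -> M) (x y k : nat) : free_below 2 p ->
  sat rho (at2 p x y k) <-> sat (scons (rho x) (fun _ => rho y)) p.
Proof.
  intro F. unfold at2. rewrite sat_rename. apply (sat_free_below p 2); auto.
  intros [|[|i]] Hi; [reflexivity|reflexivity|lia].
Qed.

Lemma well_order_of_OD : (forall a, OD a) -> has_definable_well_ordering M.
Proof.
  intro HOD. destruct od_lt_formula as (p & F & H). exists p. split; auto.
  assert (E : forall (rho : nat -> M) (x y k : nat), sat rho (at2 p x y k) <-> od_lt (rho x) (rho y))
    by (intros; rewrite sat_at2, H by auto; reflexivity).
  assert (Min : forall A z, z ∊ A -> exists y, y ∊ A /\ forall w, w ∊ A -> w = y \/ od_lt y w).
  { intros A z Hz. apply (od_lt_min (fun x => x ∊ A) z); auto. dfn. }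
  (* Linearity comes from the least element of {x, y}. *)
  assert (Tot : forall x y, od_lt x y \/ x = y \/ od_lt y x).
  { intros x y. destruct (Min (upair x y) x) as (z & Hz & L); [apply upairE; auto|].
    apply upairE in Hz as [-> | ->].
    - destruct (L y); [apply upairE| |]; auto.
    - destruct (L x); [apply upairE| |]; auto. }
  intro rho. split; [|split; [|split]].
  - intros a G. apply E in G. now apply (od_lt_asym a a).
  - intros x y z [G1 G2]. apply E in G1, G2. apply E. cbn in *.
    destruct (Tot x z) as [G|[G|G]]; auto; exfalso.
    + subst z. now apply (od_lt_asym x y).
    (* A cycle of length three would leave {x, y, z} without a least element. *)
    + destruct (Min (bun (upair x y) (upair z z)) x) as (w & Hw & L).
      { apply bunE. left. apply upairE. auto. }
      assert (EA : forall u, u ∊ bun (upair x y) (upair z z) <-> u = x \/ u = y \/ u = z)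
        by (intro u; rewrite bunE, !upairE; tauto).
      setoid_rewrite EA in L. apply EA in Hw as [->|[->| ->]].
      * destruct (L z) as [->|L']; auto; [now apply (od_lt_asym x x)|now apply (od_lt_asym x z)].
      * destruct (L x) as [->|L']; auto; [now apply (od_lt_asym y y)|now apply (od_lt_asym x y)].
      * destruct (L y) as [->|L']; auto; [now apply (od_lt_asym z z)|now apply (od_lt_asym y z)].
  - intros x y. destruct (Tot x y) as [G|[G|G]];
      [left; apply E|right; left|right; right; apply E]; exact G.
  - intros A [z Hz]. destruct (Min A z Hz) as (y & Hy & L). exists y. split; auto.
    intros w Hw. destruct (L w Hw) as [G|G]; [left; exact G|right; apply E; exact G].
Qed.

(** The least element of [a] is definable from the parameters that define [a], since the
    well-ordering adds none. An arbitrary [C] covers both the definable and the ordinal-definable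
    case. *)
Lemma definable_min : has_definable_well_ordering M ->
  forall (C : M -> Prop) a, Dfn any_formula C (fun rho => rho 0 = a) -> (exists x, x ∊ a) ->
  exists x, x ∊ a /\ Dfn any_formula C (fun rho => rho 0 = x).
Proof.
  intros (p & F & H) C a D Ne.
  set (R := fun x y : M => sat (scons x (fun _ => y)) p).
  assert (DR : Dfn any_formula C (fun rho => R (rho 0) (rho 1))).
  { unfold R. refine (Dfn_ext _ _ _ (Dfn_reindex _ (fun i => match i with 0 => 0 | S _ => 1 end) (Dfn_sat C p))).
    intro rho. apply sat_ext. intros [|i]; reflexivity. }
  destruct (H (fun _ => a)) as (Irr & Tra & _ & Min).
  destruct (Min a Ne) as (x & Hx & Lx). cbn in Hx.
  assert (Lx' : forall y, y ∊ a -> y = x \/ R x y).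
  { intros y Hy. destruct (Lx y Hy) as [G|G]; [auto|right]. now apply (sat_at2 p _ 1 0 3 F) in G. }
  exists x. split; auto.
  apply (Dfn_ext (fun rho => exists b, b = a /\ rho 0 ∊ b /\ forall y, y ∊ b -> y = rho 0 \/ R (rho 0) y)).
  - intro rho. split.
    + intros (b & -> & Hr & Lr). destruct (Lx' _ Hr) as [E|G]; auto.
      destruct (Lr x Hx) as [E|G']; auto. exfalso.
      apply (Irr x). apply (sat_at2 p _ 0 0 1 F).
      assert (T := Tra x (rho 0) x). cbn in T. rewrite !sat_at2 in T by auto. apply T. auto.
    + intros ->. exists a. auto.
  - apply Dfn_ex. apply Dfn_and; [exact (Dfn_reindex _ (fun i => i) D)|].
    dfn. apply (Dfn_app2 R); auto with dfn.
Qed.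

Lemma choice_of_OD : (forall a, OD a) -> models M ax_choice.
Proof.
  intros HOD rho A HA. cbn in HA.
  set (f := sep (cart A (union A)) (fun z => exists x y, z = opr x y /\ y ∊ x /\ forall w, w ∊ x -> w = y \/ od_lt y w)).
  assert (Ef : forall x y, opr x y ∊ f <-> x ∊ A /\ y ∊ x /\ forall w, w ∊ x -> w = y \/ od_lt y w).
  { intros x y. unfold f. rewrite sepE by dfn. rewrite cartE. split.
    - intros [(x1 & Hx1 & y1 & _ & E1) (x2 & y2 & E2 & H)].
      apply opr_inj in E1 as [<- <-]. apply opr_inj in E2 as [<- <-]. auto.
    - intros (Hx & Hy & L). split; [|eauto 6]. exists x. split; auto. exists y. split; auto.
      apply unionE. eauto. }
  assert (Ex : forall x, x ∊ A -> exists y, opr x y ∊ f /\ y ∊ x).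
  { intros x Hx. destruct (HA x Hx) as [z Hz].
    destruct (od_lt_min (fun w => w ∊ x) z) as (y & Hy & L); auto; [dfn|].
    exists y. rewrite Ef. auto. }
  exists f. split.
  - apply sat_is_fun. split.
    + intros z Hz. unfold f in Hz. apply sepE in Hz as [Hz _]; [|dfn].
      apply cartE in Hz as (x & Hx & y & _ & ->). eauto.
    + intros x Hx. destruct (Ex x Hx) as (y & Hy & _). exists y. split; auto. intros y' Hy'.
      apply Ef in Hy as (_ & Hy & L), Hy' as (_ & Hy' & L').
      destruct (L y' Hy') as [E|G]; auto. destruct (L' y Hy) as [E|G']; auto.
      now destruct (od_lt_asym _ _ G).
  - intros x Hx. destruct (Ex x Hx) as (y & Hy & Hyx). exists y. split; auto.
    apply sat_maps. exact Hy.
Qed.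

Lemma definable_ordinal_definable a : definable a -> ordinal_definable a.
Proof. intros [p H]. exists p, []. auto. Qed.

Lemma Pi2_definable_definable a : Pi2_definable a -> definable a.
Proof. intros (p & _ & H). exists p. exact H. Qed.

Lemma OD_of_Pi2_elements :
  every_nonempty_has_element M Pi2_definable ordinal_definable -> forall a, OD a.
Proof.
  intros H a. apply NNPP. intro N.
  destruct od_lt_formula as (p & _ & Hp).
  destruct (Pi2_set p Hp) as (B & DB & NB & HB); [eauto|].
  destruct (H B DB NB) as (z & Hz & Dz). now apply (HB z).
Qed.
End Equivalences.

Theorem theorem1 : forall (M : structure), models_theory M ZF ->
  let s1 := models_theory M ZFC /\ models M V_eq_HOD in
  let s2 := has_definable_well_ordering M in
  let s3 := every_nonempty_has_element M definable definable in
  let s4 := every_nonempty_has_element M definable ordinal_definable in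
  let s5 := every_nonempty_has_element M ordinal_definable ordinal_definable in
  let s6 := every_nonempty_has_element M Pi2_definable ordinal_definable in
  (s1 <-> s2) /\ (s1 <-> s3) /\ (s1 <-> s4) /\ (s1 <-> s5) /\ (s1 <-> s6).
Proof.
  intros M HZF s1 s2 s3 s4 s5 s6. change (ZF_model M) in HZF.
  (* The implications form the cycle (1), (2), (3), (4), (6), (1), with the detour from (2) through
     (5) to (4). *)
  assert (H12 : s1 -> s2) by (intros [_ H]; now apply well_order_of_OD, V_eq_HOD_iff).
  assert (H23 : s2 -> s3).
  { intros W a Da Ne. apply definable_Dfn in Da.
    destruct (definable_min W _ a Da Ne) as (x & Hx & Dx). exists x. now rewrite definable_Dfn. }
  assert (H25 : s2 -> s5).
  { intros W a Da Ne. apply ordinal_definable_Dfn in Da.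
    destruct (definable_min W _ a Da Ne) as (x & Hx & Dx). exists x. now rewrite ordinal_definable_Dfn. }
  assert (H34 : s3 -> s4).
  { intros H a Da Ne. destruct (H a Da Ne) as (x & Hx & Dx). exists x.
    auto using definable_ordinal_definable. }
  assert (H54 : s5 -> s4) by (intros H a Da; apply H; now apply definable_ordinal_definable).
  assert (H46 : s4 -> s6) by (intros H a Da; apply H; now apply Pi2_definable_definable).
  assert (H61 : s6 -> s1).
  { intro H. pose proof (OD_of_Pi2_elements H) as HOD. split; [|now apply V_eq_HOD_iff].
    intros p [Hp| ->]; [now apply HZF|now apply choice_of_OD]. }
  tauto.
Qed.
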